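(* Let $p_1<p_2$ be finite real numbers, $p_0\in(p_1,p_2)$, $c\in\mathbb{R}$, and $\psi(p):=-(p-p_0)^2+c$ on $[p_1,p_2]$. Let $\mu\in(0,1)$ and let $U(p)=(p-p_1)^{\mu-1}\tilde u(p)$ for $p\in(p_1,p_2]$, where $\tilde u\in\mathcal{C}^1([p_1,p_2],\mathbb{C})$, $\tilde u(p_1)\ne0$ and $U(p_2)=0$. For $\omega>0$ put $$I^{(1)}(\omega,p_0):=\int_{p_1}^{p_0}U(p)e^{i\omega\psi(p)}dp,\qquad I^{(2)}(\omega,p_0):=\int_{p_0}^{p_2}U(p)e^{i\omega\psi(p)}dp,$$ $$\tilde H(\omega,\psi,U):=\sqrt\pi\,e^{-i\frac\pi4}e^{i\omega c}\,\tilde u(p_0),\qquad\tilde K_\mu(\omega,\psi,U):=\frac{\Gamma(\mu)}{2^\mu}e^{i\frac{\pi\mu}2}e^{i\omega\psi(p_1)}\,\tilde u(p_1).$$ Let $\delta\in(\frac12,1)$ be arbitrary. Then for all $\omega>0$, with the constants $R^{(i)}_k(U)\ge0$ and exponents $\alpha_k^{(i)}\in\mathbb{R}$, $\beta_k^{(i)}>0$ listed in the context: $$\left|I^{(1)}(\omega,p_0)-\tilde K_\mu(\omega,\psi,U)(p_0-p_1)^{-\mu}\omega^{-\mu}-\tfrac12\tilde H(\omega,\psi,U)(p_0-p_1)^{\mu-1}\omega^{-\frac12}\right|\le\sum_{k=1}^6R_k^{(1)}(U)(p_0-p_1)^{-\alpha_k^{(1)}}\omega^{-\beta_k^{(1)}},$$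 $$\left|I^{(2)}(\omega,p_0)-\tfrac12\tilde H(\omega,\psi,U)(p_0-p_1)^{\mu-1}\omega^{-\frac12}\right|\le\sum_{k=1}^2R_k^{(2)}(U)(p_0-p_1)^{-\alpha_k^{(2)}}\omega^{-\beta_k^{(2)}}.$$
   Context: Given $\delta\in(\frac12,1)$ put $\gamma:=2\delta-1\in(0,1)$, let $K>0$ be the unique positive solution of $\frac{\sqrt\pi}2K^2-\frac12K-\frac{\sqrt\pi}4=0$, and $L:=\frac{\sqrt\pi}2K^\gamma$. Put $M_0:=\|\tilde u\|_{L^\infty(p_1,p_2)}$ and $M:=\|\tilde u\|_{W^{1,\infty}(p_1,p_2)}=\|\tilde u\|_{L^\infty(p_1,p_2)}+\|\tilde u'\|_{L^\infty(p_1,p_2)}$. Constants: $R_1^{(1)}(U)=\frac{2^{2-\mu}}\mu(2-\mu)M$, $R_2^{(1)}(U)=\frac{2^{1-\mu}}\mu M$, $R_3^{(1)}(U)=(1-\mu)\frac{2^{3-\mu}}3M_0$, $R_4^{(1)}(U)=\frac L{1-\gamma}2^{2-\mu}(1-\mu)M$, $R_5^{(1)}(U)=\frac L{1-\gamma}2^{1-\mu}M$, $R_6^{(1)}(U)=\frac{\sqrt\pi}{2^{\mu-2}}M_0$; $R_1^{(2)}(U)=\frac L{1-\gamma}(1-\mu)(p_2-p_1)^{1-\gamma}M$, $R_2^{(2)}(U)=\frac L{1-\gamma}(p_2-p_1)^{1-\gamma}M$. Exponents: $(\alpha_k^{(1)})_{k=1}^6=(2-\mu,\,1-\mu,\,4-\mu,\,1+\gamma-\mu,\,\gamma-\mu,\,3-\mu)$,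 $(\beta_k^{(1)})_{k=1}^6=(1,\,1,\,2,\,\delta,\,\delta,\,\frac32)$; $(\alpha_k^{(2)})_{k=1}^2=(2-\mu,\,1-\mu)$, $(\beta_k^{(2)})_{k=1}^2=(\delta,\,\delta)$. *)

(* Defs.v *)
From Stdlib Require Import Reals.
From Coquelicot Require Import Coquelicot.
Open Scope R_scope.

(** [cis t] is e^{it}. *)
Definition cis (t : R) : C := (cos t, sin t).

Definition Gamma (x : R) : R :=
  RInt_gen (fun t => Rpower t (x - 1) * exp (- t))
    (at_right 0) (Rbar_locally p_infty).

(** Lebesgue-null subsets of the real line. *)
Definition negligible (E : R -> Prop) : Prop :=
  forall eps : R, 0 < eps ->
  exists a b : nat -> R,
    (forall n, a n <= b n) /\
    (forall x, E x -> exists n, a n < x < b n) /\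
    ex_series (fun n => b n - a n) /\
    Series (fun n => b n - a n) <= eps.

(** Essential supremum of the modulus over (a,b).  The infimum is finite for
    essentially bounded functions; [real] would send +oo to 0. *)
Definition Linf_norm (a b : R) (f : R -> C) : R :=
  real (Glb_Rbar (fun c =>
    0 <= c /\ negligible (fun x => a < x < b /\ c < Cmod (f x)))).

Definition W1inf_norm (a b : R) (u du : R -> C) : R :=
  Linf_norm a b u + Linf_norm a b du.

(** [u] is of class C^1 on the compact interval [a,b] with derivative [du].
    The filter is the one of [is_derive] relativized to [a,b], so that the
    derivative is one-sided at the endpoints, and values outside [a,b] are
    irrelevant. *)
Definition C1_on (a b : R) (u du : R -> C) : Prop :=
  forall x, a <= x <= b ->
    filterdiff (K := R_AbsRing) (U := R_NormedModule) (V := C_R_NormedModule)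
      u (within (fun y => a <= y <= b) (locally x)) (fun h => scal h (du x)) /\
    filterlim du (within (fun y => a <= y <= b) (locally x)) (locally (du x)).

Definition psi (p0 c p : R) : R := - (p - p0) ^ 2 + c.

(** Meaningful for [p1 < p] only: [Rpower] takes an arbitrary value at 0. *)
Definition U (p1 mu : R) (u : R -> C) (p : R) : C :=
  (RtoC (Rpower (p - p1) (mu - 1)) * u p)%C.

Definition integrand (p1 p0 c mu w : R) (u : R -> C) (p : R) : C :=
  (U p1 mu u p * cis (w * psi p0 c p))%C.

(** Improper at the singular endpoint [p1], where the integrand is absolutely
    integrable and continuous on (p1,p0]. *)
Definition I1 (p1 p0 c mu w : R) (u : R -> C) : C :=
  RInt_gen (V := C_R_CompleteNormedModule) (integrand p1 p0 c mu w u)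
    (at_right p1) (at_point p0).

Definition I2 (p1 p2 p0 c mu w : R) (u : R -> C) : C :=
  RInt (V := C_R_CompleteNormedModule) (integrand p1 p0 c mu w u) p0 p2.

Definition Htilde (p0 c w : R) (u : R -> C) : C :=
  (RtoC (sqrt PI) * cis (- (PI / 4)) * cis (w * c) * u p0)%C.

Definition Ktilde (p1 p0 c mu w : R) (u : R -> C) : C :=
  (RtoC (Gamma mu / Rpower 2 mu) * cis (PI * mu / 2)
     * cis (w * psi p0 c p1) * u p1)%C.

(** The constants and exponents are indexed from 1; the value outside the
    stated range of indices is never used. *)
Definition Rcst1 (mu gam L M0 M : R) (k : nat) : R :=
  match k with
  | 1%nat => Rpower 2 (2 - mu) / mu * (2 - mu) * M
  | 2%nat => Rpower 2 (1 - mu) / mu * M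
  | 3%nat => (1 - mu) * (Rpower 2 (3 - mu) / 3) * M0
  | 4%nat => L / (1 - gam) * Rpower 2 (2 - mu) * (1 - mu) * M
  | 5%nat => L / (1 - gam) * Rpower 2 (1 - mu) * M
  | 6%nat => sqrt PI / Rpower 2 (mu - 2) * M0
  | _ => 0
  end.

Definition alpha1 (mu gam : R) (k : nat) : R :=
  match k with
  | 1%nat => 2 - mu
  | 2%nat => 1 - mu
  | 3%nat => 4 - mu
  | 4%nat => 1 + gam - mu
  | 5%nat => gam - mu
  | 6%nat => 3 - mu
  | _ => 0
  end.

Definition beta1 (delta : R) (k : nat) : R :=
  match k with
  | 1%nat => 1
  | 2%nat => 1
  | 3%nat => 2
  | 4%nat => delta
  | 5%nat => delta
  | 6%nat => 3 / 2
  | _ => 0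
  end.

Definition Rcst2 (p1 p2 mu gam L M : R) (k : nat) : R :=
  match k with
  | 1%nat => L / (1 - gam) * (1 - mu) * Rpower (p2 - p1) (1 - gam) * M
  | 2%nat => L / (1 - gam) * Rpower (p2 - p1) (1 - gam) * M
  | _ => 0
  end.

Definition alpha2 (mu : R) (k : nat) : R :=
  match k with
  | 1%nat => 2 - mu
  | 2%nat => 1 - mu
  | _ => 0
  end.

Definition beta2 (delta : R) (k : nat) : R :=
  match k with
  | 1%nat => delta
  | 2%nat => delta
  | _ => 0
  end.

(* Main.v *)
Require Import Defs.
From Stdlib Require Import Reals Lra Lia Psatz.
From Coquelicot Require Import Coquelicot.
Open Scope R_scope.

(** On each side of the stationary point the integrand is [k * B'] with [k] smooth and [B] a primitive of a model oscillatory function vanishing at infinity; one integration by parts yields the main term, and the remainder is bounded through [|B|] and [k'].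

    The model primitive is obtained by turning the path of integration by a quarter of a circle:
    [- int_s^oo z^(mu-1) e^(iz) dz = -i e^(is) int_0^oo (s + it)^(mu-1) e^(-t) dt].
    The right-hand side makes visible the value [- Gamma(mu) e^(i pi mu / 2)] at 0, the bounds [s^(mu-1)] and [Gamma(mu)], and the expansion [-i e^(is) s^(mu-1) + O(s^(mu-2))].  The Fresnel primitive at the stationary point is the case [mu = 1/2] after the change of variable [s = x^2].

    On (p1, p0) the singularity at [p1] and the stationary point at [p0] are separated at the midpoint, where the leading terms of the two boundary contributions cancel; their second-order parts give the terms of index 3 and 6. *)

(** * Complex-valued functions of a real variable *)

(** At the stationary point neither natural bound on the Fresnel primitive suffices: 1/(2x) is not
    integrable up to [p0], and the constant sqrt(pi)/2 makes the remainder as large as the main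
    term. Their interpolation x^(-gamma) with gamma < 1 is integrable, and since x = sqrt(w) |p -
    p0| it turns the prefactor w^(-1/2) into w^(-delta): hence gamma = 2 delta - 1. The equation for
    [K] serves to give K >= 1/sqrt(pi). At [p1] the bound s^(mu-1) is integrable as it stands,
    whence the order w^(-1). Remainders are bounded by a mean value inequality against a real
    majorant whose derivative may blow up at an endpoint, so no singular bound is ever integrated.
    Derivatives at the ends of [p1, p2] are one-sided in the hypotheses; a C^1 extension of [u] to
    the line removes this. The powers of 2 in the constants come from the midpoint, at distance (p0
    - p1)/2 from both critical points. The midpoint terms involve only values of [u], hence the
    factor [M0]; the remainders also involve its derivative, hence [M]. *)

Notation is_derC := (is_derive (K := R_AbsRing) (V := C_R_NormedModule)).
Notation contC := (continuous (T := R_UniformSpace) (U := C_R_NormedModule)).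
Notation RIntC := (RInt (V := C_R_CompleteNormedModule)).

Lemma norm_Cmod (z : C) : norm (V := C_R_NormedModule) z = Cmod z.
Proof.
change (sqrt (Rabs (fst z) ^ 2 + Rabs (snd z) ^ 2) = Cmod z).
unfold Cmod. now rewrite !pow2_abs.
Qed.

Lemma is_derC_pair (f g : R -> R) (x l m : R) :
  is_derive f x l -> is_derive g x m ->
  is_derC (fun t => (f t, g t)) x (l, m).
Proof.
intros Hf Hg.
apply filterdiff_ext_lin with (fun h : R => (scal h l, scal h m) : C).
2: intros h; reflexivity.
apply (filterdiff_comp'_2 (W := C_R_NormedModule) f g (fun a b => (a, b) : C) x
  (fun h => scal h l) (fun h => scal h m) (fun a b => (a, b) : C)).
- exact Hf.
- exact Hg.
- apply filterdiff_ext with (fun t : C_R_NormedModule => t).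
  { now intros []. }
  apply filterdiff_ext_lin with (fun t : C_R_NormedModule => t).
  2: now intros [].
  apply filterdiff_id.
Qed.

Lemma is_linear_fstC : is_linear (K := R_AbsRing) (U := C_R_NormedModule) (V := R_NormedModule) fst.
Proof. exact (is_linear_fst (K := R_AbsRing) (U := R_NormedModule) (V := R_NormedModule)). Qed.

Lemma is_linear_sndC : is_linear (K := R_AbsRing) (U := C_R_NormedModule) (V := R_NormedModule) snd.
Proof. exact (is_linear_snd (K := R_AbsRing) (U := R_NormedModule) (V := R_NormedModule)). Qed.

(** Reduces complex-valued calculus to the real rules; products, [cis] and conjugates are all
    handled this way. *)
Lemma is_derC_components (f : R -> C) (x : R) (l : C) :
  is_derC f x l <->
  is_derive (fun t => fst (f t)) x (fst l) /\ is_derive (fun t => snd (f t)) x (snd l).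
Proof.
split.
- intros H; split.
  + apply (filterdiff_ext_lin (U := R_NormedModule) _ (fun h : R => fst (scal h l : C_R_NormedModule))).
    2: reflexivity.
    apply (filterdiff_comp' (U := R_NormedModule) (V := C_R_NormedModule) f fst x).
    * exact H.
    * apply filterdiff_linear, is_linear_fstC.
  + apply (filterdiff_ext_lin (U := R_NormedModule) _ (fun h : R => snd (scal h l : C_R_NormedModule))).
    2: reflexivity.
    apply (filterdiff_comp' (U := R_NormedModule) (V := C_R_NormedModule) f snd x).
    * exact H.
    * apply filterdiff_linear, is_linear_sndC.
- intros [H1 H2]; destruct l as [l m].
  apply is_derive_ext with (2 := is_derC_pair _ _ _ _ _ H1 H2).
  intros t; now destruct (f t).
Qed.

Lemma contC_components (f : R -> C) (x : R) :
  contC f x <-> continuous (fun t => fst (f t)) x /\ continuous (fun t => snd (f t)) x.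
Proof.
split.
- intros H; split; apply (continuous_comp f _ x H).
  + apply (continuous_fst (U := R_UniformSpace) (V := R_UniformSpace)).
  + apply (continuous_snd (U := R_UniformSpace) (V := R_UniformSpace)).
- intros [H1 H2] P [eps HP].
  assert (K1 := proj1 (filterlim_locally _ _) H1 eps).
  assert (K2 := proj1 (filterlim_locally _ _) H2 eps).
  unfold filtermap; generalize (filter_and _ _ K1 K2); apply filter_imp.
  intros y [Hy1 Hy2]; apply HP; split; assumption.
Qed.

Lemma is_derC_mult (f g : R -> C) (x : R) (l m : C) :
  is_derC f x l -> is_derC g x m ->
  is_derC (fun t => (f t * g t)%C) x (l * g x + f x * m)%C.
Proof.
rewrite !is_derC_components; simpl.
intros [F1 F2] [G1 G2]; split.
- eapply filterdiff_ext_lin.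
  apply @filterdiff_minus_fct; [ typeclasses eauto | |].
  exact (is_derive_mult _ _ _ _ _ F1 G1 Rmult_comm).
  exact (is_derive_mult _ _ _ _ _ F2 G2 Rmult_comm).
  intros h; unfold minus, plus, opp, scal, mult; simpl; unfold mult; simpl; ring.
- eapply filterdiff_ext_lin.
  apply @filterdiff_plus_fct; [ typeclasses eauto | |].
  exact (is_derive_mult _ _ _ _ _ F1 G2 Rmult_comm).
  exact (is_derive_mult _ _ _ _ _ F2 G1 Rmult_comm).
  intros h; unfold minus, plus, opp, scal, mult; simpl; unfold mult; simpl; ring.
Qed.

Lemma contC_mult (f g : R -> C) (x : R) :
  contC f x -> contC g x -> contC (fun t => (f t * g t)%C) x.
Proof.
rewrite !contC_components; simpl.
intros [F1 F2] [G1 G2]; split.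
- apply (continuous_minus (V := R_NormedModule)); apply (continuous_mult (K := R_AbsRing)); assumption.
- apply (continuous_plus (V := R_NormedModule)); apply (continuous_mult (K := R_AbsRing)); assumption.
Qed.

Lemma is_derC_RtoC (f : R -> R) (x l : R) :
  is_derive f x l -> is_derC (fun t => RtoC (f t)) x (RtoC l).
Proof. intros H; apply is_derC_pair; [exact H | exact (is_derive_const (K := R_AbsRing) (V := R_NormedModule) 0 x)]. Qed.

Lemma contC_RtoC (f : R -> R) (x : R) :
  continuous f x -> contC (fun t => RtoC (f t)) x.
Proof. intros H; apply contC_components; split; [exact H | apply continuous_const]. Qed.

Lemma is_derC_cis (f : R -> R) (x l : R) :
  is_derive f x l -> is_derC (fun t => cis (f t)) x ((0, l) * cis (f x))%C.
Proof.
intros H; apply is_derC_components; simpl; split.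
- evar_last; [apply (is_derive_comp cos f); [apply is_derive_cos | exact H] |].
  unfold scal; simpl; unfold mult; simpl; ring.
- evar_last; [apply (is_derive_comp sin f); [apply is_derive_sin | exact H] |].
  unfold scal; simpl; unfold mult; simpl; ring.
Qed.

Lemma contC_cis (f : R -> R) (x : R) :
  continuous f x -> contC (fun t => cis (f t)) x.
Proof.
intros H; apply contC_components; simpl; split.
- apply (continuous_comp f cos); [exact H | apply continuous_cos].
- apply (continuous_comp f sin); [exact H | apply continuous_sin].
Qed.

Lemma Cmod_cis (t : R) : Cmod (cis t) = 1.
Proof.
unfold Cmod, cis; simpl.
replace (cos t * (cos t * 1) + sin t * (sin t * 1)) with 1 by (generalize (sin2_cos2 t); unfold Rsqr; lra).
apply sqrt_1.
Qed.

Lemma cis_plus (a b : R) : cis (a + b) = (cis a * cis b)%C.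
Proof. unfold cis, Cmult; simpl; rewrite cos_plus, sin_plus; f_equal; ring. Qed.

Lemma decreasing_of_derive_le_0 (f df : R -> R) (a b : R) :
  a <= b ->
  (forall x, a < x < b -> is_derive f x (df x)) ->
  (forall x, a <= x <= b -> continuous f x) ->
  (forall x, a < x < b -> df x <= 0) ->
  f b <= f a.
Proof.
intros Hab Df Cf Hle.
(* [MVT_gen] may return an endpoint as intermediate point, where [df] is not controlled; the value 0
   there keeps the sign. *)
pose (df' x := if Rlt_dec a x then if Rlt_dec x b then df x else 0 else 0).
destruct (MVT_gen f a b df') as [c [Hc E]].
- rewrite Rmin_left, Rmax_right by lra; intros x Hx; unfold df'.
  destruct (Rlt_dec a x); [|lra]; destruct (Rlt_dec x b); [|lra]; now apply Df.
- rewrite Rmin_left, Rmax_right by lra.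
  intros x Hx; apply continuity_pt_filterlim, Cf, Hx.
- assert (df' c <= 0).
  { unfold df'; destruct (Rlt_dec a c); [|lra]; destruct (Rlt_dec c b); [|lra]; now apply Hle. }
  assert (df' c * (b - a) <= 0) by nra.
  lra.
Qed.

(* Only continuity is needed at the endpoints, so [G] may have a singular derivative there. *)
Lemma Cmod_increment_le (H dH : R -> C) (G dG : R -> R) (a b : R) :
  a <= b ->
  (forall x, a < x < b -> is_derC H x (dH x)) ->
  (forall x, a < x < b -> is_derive G x (dG x)) ->
  (forall x, a <= x <= b -> contC H x) ->
  (forall x, a <= x <= b -> continuous G x) ->
  (forall x, a < x < b -> Cmod (dH x) <= dG x) ->
  Cmod (H b - H a) <= G b - G a.
Proof.
intros Hab DH DG CH CG Hle.
set (z := (H b - H a)%C).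
(* Settles the case [z = 0], in which the projection argument below is empty. *)
assert (HG : - G b <= - G a).
{ apply (decreasing_of_derive_le_0 (fun x => - G x) (fun x => - dG x) a b Hab).
  - intros x Hx; apply (is_derive_opp G), DG, Hx.
  - intros x Hx; apply (continuous_opp (V := R_NormedModule) G), CG, Hx.
  - intros x Hx; generalize (Hle x Hx) (Cmod_ge_0 (dH x)); lra. }
assert (Hd : Cmod z * Cmod z <= Cmod z * (G b - G a)).
(* Scalar product of [H x] with the fixed direction [z], minus |z| G. By Cauchy-Schwarz this real
   function decreases, and its increment over [a, b] is |z|^2 - |z| (G b - G a). *)
{ set (f x := fst z * fst (H x) + snd z * snd (H x) - Cmod z * G x).
  assert (Hf : f b <= f a).
  { apply (decreasing_of_derive_le_0 f
      (fun x => fst z * fst (dH x) + snd z * snd (dH x) - Cmod z * dG x) a b Hab).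
    - intros x Hx; destruct (proj1 (is_derC_components _ _ _) (DH x Hx)) as [D1 D2].
      apply (is_derive_minus (K := R_AbsRing) (V := R_NormedModule)).
      + apply (is_derive_plus (K := R_AbsRing) (V := R_NormedModule)).
        apply (is_derive_scal (fun x => fst (H x))); exact D1.
        apply (is_derive_scal (fun x => snd (H x))); exact D2.
      + apply (is_derive_scal G), DG, Hx.
    - intros x Hx; destruct (proj1 (contC_components _ _) (CH x Hx)) as [C1 C2].
      apply (continuous_minus (V := R_NormedModule)).
      + apply (continuous_plus (V := R_NormedModule)).
        apply (continuous_scal_r (V := R_NormedModule) (fst z) (fun x => fst (H x))); exact C1.
        apply (continuous_scal_r (V := R_NormedModule) (snd z) (fun x => snd (H x))); exact C2.
      + apply (continuous_scal_r (V := R_NormedModule) (Cmod z) G), CG, Hx.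
    - intros x Hx.
      assert (fst z * fst (dH x) + snd z * snd (dH x) <= Cmod z * Cmod (dH x)).
      { unfold Cmod; rewrite <- sqrt_mult by nra.
        eapply Rle_trans; [apply Rle_abs|]; rewrite <- sqrt_Rsqr_abs.
        apply sqrt_le_1_alt; unfold Rsqr.
        generalize (Rle_0_sqr (fst z * snd (dH x) - snd z * fst (dH x))); unfold Rsqr; nra. }
      generalize (Rmult_le_compat_l _ _ _ (Cmod_ge_0 z) (Hle x Hx)); lra. }
  assert (Hz : Cmod z * Cmod z = fst z * fst z + snd z * snd z).
  { unfold Cmod; rewrite sqrt_sqrt; [ring | nra]. }
  unfold f in Hf; rewrite Hz.
  assert (E1 : fst z = fst (H b) - fst (H a)) by reflexivity.
  assert (E2 : snd z = snd (H b) - snd (H a)) by reflexivity.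
  rewrite E1 at 2; rewrite E2 at 2; lra. }
destruct (Req_dec (Cmod z) 0) as [E|E]; [lra|].
apply Rmult_le_reg_l with (Cmod z); [generalize (Cmod_ge_0 z); lra | exact Hd].
Qed.

(** * Essential suprema and extension of C^1 functions *)

Lemma Series_ge_term (a : nat -> R) (n : nat) :
  (forall k, 0 <= a k) -> ex_series a -> a n <= Series a.
Proof.
intros Ha Hs.
apply Rle_trans with (sum_n a n).
- destruct n as [|n].
  + rewrite sum_O; lra.
  + rewrite sum_Sn; unfold plus; simpl.
    assert (0 <= sum_n a n).
    { induction n as [|n IH]; [rewrite sum_O; apply Ha|].
      rewrite sum_Sn; unfold plus; simpl; generalize (Ha (S n)); lra. }
    lra.
- apply (is_lim_seq_incr_compare (sum_n a)).
  + exact (Series_correct a Hs).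
  + intros k; rewrite sum_Sn; unfold plus; simpl; generalize (Ha (S k)); lra.
Qed.

(* The covered length to the left of [x] grows at least as fast as [x]. *)
Lemma interval_not_negligible (a b : R) (E : R -> Prop) :
  a < b -> (forall x, a < x < b -> E x) -> ~ negligible E.
Proof.
intros Hab HE Hneg.
(* Both ends are strictly inside, so every point between them is covered; their distance (b - a)/2
   exceeds the permitted total length (b - a)/4. *)
set (al := a + (b - a) / 4); set (be := a + 3 * (b - a) / 4).
destruct (Hneg ((b - a) / 4) ltac:(lra)) as (l & r & Hlr & Hcov & Hs & Hle).
set (len x n := Rmax 0 (Rmin (r n) x - l n)).
assert (Hlen : forall x n, 0 <= len x n <= r n - l n).
{ intros x n; unfold len; generalize (Hlr n) (Rmin_l (r n) x); intros H1 H2.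
  split; [apply Rmax_l | apply Rmax_lub; lra]. }
assert (Hex : forall x, ex_series (len x)).
{ intros x; apply (ex_series_le (K := R_AbsRing) (V := R_CompleteNormedModule)) with (2 := Hs).
  intros n; change (Rabs (len x n) <= r n - l n).
  rewrite Rabs_pos_eq; apply Hlen. }
assert (Hmon : forall x y n, x <= y -> len x n <= len y n).
{ intros x y n Hxy; unfold len, Rmax, Rmin; repeat (destruct Rle_dec); lra. }
assert (Hinc : forall x y n, x <= y -> l n < x -> y <= r n -> len y n - len x n = y - x).
{ intros x y n Hxy H1 H2; unfold len; rewrite !Rmin_right, !Rmax_right by lra; lra. }
assert (HSmon : forall x y, x <= y -> Series (len x) <= Series (len y)).
{ intros x y Hxy; apply Series_le; [|apply Hex].
  intros n; split; [apply Hlen | now apply Hmon]. }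
(* Continuous induction in place of compactness: at the supremum [c] of [P], the covering interval
   around [c] would carry [P] beyond [c] unless [c = be]. *)
set (P x := al <= x <= be /\ x - al <= Series (len x)).
destruct (completeness P) as [c [Hub Hlub]].
{ exists be; intros x [Hx _]; lra. }
{ exists al; split; [unfold al, be; lra|].
  replace (al - al) with 0 by ring.
  apply Rle_trans with (len al 0%nat); [apply Hlen | apply Series_ge_term; [intros; apply Hlen | apply Hex]]. }
assert (Hc1 : al <= c).
{ apply Hub; split; [unfold al, be; lra|].
  replace (al - al) with 0 by ring.
  apply Rle_trans with (len al 0%nat); [apply Hlen | apply Series_ge_term; [intros; apply Hlen | apply Hex]]. }
assert (Hc2 : c <= be) by (apply Hlub; intros x [Hx _]; lra).
assert (Hc3 : c - al <= Series (len c)).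
{ assert (c <= Series (len c) + al); [|lra].
  apply Hlub; intros x Hx; generalize (HSmon x c (Hub x Hx)); destruct Hx; lra. }
assert (Hc : c = be).
{ destruct (Req_dec c be) as [|Hne]; [assumption|exfalso].
  destruct (Hcov c) as [n Hn]; [apply HE; unfold al, be in *; lra|].
  set (y := Rmin be (r n)).
  assert (Hy : c < y) by (apply Rmin_glb_lt; lra).
  assert (Hyb : y <= be) by apply Rmin_l.
  assert (P y).
  { split; [lra|].
    assert (y - c <= Series (fun k => len y k - len c k)).
    { rewrite <- (Hinc c y n); [| lra | lra | apply Rmin_r].
      apply (Series_ge_term (fun k => len y k - len c k)).
      - intros k; generalize (Hmon c y k ltac:(lra)); lra.
      - apply (ex_series_minus (V := R_NormedModule)); apply Hex. }
    rewrite Series_minus in H by apply Hex; lra. }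
  generalize (Hub y H); lra. }
assert (Series (len be) <= Series (fun n => r n - l n)).
{ apply Series_le; [apply Hlen | exact Hs]. }
rewrite Hc in Hc3; unfold al, be in *; lra.
Qed.

Lemma negligible_empty (E : R -> Prop) : (forall x, ~ E x) -> negligible E.
Proof.
intros HE eps He; exists (fun _ => 0), (fun _ => 0).
assert (Hz : is_series (fun _ : nat => 0 - 0) 0).
{ apply filterlim_ext with (fun _ => 0); [|apply filterlim_const].
  intros n; rewrite sum_n_const; ring. }
split; [|split; [|split]].
- intros; lra.
- intros x Hx; now apply HE in Hx.
- now exists 0.
- rewrite (is_series_unique _ _ Hz); lra.
Qed.

(** A continuous function that exceeds an essential bound at one point exceeds it on a whole
    interval, which is not negligible. The continuous extension [g] makes the argument work at the
    endpoints too. *)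
Lemma Cmod_le_Linf_norm (a b : R) (f g : R -> C) :
  a < b -> (forall x, contC g x) -> (forall x, a <= x <= b -> g x = f x) ->
  forall x, a <= x <= b -> Cmod (f x) <= Linf_norm a b f.
Proof.
intros Hab Cg Hfg.
assert (Cm : forall x, continuous (fun t => Cmod (g t)) x).
{ intros x; apply continuous_ext with (fun t => norm (V := C_R_NormedModule) (g t)).
  { intros t; apply norm_Cmod. }
  apply (continuous_comp g (norm (V := C_R_NormedModule))); [apply Cg | apply (filterlim_norm (V := C_R_NormedModule))]. }
unfold Linf_norm.
set (E c := 0 <= c /\ negligible (fun x => a < x < b /\ c < Cmod (f x))).
assert (Hlow : forall x c, a <= x <= b -> E c -> Cmod (f x) <= c).
{ intros x c Hx [Hc Hn]; rewrite <- Hfg by exact Hx.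
  destruct (Rle_lt_dec (Cmod (g x)) c) as [|Hlt]; [assumption|exfalso].
  assert (Hloc : locally x (fun t => c < Cmod (g t))).
  { apply (Cm x); apply (open_gt c); exact Hlt. }
  destruct Hloc as [eps He].
  apply (interval_not_negligible (Rmax a (x - eps)) (Rmin b (x + eps))
    (fun x => a < x < b /\ c < Cmod (f x))); [| |exact Hn].
  - generalize (cond_pos eps); intros; apply Rmax_lub_lt; apply Rmin_glb_lt; lra.
  - intros t [Ht1 Ht2].
    apply Rmax_Rlt in Ht1; apply Rmin_Rgt in Ht2.
    split; [lra|]; rewrite <- Hfg by lra.
    apply He; change (Rabs (t - x) < eps); apply Rabs_lt_between'; lra. }
(* Some essential bound exists, so the infimum is finite and [real] does not fall back on its
   default value 0. *)
assert (Hne : exists c, E c).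
{ destruct (ex_RInt_ub (fun t => Cmod (g t)) a b) as [c Hc].
  { apply (ex_RInt_continuous (V := R_CompleteNormedModule)); intros; apply Cm. }
  rewrite Rmin_left, Rmax_right in Hc by lra.
  exists (Rmax 0 c); split; [apply Rmax_l|].
  apply negligible_empty; intros x [Hx H].
  rewrite <- Hfg in H by lra.
  assert (Hx' := Hc x ltac:(lra)); change (Rabs (Cmod (g x)) <= c) in Hx'.
  generalize (Rle_abs (Cmod (g x))) (Rmax_r 0 c); lra. }
intros x Hx.
destruct (Glb_Rbar_correct E) as [Hl Hg].
assert (H1 : Rbar_le (Cmod (f x)) (Glb_Rbar E)).
{ apply Hg; intros c Hc; now apply Hlow. }
destruct Hne as [c Hc]; generalize (Hl c Hc); intros H2.
destruct (Glb_Rbar E); simpl in *; [exact H1 | contradiction | contradiction].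
Qed.

(** Projection onto [a, b]: composing with it turns continuity relative to the segment into
    continuity on the line. *)
Definition clamp (a b x : R) : R := Rmax a (Rmin b x).

Lemma clamp_bounds (a b x : R) : a <= b -> a <= clamp a b x <= b.
Proof. intros; unfold clamp; split; [apply Rmax_l | apply Rmax_lub; [assumption | apply Rmin_l]]. Qed.

Lemma clamp_id (a b x : R) : a <= x <= b -> clamp a b x = x.
Proof. intros; unfold clamp; rewrite Rmin_right, Rmax_right; lra. Qed.

Lemma filterlim_clamp (a b x : R) :
  a <= b ->
  filterlim (clamp a b) (locally x) (within (fun y => a <= y <= b) (locally (clamp a b x))).
Proof.
intros Hab P [eps HP]; exists eps; intros y Hy.
apply HP; [|now apply clamp_bounds].
change (Rabs (clamp a b y - clamp a b x) < eps).
apply Rle_lt_trans with (2 := Hy).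
change (Rabs (clamp a b y - clamp a b x) <= Rabs (y - x)).
unfold clamp, Rmax, Rmin.
repeat (destruct Rle_dec); unfold Rabs; repeat (destruct Rcase_abs); lra.
Qed.

Lemma contC_clamp (a b : R) (f : R -> C) :
  a <= b ->
  (forall x, a <= x <= b ->
     filterlim (U := C_R_NormedModule) f (within (fun y => a <= y <= b) (locally x)) (locally (T := C_R_NormedModule) (f x))) ->
  forall x, contC (fun t => f (clamp a b t)) x.
Proof.
intros Hab Hf x.
apply (filterlim_comp _ _ _ (clamp a b) f) with (within (fun y => a <= y <= b) (locally (clamp a b x))).
- now apply filterlim_clamp.
- now apply Hf, clamp_bounds.
Qed.

Lemma is_derC_RInt (f : R -> C) (a : R) :
  (forall x, contC f x) -> forall x, is_derC (fun t => RIntC f a t) x (f x).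
Proof.
intros Cf x.
apply (is_derive_RInt (V := C_R_NormedModule) f (fun t => RIntC f a t) a x); [|apply Cf].
apply filter_forall; intros y.
apply (RInt_correct (V := C_R_CompleteNormedModule)).
apply (ex_RInt_continuous (V := C_R_CompleteNormedModule)); intros; apply Cf.
Qed.

Lemma is_derC_contC (f : R -> C) (x : R) (l : C) : is_derC f x l -> contC f x.
Proof.
intros H; apply (ex_derive_continuous (K := R_AbsRing) (V := C_R_NormedModule)).
now exists l.
Qed.

Lemma is_derC_minus (f g : R -> C) (x : R) (l m : C) :
  is_derC f x l -> is_derC g x m -> is_derC (fun t => (f t - g t)%C) x (l - m)%C.
Proof. apply (is_derive_minus (K := R_AbsRing) (V := C_R_NormedModule)). Qed.

Lemma is_derC_plus (f g : R -> C) (x : R) (l m : C) :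
  is_derC f x l -> is_derC g x m -> is_derC (fun t => (f t + g t)%C) x (l + m)%C.
Proof. apply (is_derive_plus (K := R_AbsRing) (V := C_R_NormedModule)). Qed.

Lemma is_derC_const (z : C) (x : R) : is_derC (fun _ => z) x (RtoC 0).
Proof. apply (is_derive_const (K := R_AbsRing) (V := C_R_NormedModule)). Qed.

Lemma contC_minus (f g : R -> C) (x : R) :
  contC f x -> contC g x -> contC (fun t => (f t - g t)%C) x.
Proof. apply (continuous_minus (V := C_R_NormedModule)). Qed.

(** The extension is the antiderivative of the clamped derivative. It makes two-sided
    differentiation rules available at the endpoints. *)
Lemma C1_on_extension (a b : R) (u du : R -> C) :
  a < b -> C1_on a b u du ->
  exists v dv : R -> C,
    (forall x, is_derC v x (dv x)) /\ (forall x, contC dv x) /\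
    (forall x, a <= x <= b -> v x = u x) /\ (forall x, a <= x <= b -> dv x = du x).
Proof.
intros Hab Hu.
set (D := fun y => a <= y <= b).
assert (Hlim : forall x, D x -> is_filter_lim (within D (locally x)) x).
{ intros x Hx P HP; exact (filter_le_within (F := locally x) D P HP). }
pose (dv x := du (clamp a b x)).
assert (Cdv : forall x, contC dv x).
{ apply contC_clamp; [lra|]; intros x Hx; apply Hu, Hx. }
assert (Cu : forall x, contC (fun t => u (clamp a b t)) x).
{ apply contC_clamp; [lra|]; intros x Hx.
  destruct (Hu x Hx) as [Hd _].
  apply (filterdiff_continuous_aux (K := R_AbsRing) (U := R_NormedModule) (V := C_R_NormedModule)) with (1 := ex_intro _ _ Hd).
  now apply Hlim. }
pose (v x := (u a + RIntC dv a x)%C).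
assert (Dv : forall x, is_derC v x (dv x)).
{ intros x; unfold v.
  replace (dv x) with (RtoC 0 + dv x)%C by ring.
  apply is_derC_plus; [apply is_derC_const | now apply is_derC_RInt]. }
exists v, dv; split; [exact Dv | split; [exact Cdv | split]].
2: now intros x Hx; unfold dv; rewrite clamp_id.
(* Inside the interval the relative neighbourhoods are the ordinary ones, so relative
   differentiability becomes [is_derC]. *)
assert (Du : forall x, a < x < b -> is_derC (fun t => u (clamp a b t)) x (dv x)).
{ intros x Hx.
  assert (HD : locally x D).
  { apply (filter_imp (fun y => a < y /\ y < b)); [unfold D; intros; lra|].
    apply filter_and; [apply (open_gt a) | apply (open_lt b)]; apply Hx. }
  apply (is_derive_ext_loc (K := R_AbsRing) (V := C_R_NormedModule) u).
  { revert HD; apply filter_imp; intros y Hy; now rewrite clamp_id. }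
  destruct (Hu x) as [[Hl Hd] _]; [lra|].
  unfold dv; rewrite clamp_id by lra.
  split; [apply Hl|].
  intros x0 Hx0 eps.
  assert (Hd' := Hd x0 (fun P HP => filter_le_within (F := locally x) D P (Hx0 P HP)) eps).
  unfold within in Hd'; generalize (filter_and _ _ Hd' HD); apply filter_imp.
  intros y [Hy1 Hy2]; now apply Hy1. }
intros x Hx.
(* Majorant 0: the difference of [u] and [v] is constant, and it vanishes at [a]. *)
assert (H := Cmod_increment_le (fun t => u (clamp a b t) - v t)%C (fun t => dv t - dv t)%C
  (fun _ => 0) (fun _ => 0) a x).
rewrite Rminus_diag in H.
assert (H0 : Cmod (u (clamp a b x) - v x - (u (clamp a b a) - v a)) <= 0).
{ apply H; try lra.
  - intros t Ht; apply is_derC_minus; [apply Du; lra | apply Dv].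
  - intros; apply (is_derive_const (K := R_AbsRing) (V := R_NormedModule)).
  - intros; apply contC_minus; [apply Cu | apply (is_derC_contC _ _ _ (Dv x0))].
  - intros; apply continuous_const.
  - intros; replace (dv x0 - dv x0)%C with (RtoC 0) by ring; rewrite Cmod_0; lra. }
assert (Hva : v a = u a).
{ unfold v; rewrite (RInt_point (V := C_R_CompleteNormedModule)).
  change (zero (G := C_R_CompleteNormedModule)) with (RtoC 0); ring. }
rewrite !clamp_id, Hva in H0 by lra.
apply Rle_antisym in H0; [|apply Cmod_ge_0]; symmetry in H0.
apply Cmod_eq_0 in H0.
replace (u x) with ((u x - v x - (u a - u a)) + v x)%C by ring.
rewrite H0; ring.
Qed.

(** * The model integral along a quarter turn *)

Notation filterlimC f F l := (filterlim (U := C_R_NormedModule) f F (locally (T := C_R_NormedModule) l)).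

Lemma exp_le_compat (x y : R) : x <= y -> exp x <= exp y.
Proof. intros [H|<-]; [left; now apply exp_increasing | lra]. Qed.

Lemma sum_sq_pos (s t : R) : 0 < s -> 0 < s ^ 2 + t ^ 2.
Proof. intros; nra. Qed.

(** [cpow nu s t] is the principal value of (s + i t)^nu for [s > 0]. *)
Definition cpow (nu s t : R) : C :=
  (RtoC (Rpower (s ^ 2 + t ^ 2) (nu / 2)) * cis (nu * atan (t / s)))%C.

Lemma Cmod_cpow (nu s t : R) : Cmod (cpow nu s t) = Rpower (s ^ 2 + t ^ 2) (nu / 2).
Proof.
unfold cpow; rewrite Cmod_mult, Cmod_cis, Cmod_R, Rabs_pos_eq; [ring|].
left; apply exp_pos.
Qed.

Lemma Rpower_sum_sq_le (nu s t : R) :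
  0 < s -> nu <= 0 -> Rpower (s ^ 2 + t ^ 2) (nu / 2) <= Rpower s nu.
Proof.
intros Hs Hnu.
replace (Rpower s nu) with (Rpower (s ^ 2) (nu / 2)).
2: { rewrite <- Rpower_pow, Rpower_mult by assumption; f_equal; simpl; field. }
unfold Rpower; apply exp_le_compat,  Rmult_le_compat_neg_l; [lra|].
apply ln_le; nra.
Qed.

Lemma cpow_0 (nu s : R) : 0 < s -> cpow nu s 0 = RtoC (Rpower s nu).
Proof.
intros Hs; unfold cpow.
replace (0 / s) with 0 by (field; lra).
rewrite atan_0, Rmult_0_r; unfold cis; rewrite cos_0, sin_0.
replace (s ^ 2 + 0 ^ 2) with (s ^ 2) by ring.
rewrite <- Rpower_pow, Rpower_mult by assumption.
replace (INR 2 * (nu / 2)) with nu by (simpl; field).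
change (1, 0) with (RtoC 1); ring.
Qed.

Lemma is_derive_Rpower_sum_sq (nu s t : R) :
  0 < s ^ 2 + t ^ 2 ->
  is_derive (fun s => Rpower (s ^ 2 + t ^ 2) (nu / 2)) s
    (nu * s / (s ^ 2 + t ^ 2) * Rpower (s ^ 2 + t ^ 2) (nu / 2)).
Proof.
intros H; unfold Rpower; auto_derive; [lra|].
simpl in *; field; lra.
Qed.

(** nu / (s + i t) *)
Definition logder (nu s t : R) : C :=
  (nu * s / (s ^ 2 + t ^ 2), - nu * t / (s ^ 2 + t ^ 2)).

Lemma Cmod_Ci : Cmod Ci = 1.
Proof. transitivity (sqrt 1); [unfold Cmod, Ci; f_equal; simpl; ring | apply sqrt_1]. Qed.

Lemma is_derC_cpow_s (nu s t : R) :
  0 < s ->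
  is_derC (fun s => cpow nu s t) s
    (logder nu s t * cpow nu s t)%C.
Proof.
intros Hs; assert (Hp := sum_sq_pos s t Hs).
evar_last.
- apply (is_derC_mult (fun s => RtoC (Rpower (s ^ 2 + t ^ 2) (nu / 2))) (fun s => cis (nu * atan (t / s)))).
  + apply is_derC_RtoC, is_derive_Rpower_sum_sq, Hp.
  + apply (is_derC_cis (fun s => nu * atan (t / s)) s ((- nu * t / (s ^ 2 + t ^ 2))%R)).
    auto_derive; [lra|]. simpl in *; field; repeat split; nra.
- unfold cpow, logder.
  apply injective_projections; simpl; ring.
Qed.

Lemma is_derC_cpow_t (nu s t : R) :
  0 < s ->
  is_derC (fun t => cpow nu s t) t
    (Ci * logder nu s t * cpow nu s t)%C.
Proof.
intros Hs; assert (Hp := sum_sq_pos s t Hs).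
evar_last.
- apply (is_derC_mult (fun t => RtoC (Rpower (s ^ 2 + t ^ 2) (nu / 2))) (fun t => cis (nu * atan (t / s)))).
  + apply is_derC_RtoC.
    apply is_derive_ext with (fun t => Rpower (t ^ 2 + s ^ 2) (nu / 2)).
    { intros u; now rewrite Rplus_comm. }
    apply is_derive_Rpower_sum_sq; lra.
  + apply (is_derC_cis (fun t => nu * atan (t / s)) t ((nu * s / (s ^ 2 + t ^ 2))%R)).
    auto_derive; [lra|]. simpl in *; field; repeat split; nra.
- unfold cpow, logder.
  rewrite (Rplus_comm (t ^ 2)).
  apply injective_projections; simpl; field; simpl in Hp; lra.
Qed.

Lemma Cmod_log_derivative (nu s t : R) :
  0 < s -> nu <= 0 -> Cmod (logder nu s t) <= - nu / s.
Proof.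
intros Hs Hnu; assert (Hp := sum_sq_pos s t Hs).
unfold Cmod, logder, fst, snd.
replace ((nu * s / (s ^ 2 + t ^ 2)) ^ 2 + (- nu * t / (s ^ 2 + t ^ 2)) ^ 2)
  with (nu ^ 2 / (s ^ 2 + t ^ 2)) by (field; lra).
rewrite <- (sqrt_pow2 (- nu / s)).
2: apply Rmult_le_pos; [lra | left; now apply Rinv_0_lt_compat].
apply sqrt_le_1_alt.
replace ((- nu / s) ^ 2) with (nu ^ 2 / s ^ 2) by (field; lra).
apply Rmult_le_compat_l; [apply pow2_ge_0|].
apply Rinv_le_contravar; nra.
Qed.

(** Move vertically from the real axis: along the way |s + i t| >= s, and the exponents are not
    positive, so the derivative of the power stays below its size at height 0. *)
Lemma cpow_close_to_real (nu s t : R) :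
  0 < s -> nu <= 0 -> 0 <= t ->
  Cmod (cpow nu s t - RtoC (Rpower s nu)) <= - nu * Rpower s (nu - 1) * t.
Proof.
intros Hs Hnu Ht.
rewrite <- (cpow_0 nu s Hs).
replace (- nu * Rpower s (nu - 1) * t)
  with (- nu * Rpower s (nu - 1) * t - - nu * Rpower s (nu - 1) * 0) by ring.
apply (Cmod_increment_le (cpow nu s)
  (fun t => Ci * logder nu s t * cpow nu s t)%C
  (fun t => - nu * Rpower s (nu - 1) * t) (fun _ => - nu * Rpower s (nu - 1)) 0 t Ht).
- intros; now apply is_derC_cpow_t.
- intros; auto_derive; [trivial | ring].
- intros; eapply is_derC_contC; now apply is_derC_cpow_t.
- intros; apply (ex_derive_continuous (K := R_AbsRing) (V := R_NormedModule)); auto_derive; trivial.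
- intros x Hx; rewrite !Cmod_mult, Cmod_Ci, Cmod_cpow, Rmult_1_l.
  replace (- nu * Rpower s (nu - 1)) with (- nu / s * Rpower s nu).
  2: { unfold Rminus; rewrite Rpower_plus, Rpower_Ropp, Rpower_1 by assumption; field; lra. }
  apply Rmult_le_compat; [apply Cmod_ge_0 | left; apply exp_pos | now apply Cmod_log_derivative | now apply Rpower_sum_sq_le].
Qed.

(* On the open first quadrant, [atan (t / s) = PI / 2 - atan (s / t)]; the right-hand side extends to [s = 0]. *)
Lemma cpow_close_to_imaginary (nu s t : R) :
  0 < s -> nu <= 0 -> 0 < t ->
  Cmod (cpow nu s t - RtoC (Rpower t nu) * cis (nu * (PI / 2))) <= - nu * Rpower t (nu - 1) * s.
Proof.
intros Hs Hnu Ht.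
(* The second factor conjugates the first, so this is i^nu (t - i x)^nu, that is (x + i t)^nu in a
   form regular at x = 0. *)
set (h x := (cpow nu t x * cis (- (2 * nu * atan (x / t))) * cis (nu * (PI / 2)))%C).
assert (Hh0 : h 0 = (RtoC (Rpower t nu) * cis (nu * (PI / 2)))%C).
{ unfold h; rewrite cpow_0 by assumption.
  replace (0 / t) with 0 by (field; lra).
  rewrite atan_0, Rmult_0_r, Ropp_0; unfold cis at 1; rewrite cos_0, sin_0.
  change (1, 0) with (RtoC 1); ring. }
assert (Hhs : h s = cpow nu s t).
{ unfold h, cpow; rewrite (Rplus_comm (t ^ 2)).
  rewrite <- !Cmult_assoc, <- !cis_plus; do 2 f_equal.
  replace (s / t) with (/ (t / s)) by (field; lra).
  rewrite atan_inv by (apply Rdiv_lt_0_compat; assumption); ring. }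
assert (Hder : forall x, is_derC h x
  ((- Ci * Cconj (logder nu t x) * h x))%C).
{ intros x; assert (Hp := sum_sq_pos t x Ht). evar_last.
  - apply is_derC_mult; [apply is_derC_mult|].
    + now apply is_derC_cpow_t.
    + apply (is_derC_cis (fun x => - (2 * nu * atan (x / t))) x (- ((2 * nu * t / (t ^ 2 + x ^ 2))%R))).
      auto_derive; [lra|]. simpl in *; field; repeat split; nra.
    + apply is_derC_const.
  - unfold h, logder; apply injective_projections; simpl; field; simpl in Hp; lra. }
rewrite <- Hhs, <- Hh0.
replace (- nu * Rpower t (nu - 1) * s)
  with (- nu * Rpower t (nu - 1) * s - - nu * Rpower t (nu - 1) * 0) by ring.
apply (Cmod_increment_le h _ (fun x => - nu * Rpower t (nu - 1) * x) (fun _ => - nu * Rpower t (nu - 1)) 0 s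
  (Rlt_le _ _ Hs) (fun x _ => Hder x)).
- intros; auto_derive; [trivial | ring].
- intros; eapply is_derC_contC; apply Hder.
- intros; apply (ex_derive_continuous (K := R_AbsRing) (V := R_NormedModule)); auto_derive; trivial.
- intros x Hx; rewrite Cmod_mult; unfold h at 1; rewrite (Cmod_mult (cpow nu t x * _)), (Cmod_mult (cpow nu t x)), Cmod_cpow, !Cmod_cis, !Rmult_1_r.
  replace (- nu * Rpower t (nu - 1)) with (- nu / t * Rpower t nu).
  2: { unfold Rminus; rewrite Rpower_plus, Rpower_Ropp, Rpower_1 by assumption; field; lra. }
  apply Rmult_le_compat; [apply Cmod_ge_0 | left; apply exp_pos | | now apply Rpower_sum_sq_le].
  rewrite Cmod_mult, Cmod_opp, Cmod_Ci, Cmod_conj, Rmult_1_l; now apply Cmod_log_derivative.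
Qed.

Lemma Cmod_cis_sub_1_le (s : R) : 0 <= s -> Cmod (cis s - RtoC 1) <= s.
Proof.
intros Hs.
assert (H := Cmod_increment_le cis (fun x => (0, 1) * cis x)%C (fun x => x) (fun _ => 1) 0 s Hs).
replace (cis 0) with (RtoC 1) in H by (unfold cis; now rewrite cos_0, sin_0).
rewrite Rminus_0_r in H; apply H.
- intros; apply is_derC_cis, (is_derive_id (K := R_AbsRing)).
- intros; apply (is_derive_id (K := R_AbsRing)).
- intros; apply contC_cis, continuous_id.
- intros; apply continuous_id.
- intros; rewrite Cmod_mult, Cmod_cis; unfold Cmod; simpl.
  rewrite Rmult_1_r; right; replace (0 * (0 * 1) + 1 * (1 * 1)) with 1 by ring; apply sqrt_1.
Qed.

(** z^nu e^{iz} at z = s + it. *)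
Definition rotint (nu s t : R) : C := (RtoC (exp (- t)) * cis s * cpow nu s t)%C.

(** The complex derivative (i + nu / z) z^nu e^(iz). The two partial derivatives are this and [Ci]
    times this: the Cauchy-Riemann equations, the only form of holomorphy used. *)
Definition drotint (nu s t : R) : C :=
  ((Ci + logder nu s t) * rotint nu s t)%C.

Lemma is_derC_rotint_s (nu s t : R) :
  0 < s -> is_derC (fun s => rotint nu s t) s (drotint nu s t).
Proof.
intros Hs; evar_last.
- apply is_derC_mult; [apply is_derC_mult|].
  + apply is_derC_const.
  + apply is_derC_cis, (is_derive_id (K := R_AbsRing)).
  + now apply is_derC_cpow_s.
- unfold drotint, rotint, logder; simpl; apply injective_projections; simpl; unfold one; simpl; field;
  generalize (sum_sq_pos s t Hs); simpl; lra.
Qed.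

Lemma is_derC_rotint_t (nu s t : R) :
  0 < s -> is_derC (fun t => rotint nu s t) t (Ci * drotint nu s t)%C.
Proof.
intros Hs; evar_last.
- apply is_derC_mult; [apply is_derC_mult|].
  + apply is_derC_RtoC; instantiate (1 := - exp (- t)); auto_derive; [trivial | ring].
  + apply is_derC_const.
  + now apply is_derC_cpow_t.
- unfold drotint, rotint, logder; simpl; apply injective_projections; simpl; field;
  generalize (sum_sq_pos s t Hs); simpl; lra.
Qed.

Lemma Cmod_rotint (nu s t : R) :
  Cmod (rotint nu s t) = exp (- t) * Rpower (s ^ 2 + t ^ 2) (nu / 2).
Proof.
unfold rotint; rewrite !Cmod_mult, Cmod_cis, Cmod_cpow, Cmod_R, Rabs_pos_eq; [ring|].
left; apply exp_pos.
Qed.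

Lemma Cmod_rotint_le (nu s t : R) :
  0 < s -> nu <= 0 -> Cmod (rotint nu s t) <= Rpower s nu * exp (- t).
Proof.
intros; rewrite Cmod_rotint, Rmult_comm; apply Rmult_le_compat_r; [left; apply exp_pos|].
now apply Rpower_sum_sq_le.
Qed.

(** * Differentiation under the integral sign *)

Definition cont2C (f : R -> R -> C) (s t : R) : Prop :=
  continuity_2d_pt (fun u v => fst (f u v)) s t /\
  continuity_2d_pt (fun u v => snd (f u v)) s t.

Lemma cont2C_mult (f g : R -> R -> C) (s t : R) :
  cont2C f s t -> cont2C g s t -> cont2C (fun u v => (f u v * g u v)%C) s t.
Proof.
intros [F1 F2] [G1 G2]; split; simpl.
- apply (continuity_2d_pt_minus (fun u v => fst (f u v) * fst (g u v)) (fun u v => snd (f u v) * snd (g u v)));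
  now apply continuity_2d_pt_mult.
- apply (continuity_2d_pt_plus (fun u v => fst (f u v) * snd (g u v)) (fun u v => snd (f u v) * fst (g u v)));
  now apply continuity_2d_pt_mult.
Qed.

Lemma cont2C_RtoC (f : R -> R -> R) (s t : R) :
  continuity_2d_pt f s t -> cont2C (fun u v => RtoC (f u v)) s t.
Proof. intros H; split; [exact H | exact (continuity_2d_pt_const s t 0)]. Qed.

Lemma cont2C_cis (f : R -> R -> R) (s t : R) :
  continuity_2d_pt f s t -> cont2C (fun u v => cis (f u v)) s t.
Proof.
intros H; split; simpl.
- apply (continuity_1d_2d_pt_comp cos); [apply continuity_cos | exact H].
- apply (continuity_1d_2d_pt_comp sin); [apply continuity_sin | exact H].
Qed.

Lemma RIntC_components (f : R -> C) (a b : R) :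
  ex_RInt (V := C_R_NormedModule) f a b ->
  RIntC f a b = (RInt (fun t => fst (f t)) a b, RInt (fun t => snd (f t)) a b).
Proof.
intros H; symmetry.
apply (RInt_fct_extend_pair (U := R_NormedModule) (V := R_NormedModule)
  (RInt (V := R_CompleteNormedModule)) (RInt (V := R_CompleteNormedModule))).
- intros g x y l; apply (is_RInt_unique (V := R_CompleteNormedModule)).
- intros g x y l; apply (is_RInt_unique (V := R_CompleteNormedModule)).
- exact (RInt_correct (V := C_R_CompleteNormedModule) f a b H).
Qed.

(** Regularity is asked on a half-line [m < s], because [rotint] is regular for positive [s] only; a
    half-line is open, so the hypotheses hold in a neighbourhood of [x]. *)
Lemma is_derive_RInt_param_right (f df : R -> R -> R) (m a b x : R) :
  m < x ->
  (forall s t, m < s -> is_derive (fun s => f s t) s (df s t)) ->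
  (forall s t, m < s -> continuity_2d_pt df s t) ->
  (forall s t, m < s -> continuous (f s) t) ->
  is_derive (fun s => RInt (f s) a b) x (RInt (df x) a b).
Proof.
intros Hx Df Cdf Cf.
assert (HD : forall s t, m < s -> Derive (fun s => f s t) s = df s t).
{ intros s t Hs; now apply is_derive_unique, Df. }
assert (Hloc : locally x (fun y => m < y)) by now apply (open_gt m).
rewrite <- (RInt_ext (fun t => Derive (fun u => f u t) x)).
2: intros t _; now apply HD.
apply is_derive_RInt_param.
- revert Hloc; apply filter_imp; intros s Hs t _; exists (df s t); now apply Df.
- intros t _; apply continuity_2d_pt_ext_loc with (2 := Cdf x t Hx).
  exists (mkposreal (x - m) ltac:(lra)); simpl; intros u v Hu Hv.
  symmetry; apply HD; apply Rabs_lt_between' in Hu; lra.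
- revert Hloc; apply filter_imp; intros s Hs.
  apply (ex_RInt_continuous (V := R_CompleteNormedModule)); intros t _; now apply Cf.
Qed.

Lemma is_derC_RInt_param (f df : R -> R -> C) (m a b x : R) :
  m < x ->
  (forall s t, m < s -> is_derC (fun s => f s t) s (df s t)) ->
  (forall s t, m < s -> cont2C df s t) ->
  (forall s t, m < s -> contC (f s) t) ->
  ex_RInt (V := C_R_NormedModule) (df x) a b ->
  is_derC (fun s => RIntC (f s) a b) x (RIntC (df x) a b).
Proof.
intros Hx Df Cdf Cf Hex.
assert (Hloc : locally x (fun y => m < y)) by now apply (open_gt m).
rewrite RIntC_components by exact Hex.
apply (is_derive_ext_loc (K := R_AbsRing) (V := C_R_NormedModule)
  (fun s => (RInt (fun t => fst (f s t)) a b, RInt (fun t => snd (f s t)) a b))).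
{ revert Hloc; apply filter_imp; intros s Hs; rewrite RIntC_components; [reflexivity|].
  apply (ex_RInt_continuous (V := C_R_CompleteNormedModule)); intros t _; now apply Cf. }
apply is_derC_pair.
- apply (is_derive_RInt_param_right (fun s t => fst (f s t)) (fun s t => fst (df s t)) m); [exact Hx | | |].
  + intros s t Hs; now apply is_derC_components, Df.
  + intros s t Hs; now apply Cdf.
  + intros s t Hs; now apply contC_components, Cf.
- apply (is_derive_RInt_param_right (fun s t => snd (f s t)) (fun s t => snd (df s t)) m); [exact Hx | | |].
  + intros s t Hs; now apply is_derC_components, Df.
  + intros s t Hs; now apply Cdf.
  + intros s t Hs; now apply contC_components, Cf.
Qed.

(** Integral of z^nu e^{iz} over the vertical segment from s + iT down to s. *)
Definition vert (nu T s : R) : C := RIntC (fun t => (- Ci * rotint nu s t)%C) 0 T.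

Lemma is_derC_scal (z : C) (f : R -> C) (x : R) (l : C) :
  is_derC f x l -> is_derC (fun t => (z * f t)%C) x (z * l)%C.
Proof.
intros H; replace (z * l)%C with (RtoC 0 * f x + z * l)%C by ring.
apply (is_derC_mult (fun _ => z)); [apply is_derC_const | exact H].
Qed.

Lemma contC_rotint (nu s t : R) : 0 < s -> contC (rotint nu s) t.
Proof. intros Hs; eapply is_derC_contC; now apply is_derC_rotint_t. Qed.

Lemma is_derC_vert_T (nu T s : R) :
  0 < s -> is_derC (fun T => vert nu T s) T (- Ci * rotint nu s T)%C.
Proof.
intros Hs; apply (is_derC_RInt (fun t => (- Ci * rotint nu s t)%C)).
intros t; apply contC_mult; [apply continuous_const | now apply contC_rotint].
Qed.

Lemma vert_0 (nu s : R) : vert nu 0 s = RtoC 0.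
Proof. unfold vert; apply (RInt_point (V := C_R_CompleteNormedModule)). Qed.

Lemma contC_drotint (nu s t : R) : 0 < s -> contC (drotint nu s) t.
Proof.
intros Hs; apply contC_mult; [|now apply contC_rotint].
assert (Hp := sum_sq_pos s t Hs).
apply contC_components; unfold logder; simpl; split;
apply (ex_derive_continuous (K := R_AbsRing) (V := R_NormedModule));
auto_derive; simpl in *; lra.
Qed.

Lemma cont2C_drotint (nu s t : R) : 0 < s -> cont2C (drotint nu) s t.
Proof.
intros Hs; assert (Hp := sum_sq_pos s t Hs).
assert (Hd : continuity_2d_pt (fun u v => u ^ 2 + v ^ 2) s t).
{ apply (continuity_2d_pt_ext (fun u v => u * u + v * v)); [intros; ring|].
  apply (continuity_2d_pt_plus (fun u v => u * u) (fun u v => v * v)); apply continuity_2d_pt_mult;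
  (apply continuity_2d_pt_id1 || apply continuity_2d_pt_id2). }
assert (Hi : continuity_2d_pt (fun u v => / (u ^ 2 + v ^ 2)) s t).
{ apply (continuity_2d_pt_inv (fun u v => u ^ 2 + v ^ 2)); [exact Hd | lra]. }
apply cont2C_mult.
- split; unfold logder; simpl.
  + apply (continuity_2d_pt_ext (fun u v => nu * u * / (u ^ 2 + v ^ 2))).
    { intros u v; simpl; unfold Rdiv; ring. }
    apply continuity_2d_pt_mult; [|exact Hi].
    apply (continuity_2d_pt_mult (fun _ _ => nu) (fun u _ => u));
    [apply continuity_2d_pt_const | apply continuity_2d_pt_id1].
  + apply (continuity_2d_pt_ext (fun u v => 1 + - nu * v * / (u ^ 2 + v ^ 2))).
    { intros u v; simpl; unfold Rdiv; ring. }
    apply (continuity_2d_pt_plus (fun _ _ => 1)); [apply continuity_2d_pt_const|].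
    apply continuity_2d_pt_mult; [|exact Hi].
    apply (continuity_2d_pt_mult (fun _ _ => - nu) (fun _ v => v));
    [apply continuity_2d_pt_const | apply continuity_2d_pt_id2].
- apply cont2C_mult; [apply cont2C_mult|apply cont2C_mult].
  + apply cont2C_RtoC, (continuity_1d_2d_pt_comp (fun v => exp (- v)) (fun _ v => v)); [|apply continuity_2d_pt_id2].
    apply derivable_continuous_pt, ex_derive_Reals_0; auto_derive; trivial.
  + apply cont2C_cis, continuity_2d_pt_id1.
  + apply cont2C_RtoC, (continuity_1d_2d_pt_comp (fun v => Rpower v (nu / 2)) (fun u v => u ^ 2 + v ^ 2)); [|exact Hd].
    apply derivable_continuous_pt, ex_derive_Reals_0; unfold Rpower; auto_derive; simpl in *; lra.
  + apply cont2C_cis, (continuity_2d_pt_mult (fun _ _ => nu)); [apply continuity_2d_pt_const|].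
    apply (continuity_1d_2d_pt_comp atan (fun u v => v / u)).
    { apply derivable_continuous_pt, derivable_pt_atan. }
    apply (continuity_2d_pt_mult (fun _ v => v) (fun u _ => / u)); [apply continuity_2d_pt_id2|].
    apply (continuity_2d_pt_inv (fun u _ => u)); [apply continuity_2d_pt_id1 | lra].
Qed.

(* Cauchy's theorem on a rectangle, in differential form. *)
Lemma is_derC_vert_s (nu T s : R) :
  0 < s -> is_derC (vert nu T) s (rotint nu s 0 - rotint nu s T)%C.
Proof.
intros Hs.
assert (C1 : forall t, contC (fun t => (- Ci * drotint nu s t)%C) t).
{ intros t; apply contC_mult; [apply continuous_const | now apply contC_drotint]. }
(* By Cauchy-Riemann the derivative of the integrand in [s] is minus the derivative of [rotint] in
   [t], so its integral reduces to the two horizontal edges. *)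
assert (HI : is_RInt (V := C_R_NormedModule) (fun t => (- Ci * drotint nu s t)%C) 0 T (rotint nu s 0 - rotint nu s T)%C).
{ replace (rotint nu s 0 - rotint nu s T)%C
    with (minus (G := C_R_NormedModule) (RtoC (-1) * rotint nu s T)%C (RtoC (-1) * rotint nu s 0)%C).
  2: { change ((RtoC (-1) * rotint nu s T) - (RtoC (-1) * rotint nu s 0) = rotint nu s 0 - rotint nu s T)%C.
       apply injective_projections; simpl; ring. }
  apply (is_RInt_derive (V := C_R_CompleteNormedModule) (fun t => (RtoC (-1) * rotint nu s t)%C)).
  - intros t _; replace (- Ci * drotint nu s t)%C with (RtoC (-1) * (Ci * drotint nu s t))%C.
    2: apply injective_projections; simpl; ring.
    now apply is_derC_scal, is_derC_rotint_t.
  - intros t _; apply C1. }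
rewrite <- (is_RInt_unique (V := C_R_CompleteNormedModule) _ _ _ _ HI).
apply (is_derC_RInt_param (fun s t => (- Ci * rotint nu s t)%C) (fun s t => (- Ci * drotint nu s t)%C) 0).
- exact Hs.
- intros; now apply is_derC_scal, is_derC_rotint_s.
- intros; apply (cont2C_mult (fun _ _ => (- Ci)%C)); [split; exact (continuity_2d_pt_const _ _ _) | now apply cont2C_drotint].
- intros; apply contC_mult; [apply continuous_const | now apply contC_rotint].
- eexists; exact HI.
Qed.

(** * Limits at infinity *)

Lemma exp_neg_lim : filterlim (fun T => exp (- T)) (Rbar_locally p_infty) (locally 0).
Proof.
apply (is_lim_comp exp Ropp p_infty 0 m_infty is_lim_exp_m).
- apply (is_lim_opp (fun x => x) p_infty p_infty), is_lim_id.
- now exists 0.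
Qed.

(** Cauchy criterion in the form that serves both the vertical integral and the incomplete Gamma
    function. *)
Lemma exp_decay_cauchy (f : R -> C) (m k : R) :
  (forall x y, m <= x <= y -> Cmod (f y - f x) <= k * (exp (- x) - exp (- y))) ->
  exists l, filterlimC f (Rbar_locally p_infty) l.
Proof.
intros Hf.
apply (filterlim_locally_cauchy (U := C_R_CompleteNormedModule)).
intros eps.
assert (Hk : 0 < eps / (Rabs k + 1)).
{ apply Rdiv_lt_0_compat; [apply cond_pos | generalize (Rabs_pos k); lra]. }
destruct (proj1 (filterlim_locally _ _) exp_neg_lim (mkposreal _ Hk)) as [M HM].
assert (Hdiff : forall x y, Rmax m (M + 1) < x -> x <= y -> Cmod (f y - f x) < eps).
{ intros x y Hx Hxy; apply Rmax_Rlt in Hx.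
  apply Rle_lt_trans with (1 := Hf x y ltac:(lra)).
  assert (Hm : Rabs (exp (- x) - 0) < eps / (Rabs k + 1)) by (apply HM; lra).
  rewrite Rminus_0_r, Rabs_pos_eq in Hm by (left; apply exp_pos).
  assert (He := exp_pos (- y)).
  assert (He' : exp (- y) <= exp (- x)) by (apply exp_le_compat; lra).
  apply Rle_lt_trans with (Rabs k * exp (- x)).
  - apply Rle_trans with (Rabs k * (exp (- x) - exp (- y))).
    + apply Rmult_le_compat_r; [lra | apply Rle_abs].
    + apply Rmult_le_compat_l; [apply Rabs_pos | lra].
  - apply Rle_lt_trans with ((Rabs k + 1) * exp (- x)); [generalize (exp_pos (- x)); lra|].
    apply Rlt_le_trans with ((Rabs k + 1) * (eps / (Rabs k + 1))).
    + apply Rmult_lt_compat_l; [generalize (Rabs_pos k); lra | exact Hm].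
    + right; field; generalize (Rabs_pos k); lra. }
exists (fun x => Rmax m (M + 1) < x); split; [now exists (Rmax m (M + 1))|].
intros x y Hx Hy.
apply (norm_compat1 (V := C_R_NormedModule)); rewrite norm_Cmod.
change (Cmod (f y - f x) < eps).
destruct (Rle_dec x y) as [Hxy|Hxy]; [now apply Hdiff|].
replace (f y - f x)%C with (- (f x - f y))%C by ring.
rewrite Cmod_opp; apply Hdiff; lra.
Qed.

Lemma Cmod_lim_le {T : Type} (F : (T -> Prop) -> Prop) {FF : ProperFilter F}
  (f : T -> C) (g : T -> R) (l : C) (c : R) :
  filterlimC f F l -> filterlim g F (locally c) ->
  F (fun x => Cmod (f x) <= g x) -> Cmod l <= c.
Proof.
intros Hf Hg H.
apply (filterlim_le (F := F) (fun x => Cmod (f x)) g (Cmod l) c H); [|exact Hg].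
apply filterlim_ext with (fun x => norm (V := C_R_NormedModule) (f x)).
{ intros; apply norm_Cmod. }
simpl; rewrite <- norm_Cmod.
apply (filterlim_comp _ _ _ _ _ _ _ _ Hf (filterlim_norm (V := C_R_NormedModule) l)).
Qed.

(** * The incomplete Gamma function and the oscillatory primitive *)

(** Unlike [Rpower], vanishes at 0. *)
Definition pw (x a : R) : R := if Rle_dec x 0 then 0 else Rpower x a.

Lemma pw_pos (x a : R) : 0 < x -> pw x a = Rpower x a.
Proof. intros; unfold pw; destruct (Rle_dec x 0); [lra | reflexivity]. Qed.

Lemma pw_0 (a : R) : pw 0 a = 0.
Proof. unfold pw; destruct (Rle_dec 0 0); [reflexivity | lra]. Qed.

Lemma pw_ge_0 (x a : R) : 0 <= pw x a.
Proof. unfold pw; destruct (Rle_dec x 0); [lra | left; apply exp_pos]. Qed.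

Lemma is_derive_Rpower (x a : R) : 0 < x -> is_derive (fun t => Rpower t a) x (a * Rpower x (a - 1)).
Proof.
intros Hx; unfold Rminus; rewrite Rpower_plus, Rpower_Ropp, Rpower_1 by assumption.
unfold Rpower; auto_derive; [assumption | field; lra].
Qed.

Lemma is_derive_pw (x a : R) : 0 < x -> is_derive (fun t => pw t a) x (a * Rpower x (a - 1)).
Proof.
intros Hx; apply is_derive_ext_loc with (fun t => Rpower t a); [|now apply is_derive_Rpower].
apply (filter_imp (fun y => 0 < y)); [intros y Hy; now rewrite pw_pos | now apply (open_gt 0)].
Qed.

Lemma continuous_pw (x a : R) : 0 < a -> continuous (fun t => pw t a) x.
Proof.
intros Ha; destruct (Rtotal_order x 0) as [Hx|[->|Hx]].
- apply continuous_ext_loc with (fun _ => 0); [|apply continuous_const].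
  apply (filter_imp (fun y => y < 0)); [|now apply (open_lt 0)].
  intros y Hy; unfold pw; destruct (Rle_dec y 0); [reflexivity | lra].
- apply (proj2 (filterlim_locally (F := locally 0) (fun t => pw t a) (pw 0 a))).
  intros eps; rewrite pw_0.
  (* The radius solves y^a = eps. *)
  exists (mkposreal (Rpower eps (/ a)) (exp_pos _)); intros y Hy.
  change (Rabs (y - 0) < Rpower eps (/ a)) in Hy; rewrite Rminus_0_r in Hy.
  change (Rabs (pw y a - 0) < eps); rewrite Rminus_0_r, Rabs_pos_eq by apply pw_ge_0.
  destruct (Rle_dec y 0) as [Hy0|Hy0].
  + unfold pw; destruct (Rle_dec y 0); [apply cond_pos | lra].
  + rewrite pw_pos by lra; rewrite Rabs_pos_eq in Hy by lra.
    replace (pos eps) with (Rpower (Rpower eps (/ a)) a).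
    * apply Rlt_Rpower_l; lra.
    * rewrite Rpower_mult, Rinv_l, Rpower_1 by (try lra; apply cond_pos); reflexivity.
- apply (ex_derive_continuous (K := R_AbsRing) (V := R_NormedModule)); eexists; now apply is_derive_pw.
Qed.

Lemma continuous_pw_exp (a x : R) : 0 < a -> continuous (fun t => pw t a * exp (- t)) x.
Proof.
intros Ha; apply (continuous_mult (K := R_AbsRing)); [now apply continuous_pw|].
apply (ex_derive_continuous (K := R_AbsRing) (V := R_NormedModule)); auto_derive; trivial.
Qed.

Lemma is_derive_RInt_upper (f : R -> R) (x : R) :
  (forall y, continuous f y) -> is_derive (fun T => RInt f 0 T) x (f x).
Proof.
intros Cf; apply (is_derive_RInt (V := R_NormedModule) f (fun T => RInt f 0 T) 0 x); [|apply Cf].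
apply filter_forall; intros y.
apply (RInt_correct (V := R_CompleteNormedModule)), (ex_RInt_continuous (V := R_CompleteNormedModule)).
intros; apply Cf.
Qed.

(* The integral of [t^(mu-1) e^(-t)] over [0, T], integrated by parts so that no singularity is left at 0. *)
Definition lower_gamma (mu T : R) : R :=
  / mu * (pw T mu * exp (- T) + RInt (fun t => pw t mu * exp (- t)) 0 T).

Lemma lower_gamma_0 (mu : R) : lower_gamma mu 0 = 0.
Proof.
unfold lower_gamma; rewrite pw_0, RInt_point; change (zero (G := R_CompleteNormedModule)) with 0; ring.
Qed.

Lemma continuous_lower_gamma (mu T : R) : 0 < mu -> continuous (lower_gamma mu) T.
Proof.
intros Hmu; unfold lower_gamma.
apply (continuous_scal_r (V := R_NormedModule) (/ mu) (fun T => pw T mu * exp (- T) + RInt (fun t => pw t mu * exp (- t)) 0 T)).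
apply (continuous_plus (V := R_NormedModule)).
- now apply continuous_pw_exp.
- apply (ex_derive_continuous (K := R_AbsRing) (V := R_NormedModule)); eexists.
  apply is_derive_RInt_upper; intros; now apply continuous_pw_exp.
Qed.

Lemma is_derive_lower_gamma (mu T : R) :
  0 < mu -> 0 < T -> is_derive (lower_gamma mu) T (Rpower T (mu - 1) * exp (- T)).
Proof.
intros Hmu HT; unfold lower_gamma.
evar_last.
- apply (is_derive_scal (fun T => pw T mu * exp (- T) + RInt (fun t => pw t mu * exp (- t)) 0 T)).
  apply (is_derive_plus (K := R_AbsRing) (V := R_NormedModule)).
  + apply (is_derive_mult (fun T => pw T mu) (fun T => exp (- T))).
    * now apply is_derive_pw.
    * instantiate (1 := - exp (- T)); auto_derive; [trivial | ring].
    * apply Rmult_comm.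
  + apply is_derive_RInt_upper; intros; now apply continuous_pw_exp.
- unfold plus, mult; simpl; unfold mult; simpl; rewrite pw_pos by assumption; field; lra.
Qed.

Lemma lower_gamma_mono (mu x y : R) :
  0 < mu -> 0 <= x <= y -> lower_gamma mu x <= lower_gamma mu y.
Proof.
intros Hmu [Hx Hxy].
apply Ropp_le_cancel.
apply (decreasing_of_derive_le_0 (fun T => - lower_gamma mu T) (fun T => - (Rpower T (mu - 1) * exp (- T))) x y Hxy).
- intros t Ht; apply (is_derive_opp (lower_gamma mu)), is_derive_lower_gamma; lra.
- intros t Ht; apply (continuous_opp (V := R_NormedModule) (lower_gamma mu)), continuous_lower_gamma; lra.
- intros t Ht; assert (0 < Rpower t (mu - 1) * exp (- t)) by (apply Rmult_lt_0_compat; apply exp_pos); lra.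
Qed.

(** Beyond 1 the density is at most e^(-t), so [lower_gamma] plus e^(-T) decreases there and a limit
    exists. It equals the improper integral because [lower_gamma] is a primitive on the open
    half-line and tends to 0 at 0. *)
Lemma lower_gamma_lim (mu : R) :
  0 < mu < 1 -> filterlim (lower_gamma mu) (Rbar_locally p_infty) (locally (Gamma mu)).
Proof.
intros Hmu.
destruct (exp_decay_cauchy (fun T => RtoC (lower_gamma mu T)) 1 1) as [l Hl].
{ intros x y Hxy.
  replace (RtoC (lower_gamma mu y) - RtoC (lower_gamma mu x))%C
    with (RtoC (lower_gamma mu y - lower_gamma mu x)) by now rewrite RtoC_minus.
  rewrite Cmod_R, Rabs_pos_eq.
  2: generalize (lower_gamma_mono mu x y ltac:(lra) ltac:(lra)); lra.
  assert (lower_gamma mu y + exp (- y) <= lower_gamma mu x + exp (- x)); [|lra].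
  apply (decreasing_of_derive_le_0 (fun T => lower_gamma mu T + exp (- T))
    (fun T => Rpower T (mu - 1) * exp (- T) + - exp (- T))); [lra | | |].
  - intros t Ht; apply (is_derive_plus (K := R_AbsRing) (V := R_NormedModule)).
    + apply is_derive_lower_gamma; lra.
    + auto_derive; [trivial | ring].
  - intros t Ht; apply (continuous_plus (V := R_NormedModule)).
    + apply continuous_lower_gamma; lra.
    + apply (ex_derive_continuous (K := R_AbsRing) (V := R_NormedModule)); auto_derive; trivial.
  - intros t Ht.
    assert (Rpower t (mu - 1) <= 1).
    { apply Rle_trans with (Rpower t 0); [apply Rle_Rpower; lra | rewrite Rpower_O; lra]. }
    generalize (exp_pos (- t)); nra. }
assert (Hl1 : filterlim (lower_gamma mu) (Rbar_locally p_infty) (locally (fst l))).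
{ apply (filterlim_comp _ _ _ (fun T => RtoC (lower_gamma mu T)) fst _ _ _ Hl).
  apply (continuous_fst (U := R_UniformSpace) (V := R_UniformSpace)). }
replace (Gamma mu) with (fst l); [exact Hl1|].
symmetry; unfold Gamma.
apply (is_RInt_gen_unique (V := R_CompleteNormedModule)).
assert (Hl2 : filterlim (fun ab => lower_gamma mu (snd ab) - lower_gamma mu (fst ab))
  (filter_prod (at_right 0) (Rbar_locally p_infty)) (locally (fst l))).
{ replace (fst l) with (minus (fst l) (lower_gamma mu 0)).
  2: { rewrite lower_gamma_0; unfold minus, plus, opp; simpl; ring. }
  apply (filterlim_comp_2 (F := filter_prod (at_right 0) (Rbar_locally p_infty))
    (G := locally (fst l)) (H := locally (opp (lower_gamma mu 0)))
    (fun ab => lower_gamma mu (snd ab)) (fun ab => opp (lower_gamma mu (fst ab))) plus).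
  - apply (filterlim_comp _ _ _ snd (lower_gamma mu)) with (2 := Hl1); apply filterlim_snd.
  - apply (filterlim_comp _ _ _ fst (fun x => opp (lower_gamma mu x))) with (at_right 0).
    + apply filterlim_fst.
    + intros P HP; apply (filter_le_within (F := locally 0) (fun u => 0 < u) (fun x => P (opp (lower_gamma mu x)))).
      revert P HP; apply (continuous_opp (V := R_NormedModule) (lower_gamma mu)), continuous_lower_gamma; lra.
  - apply (filterlim_plus (V := R_NormedModule)). }
apply filterlimi_lim_ext_loc with (2 := Hl2).
exists (fun x => 0 < x) (fun y => 1 < y).
- now exists (mkposreal 1 Rlt_0_1).
- now exists 1.
- intros x y Hx Hy; simpl fst; simpl snd.
  apply (is_RInt_derive (V := R_CompleteNormedModule) (lower_gamma mu)).
  + intros t Ht; apply is_derive_lower_gamma; [lra|].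
    apply Rlt_le_trans with (2 := proj1 Ht); apply Rmin_glb_lt; lra.
  + intros t Ht; assert (0 < t) by (apply Rlt_le_trans with (2 := proj1 Ht); apply Rmin_glb_lt; lra).
    apply (ex_derive_continuous (K := R_AbsRing) (V := R_NormedModule)); unfold Rpower; auto_derive; assumption.
Qed.

Lemma lower_gamma_le_Gamma (mu T : R) : 0 < mu < 1 -> 0 <= T -> lower_gamma mu T <= Gamma mu.
Proof.
intros Hmu HT.
apply (filterlim_le (F := Rbar_locally p_infty) (fun _ => lower_gamma mu T) (lower_gamma mu) (lower_gamma mu T) (Gamma mu)).
- exists T; intros x Hx; apply lower_gamma_mono; lra.
- apply filterlim_const.
- now apply lower_gamma_lim.
Qed.

Lemma filterlim_comp_ex_derive {T : Type} (F : (T -> Prop) -> Prop) (f : T -> R) (g : R -> R) (a b : R) :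
  filterlim f F (locally a) -> ex_derive g a -> g a = b ->
  filterlim (fun x => g (f x)) F (locally b).
Proof.
intros Hf Hg <-; apply (filterlim_comp _ _ _ f g _ _ _ Hf).
now apply (ex_derive_continuous (K := R_AbsRing) (V := R_NormedModule)).
Qed.

Lemma Cmod_vert_increment (nu s x y : R) :
  0 < s -> nu <= 0 -> 0 <= x <= y ->
  Cmod (vert nu y s - vert nu x s) <= Rpower s nu * (exp (- x) - exp (- y)).
Proof.
intros Hs Hnu [Hx Hxy].
replace (Rpower s nu * (exp (- x) - exp (- y)))
  with (- Rpower s nu * exp (- y) - - Rpower s nu * exp (- x)) by ring.
apply (Cmod_increment_le (fun T => vert nu T s) (fun T => - Ci * rotint nu s T)%C
  (fun T => - Rpower s nu * exp (- T)) (fun T => Rpower s nu * exp (- T))); [exact Hxy | | | | |].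
- intros; now apply is_derC_vert_T.
- intros; auto_derive; [trivial | ring].
- intros; eapply is_derC_contC; now apply is_derC_vert_T.
- intros; apply (ex_derive_continuous (K := R_AbsRing) (V := R_NormedModule)); auto_derive; trivial.
- intros; rewrite Cmod_mult, Cmod_opp, Cmod_Ci, Rmult_1_l; now apply Cmod_rotint_le.
Qed.

(** Primitive of s^nu e^{is} that vanishes at infinity. *)
Definition osc (nu s : R) : C :=
  iota (T := C_R_CompleteNormedModule) (fun l => filterlimC (fun T => vert nu T s) (Rbar_locally p_infty) l).

Lemma osc_lim (nu s : R) :
  0 < s -> nu <= 0 -> filterlimC (fun T => vert nu T s) (Rbar_locally p_infty) (osc nu s).
Proof.
intros Hs Hnu.
destruct (exp_decay_cauchy (fun T => vert nu T s) 0 (Rpower s nu)) as [l Hl].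
{ intros x y Hxy; now apply Cmod_vert_increment. }
assert (E : osc nu s = l) by exact (iota_filterlim_locally (V := C_R_CompleteNormedModule) _ l Hl).
rewrite E; exact Hl.
Qed.

Lemma filterlimC_plus_const {T : Type} (F : (T -> Prop) -> Prop) {FF : Filter F} (f : T -> C) (l z : C) :
  filterlimC f F l -> filterlimC (fun x => (f x + z)%C) F (l + z)%C.
Proof.
intros Hf.
apply (filterlim_comp_2 (F := F) (G := locally (T := C_R_NormedModule) l) (H := locally (T := C_R_NormedModule) z)
  f (fun _ => z) (plus (G := C_R_NormedModule))).
- exact Hf.
- apply filterlim_const.
- apply (filterlim_plus (V := C_R_NormedModule)).
Qed.

(** The common shape of the estimates on [osc]: [- z] is the expected main term, and a bound at
    finite height [T], whose error may still depend on [T], passes to the limit. *)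
Lemma Cmod_osc_plus_le (nu s m c : R) (z : C) (g : R -> R) :
  0 < s -> nu <= 0 ->
  (forall T, m < T -> Cmod (vert nu T s + z) <= g T) ->
  filterlim g (Rbar_locally p_infty) (locally c) ->
  Cmod (osc nu s + z) <= c.
Proof.
intros Hs Hnu H Hg.
apply (Cmod_lim_le (Rbar_locally p_infty) (fun T => (vert nu T s + z)%C) g); [|exact Hg|now exists m].
exact (filterlimC_plus_const _ _ _ z (osc_lim nu s Hs Hnu)).
Qed.

Lemma Cmod_osc_le (nu s : R) : 0 < s -> nu <= 0 -> Cmod (osc nu s) <= Rpower s nu.
Proof.
intros Hs Hnu.
replace (osc nu s) with (osc nu s + RtoC 0)%C by ring.
apply (Cmod_osc_plus_le nu s 0 _ _ (fun _ => Rpower s nu)); [exact Hs | exact Hnu | | apply filterlim_const].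
intros T HT; replace (vert nu T s + RtoC 0)%C with (vert nu T s - vert nu 0 s)%C by (rewrite vert_0; ring).
apply Rle_trans with (1 := Cmod_vert_increment nu s 0 T Hs Hnu ltac:(lra)).
rewrite Ropp_0, exp_0; generalize (exp_pos (- T)) (exp_pos (nu * ln s)); fold (Rpower s nu); nra.
Qed.

Lemma Rpower_sum_sq_le_r (nu s t : R) :
  0 < t -> nu <= 0 -> Rpower (s ^ 2 + t ^ 2) (nu / 2) <= Rpower t nu.
Proof. intros; rewrite Rplus_comm; now apply Rpower_sum_sq_le. Qed.

(** Here |s + i t| is bounded below by [t] instead of [s], so the bound stays finite as [s] tends to
    0, unlike s^(mu-1). *)
Lemma Cmod_osc_le_Gamma (mu s : R) : 0 < s -> 0 < mu < 1 -> Cmod (osc (mu - 1) s) <= Gamma mu.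
Proof.
intros Hs Hmu.
replace (osc (mu - 1) s) with (osc (mu - 1) s + RtoC 0)%C by ring.
apply (Cmod_osc_plus_le _ s 0 _ _ (fun _ => Gamma mu)); [exact Hs | lra | | apply filterlim_const].
intros T HT; replace (vert (mu - 1) T s + RtoC 0)%C with (vert (mu - 1) T s - vert (mu - 1) 0 s)%C by (rewrite vert_0; ring).
apply Rle_trans with (lower_gamma mu T - lower_gamma mu 0).
2: rewrite lower_gamma_0, Rminus_0_r; apply lower_gamma_le_Gamma; lra.
apply (Cmod_increment_le (fun T => vert (mu - 1) T s) (fun T => - Ci * rotint (mu - 1) s T)%C
  (lower_gamma mu) (fun T => Rpower T (mu - 1) * exp (- T))); [lra | | | | |].
- intros; now apply is_derC_vert_T.
- intros; apply is_derive_lower_gamma; lra.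
- intros; eapply is_derC_contC; now apply is_derC_vert_T.
- intros; apply continuous_lower_gamma; lra.
- intros t Ht; rewrite Cmod_mult, Cmod_opp, Cmod_Ci, Rmult_1_l, Cmod_rotint, Rmult_comm.
  apply Rmult_le_compat_r; [left; apply exp_pos | apply Rpower_sum_sq_le_r; lra].
Qed.

(** Replace (s + i t)^nu by s^nu on the vertical line. The error is weighted by t e^(-t), whose
    integral over the half-line is 1. *)
Lemma Cmod_osc_expansion (nu s : R) :
  0 < s -> nu <= 0 ->
  Cmod (osc nu s + Ci * cis s * RtoC (Rpower s nu)) <= - nu * Rpower s (nu - 1).
Proof.
intros Hs Hnu.
set (z := (Ci * cis s * RtoC (Rpower s nu))%C).
assert (Hz : Cmod z = Rpower s nu).
{ unfold z; rewrite !Cmod_mult, Cmod_Ci, Cmod_cis, Cmod_R, Rabs_pos_eq; [ring | left; apply exp_pos]. }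
assert (Hc : 0 <= - nu * Rpower s (nu - 1)).
{ apply Rmult_le_pos; [lra | left; apply exp_pos]. }
apply (Cmod_osc_plus_le nu s 0 _ _ (fun T => - nu * Rpower s (nu - 1) + Rpower s nu * exp (- T)));
  [exact Hs | exact Hnu | |].
- intros T HT.
  (* The factor 1 - e^(-T) is the integral of e^(-t) up to [T]: the main term truncated at the same
     height. *)
  set (H T := (vert nu T s + z * RtoC (1 - exp (- T)))%C).
  assert (HH : Cmod (H T - H 0) <= - nu * Rpower s (nu - 1)).
  { set (k := - nu * Rpower s (nu - 1)) in *.
    (* -(t + 1) e^(-t) is a primitive of t e^(-t), and its increment over [0, T] is at most 1. *)
    apply Rle_trans with ((- k * ((T + 1) * exp (- T))) - (- k * ((0 + 1) * exp (- 0)))).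
    2: { rewrite Ropp_0, exp_0.
         assert (0 <= k * ((T + 1) * exp (- T))); [|lra].
         apply Rmult_le_pos; [exact Hc | apply Rmult_le_pos; [lra | left; apply exp_pos]]. }
    apply (Cmod_increment_le H (fun T => - Ci * rotint nu s T + z * RtoC (exp (- T)))%C
      (fun T => - k * ((T + 1) * exp (- T))) (fun T => k * T * exp (- T))); [lra | | | | |].
    - intros t Ht; apply is_derC_plus; [now apply is_derC_vert_T|].
      apply is_derC_scal, is_derC_RtoC; auto_derive; [trivial | ring].
    - intros t Ht; auto_derive; [trivial | ring].
    - intros t Ht; eapply is_derC_contC; apply is_derC_plus; [now apply is_derC_vert_T|].
      apply is_derC_scal, (is_derC_RtoC _ _ (exp (- t))); auto_derive; [trivial | ring].
    - intros; apply (ex_derive_continuous (K := R_AbsRing) (V := R_NormedModule)); auto_derive; trivial.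
    - intros t Ht.
      replace (- Ci * rotint nu s t + z * RtoC (exp (- t)))%C
        with (- Ci * cis s * RtoC (exp (- t)) * (cpow nu s t - RtoC (Rpower s nu)))%C.
      2: unfold rotint, z; ring.
      rewrite !Cmod_mult, Cmod_opp, Cmod_Ci, Cmod_cis, Cmod_R, Rabs_pos_eq by (left; apply exp_pos).
      rewrite !Rmult_1_l, Rmult_comm; apply Rmult_le_compat_r; [left; apply exp_pos|].
      apply cpow_close_to_real; lra. }
  replace (vert nu T s + z)%C with ((H T - H 0) + z * RtoC (exp (- T)))%C.
  2: { unfold H; rewrite vert_0, Ropp_0, exp_0, RtoC_minus, !RtoC_minus; ring. }
  apply Rle_trans with (1 := Cmod_triangle _ _); apply Rplus_le_compat; [exact HH|].
  rewrite Cmod_mult, Hz, Cmod_R, Rabs_pos_eq; [lra | left; apply exp_pos].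
- apply (filterlim_comp_ex_derive _ (fun T => exp (- T)) (fun x => - nu * Rpower s (nu - 1) + Rpower s nu * x) 0);
  [exact exp_neg_lim | auto_derive; trivial | ring].
Qed.

(** Two replacements, e^(is) by 1 and (s + i t)^(mu-1) by (i t)^(mu-1), each costing a factor [s].
    The power t^(mu-2) from the second is not integrable at 0, so the estimate can only be
    integrated away from the real axis. *)
Lemma Cmod_rotint_close_to_imaginary (mu s t : R) :
  0 < mu < 1 -> 0 < s -> 0 < t ->
  Cmod (- Ci * rotint (mu - 1) s t + cis (PI * mu / 2) * RtoC (Rpower t (mu - 1) * exp (- t)))
    <= s * (Rpower t (mu - 1) * exp (- t)) + (1 - mu) * Rpower t (mu - 2) * s.
Proof.
intros Hmu Hs Ht; set (nu := mu - 1).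
assert (Hci : cis (PI * mu / 2) = (Ci * cis (nu * (PI / 2)))%C).
{ replace (PI * mu / 2) with (PI / 2 + nu * (PI / 2)) by (unfold nu; field).
  rewrite cis_plus; f_equal; unfold cis; now rewrite cos_PI2, sin_PI2. }
replace (- Ci * rotint nu s t + cis (PI * mu / 2) * RtoC (Rpower t nu * exp (- t)))%C
  with (- Ci * RtoC (exp (- t)) * (cis s * (cpow nu s t - RtoC (Rpower t nu) * cis (nu * (PI / 2)))
         + (cis s - RtoC 1) * (RtoC (Rpower t nu) * cis (nu * (PI / 2)))))%C.
2: rewrite Hci, RtoC_mult; unfold rotint; ring.
rewrite !Cmod_mult, Cmod_opp, Cmod_Ci, Cmod_R, Rabs_pos_eq, Rmult_1_l by (left; apply exp_pos).
assert (He : 0 < exp (- t) <= 1).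
{ split; [apply exp_pos|]; rewrite <- exp_0; apply exp_le_compat; lra. }
assert (H1 := cpow_close_to_imaginary nu s t Hs ltac:(unfold nu; lra) Ht).
assert (H2 := Cmod_cis_sub_1_le s (Rlt_le _ _ Hs)).
replace (nu - 1) with (mu - 2) in H1 by (unfold nu; ring).
replace (- nu) with (1 - mu) in H1 by (unfold nu; ring).
assert (Hp := exp_pos (nu * ln t)); fold (Rpower t nu) in Hp.
apply Rle_trans with (exp (- t) * ((1 - mu) * Rpower t (mu - 2) * s + s * Rpower t nu)).
- apply Rmult_le_compat_l; [lra|].
  apply Rle_trans with (1 := Cmod_triangle _ _).
  rewrite !Cmod_mult, !Cmod_cis, Cmod_R, Rabs_pos_eq, Rmult_1_l, Rmult_1_r by lra.
  apply Rplus_le_compat; [exact H1|]; apply Rmult_le_compat_r; lra.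
- assert (0 <= (1 - mu) * Rpower t (mu - 2) * s).
  { apply Rmult_le_pos; [apply Rmult_le_pos; [lra | left; apply exp_pos] | lra]. }
  nra.
Qed.

(* Split the vertical segment at height [s]: below it both powers are integrable, above it they are close. *)
Lemma Cmod_osc_near_0 (mu s : R) :
  0 < mu < 1 -> 0 < s ->
  Cmod (osc (mu - 1) s + cis (PI * mu / 2) * RtoC (Gamma mu))
    <= (2 / mu + 1) * Rpower s mu + s * Gamma mu.
Proof.
intros Hmu Hs; set (z := cis (PI * mu / 2)).
assert (Hz : Cmod z = 1) by apply Cmod_cis.
assert (Hnu : mu - 1 <= 0) by lra.
set (H T := (vert (mu - 1) T s + z * RtoC (lower_gamma mu T))%C).
assert (DH : forall t, 0 < t -> is_derC H t
  (- Ci * rotint (mu - 1) s t + z * RtoC (Rpower t (mu - 1) * exp (- t)))%C).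
{ intros t Ht; apply is_derC_plus; [now apply is_derC_vert_T|].
  apply is_derC_scal, is_derC_RtoC, is_derive_lower_gamma; lra. }
assert (CH : forall t, contC H t).
{ intros t; apply (continuous_plus (V := C_R_NormedModule)).
  - eapply is_derC_contC; now apply is_derC_vert_T.
  - apply contC_mult; [apply continuous_const|].
    apply contC_RtoC, continuous_lower_gamma; lra. }
(* Below height [s] nothing is gained from cancellation: each of the two terms is at most t^(mu-1),
   and 2 t^mu / mu is a primitive of the sum. *)
assert (H1 : Cmod (H s - H 0) <= 2 / mu * pw s mu - 2 / mu * pw 0 mu).
{ apply (Cmod_increment_le H _ (fun t => 2 / mu * pw t mu) (fun t => 2 / mu * (mu * Rpower t (mu - 1))) 0 s
    (Rlt_le _ _ Hs) (fun t Ht => DH t (proj1 Ht))).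
  - intros t Ht; apply (is_derive_scal (fun t => pw t mu)), is_derive_pw; lra.
  - intros; apply CH.
  - intros; apply (continuous_scal_r (V := R_NormedModule) (2 / mu) (fun t => pw t mu)), continuous_pw; lra.
  - intros t Ht; apply Rle_trans with (1 := Cmod_triangle _ _).
    rewrite !Cmod_mult, Cmod_opp, Cmod_Ci, Hz, !Rmult_1_l, Cmod_rotint, Cmod_R, Rabs_pos_eq.
    2: left; apply Rmult_lt_0_compat; apply exp_pos.
    generalize (Rpower_sum_sq_le_r (mu - 1) s t ltac:(lra) ltac:(lra)); intros Hr.
    assert (He : 0 < exp (- t) <= 1).
    { split; [apply exp_pos|]; rewrite <- exp_0; apply exp_le_compat; lra. }
    assert (Hp := exp_pos ((mu - 1) * ln t)); fold (Rpower t (mu - 1)) in Hp.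
    assert (Hp' := exp_pos ((mu - 1) / 2 * ln (s ^ 2 + t ^ 2))); fold (Rpower (s ^ 2 + t ^ 2) ((mu - 1) / 2)) in Hp'.
    replace (2 / mu * (mu * Rpower t (mu - 1))) with (2 * Rpower t (mu - 1)) by (field; lra).
    nra. }
rewrite pw_0, pw_pos, Rmult_0_r, Rminus_0_r in H1 by assumption.
assert (H2 : forall T, s < T -> Cmod (H T - H s) <= s * Gamma mu + Rpower s mu).
{ intros T HT.
  (* The terms in t^(mu-1) e^(-t) and in t^(mu-2) integrate to s times [lower_gamma] and to -s
     t^(mu-1); at the lower end t = s the latter contributes s^mu. *)
  apply Rle_trans with ((s * lower_gamma mu T - s * Rpower T (mu - 1)) - (s * lower_gamma mu s - s * Rpower s (mu - 1))).
  - apply (Cmod_increment_le H (fun t => - Ci * rotint (mu - 1) s t + z * RtoC (Rpower t (mu - 1) * exp (- t)))%C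
      (fun t => s * lower_gamma mu t - s * Rpower t (mu - 1))
      (fun t => s * (Rpower t (mu - 1) * exp (- t)) - s * ((mu - 1) * Rpower t (mu - 1 - 1)))); [lra | | | | |].
    + intros t Ht; apply DH; lra.
    + intros t Ht; apply (is_derive_minus (K := R_AbsRing) (V := R_NormedModule)).
      * apply (is_derive_scal (lower_gamma mu)), is_derive_lower_gamma; lra.
      * apply (is_derive_scal (fun t => Rpower t (mu - 1))), is_derive_Rpower; lra.
    + intros; apply CH.
    + intros t Ht; apply (continuous_minus (V := R_NormedModule)).
      * apply (continuous_scal_r (V := R_NormedModule) s (lower_gamma mu)), continuous_lower_gamma; lra.
      * apply (continuous_scal_r (V := R_NormedModule) s (fun t => Rpower t (mu - 1))).
        apply (ex_derive_continuous (K := R_AbsRing) (V := R_NormedModule)); eexists; apply is_derive_Rpower; lra.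
    + intros t Ht.
      apply Rle_trans with (1 := Cmod_rotint_close_to_imaginary mu s t Hmu Hs ltac:(lra)).
      replace (mu - 1 - 1) with (mu - 2) by ring; lra.
  - assert (HG := lower_gamma_le_Gamma mu T Hmu ltac:(lra)).
    assert (HG' := lower_gamma_mono mu 0 s ltac:(lra) ltac:(lra)); rewrite lower_gamma_0 in HG'.
    assert (Hp : 0 < Rpower T (mu - 1)) by apply exp_pos.
    replace (Rpower s mu) with (s * Rpower s (mu - 1)).
    2: { rewrite <- (Rpower_1 s) at 1 by assumption; rewrite <- Rpower_plus; f_equal; ring. }
    assert (0 <= s * Rpower T (mu - 1)) by nra.
    assert (0 <= s * lower_gamma mu s) by nra.
    assert (s * lower_gamma mu T <= s * Gamma mu) by nra.
    lra. }
assert (HG : 0 <= Gamma mu).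
{ rewrite <- (lower_gamma_0 mu); apply lower_gamma_le_Gamma; lra. }
apply (Cmod_osc_plus_le _ s s _ _
  (fun T => (2 / mu + 1) * Rpower s mu + s * Gamma mu + (Gamma mu - lower_gamma mu T))); [exact Hs | lra | |].
- intros T HT.
  replace (vert (mu - 1) T s + z * RtoC (Gamma mu))%C
    with ((H T - H s) + (H s - H 0) + z * RtoC (Gamma mu - lower_gamma mu T))%C.
  2: { unfold H; rewrite vert_0, lower_gamma_0, RtoC_minus; ring. }
  apply Rle_trans with (1 := Cmod_triangle _ _).
  rewrite Cmod_mult, Hz, Cmod_R, Rabs_pos_eq.
  2: generalize (lower_gamma_le_Gamma mu T Hmu ltac:(lra)); lra.
  generalize (Cmod_triangle (H T - H s) (H s - H 0)) (H2 T HT); lra.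
- set (k := (2 / mu + 1) * Rpower s mu + s * Gamma mu).
  apply (filterlim_comp_ex_derive _ (lower_gamma mu) (fun x => k + (Gamma mu - x)) (Gamma mu));
  [now apply lower_gamma_lim | auto_derive; trivial | ring].
Qed.

Lemma rotint_0 (nu s : R) : 0 < s -> rotint nu s 0 = (RtoC (Rpower s nu) * cis s)%C.
Proof. intros Hs; unfold rotint; rewrite cpow_0, Ropp_0, exp_0 by assumption; ring. Qed.

Lemma scal_RtoC (a : R) (z : C) : scal (K := R_AbsRing) (V := C_R_NormedModule) a z = (RtoC a * z)%C.
Proof.
apply injective_projections.
- change (a * fst z = fst (RtoC a * z)%C); simpl; ring.
- change (a * snd z = snd (RtoC a * z)%C); simpl; ring.
Qed.

Lemma is_derC_of_linear_bound (f : R -> C) (x : R) (l : C) :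
  (forall eps, 0 < eps -> locally x (fun y => Cmod (f y - f x - RtoC (y - x) * l) <= eps * Rabs (y - x))) ->
  is_derC f x l.
Proof.
intros H; split; [apply is_linear_scal_l|].
intros x0 Hx0; rewrite <- (is_filter_lim_locally_unique (V := R_NormedModule) x x0 Hx0).
intros eps; generalize (H eps (cond_pos eps)); apply filter_imp; intros y Hy.
rewrite norm_Cmod.
match goal with |- Cmod ?z <= _ => assert (E : z = (f y - f x - RtoC (y - x) * l)%C) end.
{ apply injective_projections.
  - change (fst (f y) + - fst (f x) + - ((y + - x) * fst l) = fst (f y - f x - RtoC (y - x) * l)%C); simpl; ring.
  - change (snd (f y) + - snd (f x) + - ((y + - x) * snd l) = snd (f y - f x - RtoC (y - x) * l)%C); simpl; ring. }
rewrite E; exact Hy.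
Qed.

(* Pass to the limit T -> oo in the mean value inequality for [vert nu T]. *)
Lemma is_derC_osc (nu s : R) :
  0 < s -> nu <= 0 -> is_derC (osc nu) s (RtoC (Rpower s nu) * cis s)%C.
Proof.
intros Hs Hnu; set (l := (RtoC (Rpower s nu) * cis s)%C).
apply is_derC_of_linear_bound; intros eps Heps.
assert (Hc : contC (fun y => RtoC (Rpower y nu) * cis y)%C s).
{ apply contC_mult; [|apply contC_cis, continuous_id].
  apply contC_RtoC, (ex_derive_continuous (K := R_AbsRing) (V := R_NormedModule)); eexists; now apply is_derive_Rpower. }
assert (Hc' := proj1 (filterlim_locally_ball_norm (U := C_R_NormedModule) (F := locally s) _ _) Hc (mkposreal eps Heps)).
destruct Hc' as [del Hdel].
(* Staying beyond [s / 2] makes the contribution of the top edge at height [T] exponentially small,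
   uniformly near [s]. *)
assert (Hpos : 0 < Rmin del (s / 2)) by (apply Rmin_glb_lt; [apply cond_pos | lra]).
exists (mkposreal _ Hpos); intros y Hy.
change (Rabs (y - s) < Rmin del (s / 2)) in Hy.
assert (Hy1 : Rabs (y - s) < del) by (apply Rlt_le_trans with (1 := Hy), Rmin_l).
assert (Hy2 : Rabs (y - s) < s / 2) by (apply Rlt_le_trans with (1 := Hy), Rmin_r).
assert (Hinc : forall T a b, 0 < T -> s / 2 <= a -> a <= b -> Rabs (a - s) < del -> Rabs (b - s) < del ->
  Cmod (vert nu T b - vert nu T a - RtoC (b - a) * l) <= (eps + Rpower (s / 2) nu * exp (- T)) * (b - a)).
{ intros T a b HT Ha Hab Has Hbs.
  set (k := eps + Rpower (s / 2) nu * exp (- T)).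
  replace (vert nu T b - vert nu T a - RtoC (b - a) * l)%C
    with ((vert nu T b - l * RtoC b) - (vert nu T a - l * RtoC a))%C by (rewrite RtoC_minus; ring).
  replace (k * (b - a)) with (k * b - k * a) by ring.
  apply (Cmod_increment_le (fun y => vert nu T y - l * RtoC y)%C
    (fun y => rotint nu y 0 - rotint nu y T - l * RtoC 1)%C (fun y => k * y) (fun _ => k) a b Hab).
  - intros x Hx; apply is_derC_minus; [apply is_derC_vert_s; lra|].
    apply is_derC_scal, is_derC_RtoC, (is_derive_id (K := R_AbsRing)).
  - intros; auto_derive; [trivial | ring].
  - intros x Hx; eapply is_derC_contC; apply is_derC_minus; [apply is_derC_vert_s; lra|].
    apply is_derC_scal, is_derC_RtoC, (is_derive_id (K := R_AbsRing)).
  - intros; apply (ex_derive_continuous (K := R_AbsRing) (V := R_NormedModule)); auto_derive; trivial.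
  - intros x Hx; rewrite rotint_0 by lra.
    replace (RtoC (Rpower x nu) * cis x - rotint nu x T - l * RtoC 1)%C
      with ((RtoC (Rpower x nu) * cis x - l) + - rotint nu x T)%C by ring.
    apply Rle_trans with (1 := Cmod_triangle _ _); apply Rplus_le_compat.
    + left.
      assert (Hb : ball s del x).
      { change (Rabs (x - s) < del); apply Rabs_lt_between' in Has, Hbs; apply Rabs_lt_between'; lra. }
      assert (Hd := Hdel x Hb); unfold ball_norm in Hd; rewrite norm_Cmod in Hd; exact Hd.
    + rewrite Cmod_opp; apply Rle_trans with (Rpower x nu * exp (- T)); [apply Cmod_rotint_le; lra|].
      apply Rmult_le_compat_r; [left; apply exp_pos|].
      unfold Rpower; apply exp_le_compat, Rmult_le_compat_neg_l; [lra | apply ln_le; lra]. }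
assert (Hfin : forall a b, s / 2 <= a -> a <= b -> Rabs (a - s) < del -> Rabs (b - s) < del ->
  Cmod (osc nu b - osc nu a - RtoC (b - a) * l) <= eps * (b - a)).
{ intros a b Ha Hab Has Hbs.
  apply (Cmod_lim_le (Rbar_locally p_infty) (fun T => vert nu T b + (RtoC (-1) * vert nu T a + - (RtoC (b - a) * l)))%C
    (fun T => (eps + Rpower (s / 2) nu * exp (- T)) * (b - a))).
  - replace (osc nu b - osc nu a - RtoC (b - a) * l)%C
      with (osc nu b + (RtoC (-1) * osc nu a + - (RtoC (b - a) * l)))%C.
    2: apply injective_projections; simpl; ring.
    apply (filterlim_comp_2 (G := locally (T := C_R_NormedModule) (osc nu b))
      (H := locally (T := C_R_NormedModule) (RtoC (-1) * osc nu a + - (RtoC (b - a) * l))%C)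
      (fun T => vert nu T b) (fun T => RtoC (-1) * vert nu T a + - (RtoC (b - a) * l))%C (plus (G := C_R_NormedModule))).
    + apply osc_lim; lra.
    + apply (filterlimC_plus_const (Rbar_locally p_infty)).
      apply (filterlim_comp _ _ _ (fun T => vert nu T a) (fun x => RtoC (-1) * x)%C _ _ _ (osc_lim nu a ltac:(lra) Hnu)).
      apply (filterlim_ext (fun x => scal (K := R_AbsRing) (V := C_R_NormedModule) (-1) x)).
      { intros x; apply scal_RtoC. }
      replace (RtoC (-1) * osc nu a)%C with (scal (K := R_AbsRing) (V := C_R_NormedModule) (-1) (osc nu a)).
      2: apply scal_RtoC.
      apply (filterlim_scal_r (V := C_R_NormedModule)).
    + apply (filterlim_plus (V := C_R_NormedModule)).
  - apply (filterlim_comp_ex_derive _ (fun T => exp (- T)) (fun x => (eps + Rpower (s / 2) nu * x) * (b - a)) 0);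
    [exact exp_neg_lim | auto_derive; trivial | ring].
  - exists 0; intros T HT.
    replace (vert nu T b + (RtoC (-1) * vert nu T a + - (RtoC (b - a) * l)))%C
      with (vert nu T b - vert nu T a - RtoC (b - a) * l)%C.
    2: apply injective_projections; simpl; ring.
    now apply Hinc. }
assert (Hss : Rabs (s - s) < del) by (rewrite Rminus_diag, Rabs_R0; apply cond_pos).
destruct (Rle_dec s y) as [Hsy|Hsy].
- rewrite (Rabs_pos_eq (y - s)) by lra; apply Hfin; lra.
- rewrite Rabs_minus_sym, (Rabs_pos_eq (s - y)) by lra.
  replace (osc nu y - osc nu s - RtoC (y - s) * l)%C
    with (- (osc nu s - osc nu y - RtoC (s - y) * l))%C by (rewrite !RtoC_minus; ring).
  apply Rabs_lt_between' in Hy2 as Hy3.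
  rewrite Cmod_opp; apply Hfin; lra.
Qed.

(** [osc (mu - 1)] extended to [s <= 0] by its limit at 0. *)
Definition osc_ext (mu s : R) : C :=
  if Rle_dec s 0 then (- (cis (PI * mu / 2) * RtoC (Gamma mu)))%C else osc (mu - 1) s.

Lemma osc_ext_pos (mu s : R) : 0 < s -> osc_ext mu s = osc (mu - 1) s.
Proof. intros; unfold osc_ext; destruct (Rle_dec s 0); [lra | reflexivity]. Qed.

Lemma osc_ext_0 (mu : R) : osc_ext mu 0 = (- (cis (PI * mu / 2) * RtoC (Gamma mu)))%C.
Proof. unfold osc_ext; destruct (Rle_dec 0 0); [reflexivity | lra]. Qed.

Lemma is_derC_osc_ext (mu s : R) :
  0 < mu < 1 -> 0 < s -> is_derC (osc_ext mu) s (RtoC (Rpower s (mu - 1)) * cis s)%C.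
Proof.
intros Hmu Hs.
apply (is_derive_ext_loc (K := R_AbsRing) (V := C_R_NormedModule) (osc (mu - 1))); [|apply is_derC_osc; lra].
apply (filter_imp (fun y => 0 < y)); [intros y Hy; now rewrite osc_ext_pos | now apply (open_gt 0)].
Qed.

(** At 0 this is [Cmod_osc_near_0], whose bound vanishes with [s]. It lets the integration by parts
    reach the singular endpoint. *)
Lemma contC_osc_ext (mu s : R) : 0 < mu < 1 -> contC (osc_ext mu) s.
Proof.
intros Hmu; destruct (Rtotal_order s 0) as [Hs|[->|Hs]].
- apply continuous_ext_loc with (fun _ => (- (cis (PI * mu / 2) * RtoC (Gamma mu)))%C); [|apply continuous_const].
  apply (filter_imp (fun y => y < 0)); [|now apply (open_lt 0)].
  intros y Hy; unfold osc_ext; destruct (Rle_dec y 0); [reflexivity | lra].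
- apply (proj2 (filterlim_locally_ball_norm (U := C_R_NormedModule) (F := locally 0) (osc_ext mu) (osc_ext mu 0))).
  intros eps.
  assert (Hc : continuous (fun s => (2 / mu + 1) * pw s mu + s * Gamma mu) 0).
  { apply (continuous_plus (V := R_NormedModule)).
    - apply (continuous_scal_r (V := R_NormedModule) (2 / mu + 1) (fun s => pw s mu)), continuous_pw; lra.
    - apply (ex_derive_continuous (K := R_AbsRing) (V := R_NormedModule)); auto_derive; trivial. }
  generalize (proj1 (filterlim_locally _ _) Hc eps); apply filter_imp; intros y Hy.
  unfold ball_norm; rewrite norm_Cmod.
  change (Cmod (osc_ext mu y - osc_ext mu 0) < eps).
  change (Rabs ((2 / mu + 1) * pw y mu + y * Gamma mu - ((2 / mu + 1) * pw 0 mu + 0 * Gamma mu)) < eps) in Hy.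
  rewrite pw_0, Rmult_0_r, Rmult_0_l, Rplus_0_r, Rminus_0_r in Hy.
  destruct (Rle_dec y 0) as [Hy0|Hy0].
  + replace (osc_ext mu y) with (osc_ext mu 0).
    2: { unfold osc_ext; destruct (Rle_dec y 0), (Rle_dec 0 0); lra || reflexivity. }
    replace (osc_ext mu 0 - osc_ext mu 0)%C with (RtoC 0) by ring.
    rewrite Cmod_0; apply cond_pos.
  + rewrite osc_ext_0, osc_ext_pos by lra.
    replace (osc (mu - 1) y - - (cis (PI * mu / 2) * RtoC (Gamma mu)))%C
      with (osc (mu - 1) y + cis (PI * mu / 2) * RtoC (Gamma mu))%C by ring.
    apply Rle_lt_trans with (1 := Cmod_osc_near_0 mu y Hmu ltac:(lra)).
    rewrite pw_pos in Hy by lra.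
    apply Rle_lt_trans with (2 := Hy), Rle_abs.
- eapply is_derC_contC; now apply is_derC_osc_ext.
Qed.

(** * The Gaussian and Fresnel integrals *)

(* Coquelicot's canonical structures leave equalities in carriers that [ring] does not recognise as [R]. *)
Ltac ring_R := match goal with |- ?a = ?b => change (@eq R a b) end; ring.

Definition gauss_prim (x : R) : R := RInt (fun y => exp (- y ^ 2)) 0 x.

(** Companion of the Gaussian primitive in the classical evaluation: its derivative is opposite to
    that of the square of [gauss_prim]. *)
Definition gauss_aux (x : R) : R := RInt (fun y => exp (- (x ^ 2 * (1 + y ^ 2))) / (1 + y ^ 2)) 0 1.

Lemma gauss_prim_0 : gauss_prim 0 = 0.
Proof. apply (RInt_point (V := R_CompleteNormedModule)). Qed.

Lemma is_derive_gauss_prim (x : R) : is_derive gauss_prim x (exp (- x ^ 2)).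
Proof.
apply (is_derive_RInt_upper (fun y => exp (- y ^ 2))); intros y.
apply (ex_derive_continuous (K := R_AbsRing) (V := R_NormedModule)); auto_derive; trivial.
Qed.

Lemma continuous_gauss_aux (x y : R) : continuous (fun y => exp (- (x ^ 2 * (1 + y ^ 2))) / (1 + y ^ 2)) y.
Proof.
apply (ex_derive_continuous (K := R_AbsRing) (V := R_NormedModule)); auto_derive.
simpl; nra.
Qed.

Lemma is_derive_gauss_aux (x : R) : is_derive gauss_aux x (-2 * exp (- x ^ 2) * gauss_prim x).
Proof.
replace (-2 * exp (- x ^ 2) * gauss_prim x)
  with (RInt (fun t => -2 * x * exp (- (x ^ 2 * (1 + t ^ 2)))) 0 1).
- apply (is_derive_RInt_param_right (fun s t => exp (- (s ^ 2 * (1 + t ^ 2))) / (1 + t ^ 2))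
    (fun s t => -2 * s * exp (- (s ^ 2 * (1 + t ^ 2)))) (x - 1)); [lra | | |].
  + intros s t _; auto_derive; [simpl; nra | simpl; field; nra].
  + intros s t _.
    assert (Hs : continuity_2d_pt (fun u v => - (u ^ 2 * (1 + v ^ 2))) s t).
    { apply (continuity_2d_pt_ext (fun u v => - (u * u * (1 + v * v)))); [intros; ring|].
      apply (continuity_2d_pt_opp (fun u v => u * u * (1 + v * v))).
      apply (continuity_2d_pt_mult (fun u v => u * u) (fun u v => 1 + v * v)).
      - apply (continuity_2d_pt_mult (fun u v => u) (fun u v => u)); apply continuity_2d_pt_id1.
      - apply (continuity_2d_pt_plus (fun u v => 1) (fun u v => v * v)); [apply continuity_2d_pt_const|].
        apply (continuity_2d_pt_mult (fun u v => v) (fun u v => v)); apply continuity_2d_pt_id2. }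
    apply (continuity_2d_pt_mult (fun u v => -2 * u) (fun u v => exp (- (u ^ 2 * (1 + v ^ 2))))).
    * apply (continuity_2d_pt_mult (fun u v => -2) (fun u v => u)); [apply continuity_2d_pt_const | apply continuity_2d_pt_id1].
    * apply (continuity_1d_2d_pt_comp exp); [apply derivable_continuous_pt, derivable_pt_exp | exact Hs].
  + intros s t _; apply continuous_gauss_aux.
- assert (Cg : forall y, continuous (fun y => exp (- y ^ 2)) y).
  { intros y; apply (ex_derive_continuous (K := R_AbsRing) (V := R_NormedModule)); auto_derive; trivial. }
  unfold gauss_prim.
  (* Change of variable y = x t, which turns [gauss_prim x] into an integral over [0, 1]. *)
  assert (E := RInt_comp_lin (V := R_CompleteNormedModule) (fun y => exp (- y ^ 2)) x 0 0 1).
  rewrite Rmult_0_r, Rmult_1_r, !Rplus_0_r in E.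
  rewrite <- E by (apply (ex_RInt_continuous (V := R_CompleteNormedModule)); intros; apply Cg).
  assert (E' := RInt_scal (V := R_CompleteNormedModule) (fun y => scal x (exp (- (x * y + 0) ^ 2))) 0 1 (-2 * exp (- x ^ 2))).
  unfold scal in E'; simpl in E'; unfold mult in E'; simpl in E'.
  unfold scal; simpl; unfold mult; simpl.
  rewrite <- E'.
  + apply RInt_ext; intros t _.
    replace (- (x * (x * 1) * (1 + t * (t * 1)))) with (- (x * (x * 1)) + - ((x * t + 0) * ((x * t + 0) * 1))) by ring.
    rewrite exp_plus; ring_R.
  + apply (ex_RInt_continuous (V := R_CompleteNormedModule)); intros y _.
    apply (ex_derive_continuous (K := R_AbsRing) (V := R_NormedModule)); auto_derive; trivial.
Qed.

Lemma constant_of_derive_0 (f : R -> R) (a b : R) :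
  a <= b -> (forall x, a < x < b -> is_derive f x 0) -> (forall x, a <= x <= b -> continuous f x) -> f b = f a.
Proof.
intros Hab Df Cf; apply Rle_antisym.
- apply (decreasing_of_derive_le_0 f (fun _ => 0)); auto; intros; lra.
- apply Ropp_le_cancel, (decreasing_of_derive_le_0 (fun x => - f x) (fun _ => - 0)); auto.
  + intros x Hx; now apply (is_derive_opp f), Df.
  + intros x Hx; now apply (continuous_opp (V := R_NormedModule) f), Cf.
  + intros; lra.
Qed.

Lemma gauss_prim_sq (x : R) : 0 <= x -> gauss_prim x ^ 2 + gauss_aux x = PI / 4.
Proof.
intros Hx.
assert (D : forall y, is_derive (fun y => gauss_prim y ^ 2 + gauss_aux y) y 0).
{ intros y; evar_last.
  - apply (is_derive_plus (K := R_AbsRing) (V := R_NormedModule)); [|apply is_derive_gauss_aux].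
    apply (is_derive_pow gauss_prim 2), is_derive_gauss_prim.
  - unfold plus; simpl; ring. }
rewrite (constant_of_derive_0 (fun y => gauss_prim y ^ 2 + gauss_aux y) 0 x Hx).
(* The constant is read off at 0, where only the integral of 1/(1 + y^2) over [0, 1] remains. *)
- rewrite gauss_prim_0; unfold gauss_aux.
  rewrite (RInt_ext _ (fun y => / (1 + y ^ 2))).
  2: { intros y _; replace (- (0 ^ 2 * (1 + y ^ 2))) with 0 by ring; rewrite exp_0; unfold Rdiv; ring_R. }
  assert (E : is_RInt (fun y => / (1 + y ^ 2)) 0 1 (minus (atan 1) (atan 0))).
  { apply (is_RInt_derive (V := R_CompleteNormedModule) atan).
    - intros y _; auto_derive; [trivial | unfold Rsqr; simpl; field; nra].
    - intros y _; apply (ex_derive_continuous (K := R_AbsRing) (V := R_NormedModule)); auto_derive; simpl; nra. }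
  rewrite (is_RInt_unique (V := R_CompleteNormedModule) _ _ _ _ E), atan_1, atan_0.
  unfold minus, plus, opp, zero; simpl; ring_R.
- intros; apply D.
- intros; apply (ex_derive_continuous (K := R_AbsRing) (V := R_NormedModule)); eexists; apply D.
Qed.

Lemma gauss_aux_bounds (x : R) : 0 <= gauss_aux x <= exp (- x ^ 2).
Proof.
assert (I : ex_RInt (fun y => exp (- (x ^ 2 * (1 + y ^ 2))) / (1 + y ^ 2)) 0 1).
{ apply (ex_RInt_continuous (V := R_CompleteNormedModule)); intros; apply continuous_gauss_aux. }
split.
- apply RInt_ge_0; [lra | exact I |].
  intros y _; apply Rlt_le, Rdiv_lt_0_compat; [apply exp_pos | nra].
- replace (exp (- x ^ 2)) with (RInt (fun _ => exp (- x ^ 2)) 0 1).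
  2: { rewrite RInt_const; unfold scal; simpl; unfold mult; simpl; ring_R. }
  apply RInt_le; [lra | exact I | apply ex_RInt_const |].
  intros y _; rewrite <- (Rdiv_1_r (exp (- x ^ 2))).
  apply Rmult_le_compat; [left; apply exp_pos | left; apply Rinv_0_lt_compat; nra | apply exp_le_compat; nra | apply Rinv_le_contravar; nra].
Qed.

(** Substitution t = y^2, checked on derivatives for y > 0; continuity takes care of 0, where
    t^(-1/2) is singular. *)
Lemma lower_gamma_half_sq (x : R) : 0 <= x -> lower_gamma (1 / 2) (x ^ 2) = 2 * gauss_prim x.
Proof.
intros Hx.
assert (E := constant_of_derive_0 (fun y => lower_gamma (1 / 2) (y ^ 2) - 2 * gauss_prim y) 0 x Hx).
cbv beta in E; replace (0 ^ 2) with 0 in E by ring; rewrite lower_gamma_0 in E.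
rewrite gauss_prim_0 in E.
enough (lower_gamma (1 / 2) (x ^ 2) - 2 * gauss_prim x = 0 - 2 * 0) by lra.
apply E.
- intros y Hy; evar_last.
  + apply (is_derive_minus (K := R_AbsRing) (V := R_NormedModule)).
    * apply (is_derive_comp (lower_gamma (1 / 2)) (fun y => y ^ 2)).
      apply is_derive_lower_gamma; nra.
      instantiate (1 := 2 * y); auto_derive; [trivial | ring].
    * apply (is_derive_scal gauss_prim), is_derive_gauss_prim.
  + replace (Rpower (y ^ 2) (1 / 2 - 1)) with (/ y).
    unfold minus, plus, opp, scal; simpl; unfold mult; simpl; field; lra.
    rewrite <- Rpower_pow, Rpower_mult by lra.
    replace (INR 2 * (1 / 2 - 1)) with (Ropp 1) by (simpl; field).
    rewrite Rpower_Ropp, Rpower_1 by lra; reflexivity.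
- intros y Hy; apply (continuous_minus (V := R_NormedModule)).
  + apply (continuous_comp (fun y => y ^ 2) (lower_gamma (1 / 2))); [|apply continuous_lower_gamma; lra].
    apply (ex_derive_continuous (K := R_AbsRing) (V := R_NormedModule)); auto_derive; trivial.
  + apply (ex_derive_continuous (K := R_AbsRing) (V := R_NormedModule)); eexists.
    apply (is_derive_scal gauss_prim), is_derive_gauss_prim.
Qed.

Lemma Gamma_half : Gamma (1 / 2) = sqrt PI.
Proof.
assert (HG : 0 <= Gamma (1 / 2)).
{ rewrite <- (lower_gamma_0 (1 / 2)); apply lower_gamma_le_Gamma; lra. }
assert (Hsq : filterlim (fun x => x ^ 2) (Rbar_locally p_infty) (Rbar_locally p_infty)).
{ intros P [M HM]; exists (Rmax 1 M); intros x Hx; apply HM.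
  apply Rmax_Rlt in Hx; nra. }
assert (Hlim : filterlim (fun x => lower_gamma (1 / 2) (x ^ 2) ^ 2) (Rbar_locally p_infty) (locally (Gamma (1 / 2) ^ 2))).
{ apply (filterlim_comp_ex_derive _ (fun x => lower_gamma (1 / 2) (x ^ 2)) (fun y => y ^ 2) (Gamma (1 / 2)));
  [|auto_derive; trivial | reflexivity].
  apply (filterlim_comp _ _ _ (fun x => x ^ 2) (lower_gamma (1 / 2)) _ _ _ Hsq), lower_gamma_lim; lra. }
(* Four times [gauss_prim_sq], with [gauss_aux] between 0 and e^(-x^2) <= e^(-x); the last form
   matches [exp_neg_lim]. *)
assert (Hval : forall x, 1 < x -> PI - 4 * exp (- x) <= lower_gamma (1 / 2) (x ^ 2) ^ 2 <= PI).
{ intros x Hx; rewrite lower_gamma_half_sq by lra.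
  generalize (gauss_prim_sq x ltac:(lra)) (gauss_aux_bounds x); intros H1 [H2 H3].
  assert (exp (- x ^ 2) <= exp (- x)) by (apply exp_le_compat; nra).
  split; nra. }
assert (Hle : Gamma (1 / 2) ^ 2 <= PI).
{ apply (filterlim_le (F := Rbar_locally p_infty) (fun x => lower_gamma (1 / 2) (x ^ 2) ^ 2) (fun _ => PI)
    (Gamma (1 / 2) ^ 2) PI); [|exact Hlim | apply filterlim_const].
  exists 1; intros x Hx; now apply Hval. }
assert (Hge : PI <= Gamma (1 / 2) ^ 2).
{ apply (filterlim_le (F := Rbar_locally p_infty) (fun x => PI - 4 * exp (- x)) (fun x => lower_gamma (1 / 2) (x ^ 2) ^ 2)
    PI (Gamma (1 / 2) ^ 2)); [| |exact Hlim].
  - exists 1; intros x Hx; now apply Hval.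
  - apply (filterlim_comp_ex_derive _ (fun x => exp (- x)) (fun y => PI - 4 * y) 0);
    [exact exp_neg_lim | auto_derive; trivial | ring]. }
rewrite <- (sqrt_pow2 (Gamma (1 / 2))) by exact HG.
f_equal; lra.
Qed.

Lemma is_derC_conj (f : R -> C) (x : R) (l : C) :
  is_derC f x l -> is_derC (fun t => Cconj (f t)) x (Cconj l).
Proof.
rewrite !is_derC_components; simpl; intros [H1 H2]; split; [exact H1|].
now apply (is_derive_opp (fun t => snd (f t))).
Qed.

Lemma contC_conj (f : R -> C) (x : R) : contC f x -> contC (fun t => Cconj (f t)) x.
Proof.
rewrite !contC_components; simpl; intros [H1 H2]; split; [exact H1|].
now apply (continuous_opp (V := R_NormedModule) (fun t => snd (f t))).
Qed.

Lemma is_derC_comp (f : R -> C) (g : R -> R) (x l : R) (m : C) :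
  is_derive g x l -> is_derC f (g x) m -> is_derC (fun t => f (g t)) x (RtoC l * m)%C.
Proof.
intros Hg Hf; rewrite <- scal_RtoC.
now apply (is_derive_comp (K := R_AbsRing) (V := C_R_NormedModule) f g).
Qed.

Lemma Cconj_cis (t : R) : Cconj (cis t) = cis (- t).
Proof. unfold cis, Cconj; simpl; now rewrite cos_neg, sin_neg. Qed.

(** The primitive of e^{-i y^2} that vanishes at +oo. *)
Definition fresnel (x : R) : C :=
  (RIntC (fun y => cis (- y ^ 2)) 0 x - RtoC (sqrt PI / 2) * cis (- (PI / 4)))%C.

Lemma fresnel_0 : fresnel 0 = (- (RtoC (sqrt PI / 2) * cis (- (PI / 4))))%C.
Proof.
unfold fresnel; rewrite (RInt_point (V := C_R_CompleteNormedModule)).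
change (zero (G := C_R_CompleteNormedModule)) with (RtoC 0); ring.
Qed.

Lemma is_derC_fresnel (x : R) : is_derC fresnel x (cis (- x ^ 2)).
Proof.
replace (cis (- x ^ 2)) with (cis (- x ^ 2) - RtoC 0)%C by ring.
apply is_derC_minus; [|apply is_derC_const].
apply (is_derC_RInt (fun y => cis (- y ^ 2))); intros y.
apply contC_cis, (ex_derive_continuous (K := R_AbsRing) (V := R_NormedModule)); auto_derive; trivial.
Qed.

(** Change of variable s = y^2, with a conjugate because the phase is -y^2. Both sides have the same
    derivative, and they agree at 0 precisely because Gamma(1/2) = sqrt(pi); this justifies the
    constant subtracted in [fresnel]. *)
Lemma fresnel_eq_osc (x : R) :
  0 <= x -> fresnel x = (RtoC (1 / 2) * Cconj (osc_ext (1 / 2) (x ^ 2)))%C.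
Proof.
intros Hx.
set (g y := (RtoC (1 / 2) * Cconj (osc_ext (1 / 2) (y ^ 2)))%C).
assert (H0 : fresnel 0 = g 0).
{ unfold g; replace (0 ^ 2) with 0 by ring; rewrite osc_ext_0, fresnel_0, Gamma_half.
  replace (Cconj (- (cis (PI * (1 / 2) / 2) * RtoC (sqrt PI))))
    with (- (Cconj (cis (PI * (1 / 2) / 2)) * RtoC (sqrt PI)))%C.
  2: apply injective_projections; simpl; ring.
  rewrite Cconj_cis; replace (- (PI * (1 / 2) / 2)) with (- (PI / 4)) by field.
  apply injective_projections; simpl; field. }
assert (Hle : Cmod ((fresnel x - g x) - (fresnel 0 - g 0)) <= 0 - 0).
{ apply (Cmod_increment_le (fun x => fresnel x - g x)%C (fun x => cis (- x ^ 2) - cis (- x ^ 2))%C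
    (fun _ => 0) (fun _ => 0) 0 x Hx).
  - intros y Hy; apply is_derC_minus; [apply is_derC_fresnel|].
    evar_last.
    + apply is_derC_scal, is_derC_conj, (is_derC_comp (osc_ext (1 / 2)) (fun y => y ^ 2) y (2 * y)).
      * auto_derive; [trivial | ring].
      * apply is_derC_osc_ext; [lra | nra].
    + replace (Rpower (y ^ 2) (1 / 2 - 1)) with (/ y).
      2: { rewrite <- Rpower_pow, Rpower_mult by lra.
           replace (INR 2 * (1 / 2 - 1)) with (Ropp 1) by (simpl; field).
           rewrite Rpower_Ropp, Rpower_1 by lra; reflexivity. }
      rewrite <- Cconj_cis; apply injective_projections; simpl; field; lra.
  - intros; apply (is_derive_const (K := R_AbsRing) (V := R_NormedModule)).
  - intros y Hy; apply contC_minus; [eapply is_derC_contC; apply is_derC_fresnel|].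
    apply contC_mult; [apply continuous_const|]; apply contC_conj.
    apply (continuous_comp (fun y => y ^ 2) (osc_ext (1 / 2))); [|apply contC_osc_ext; lra].
    apply (ex_derive_continuous (K := R_AbsRing) (V := R_NormedModule)); auto_derive; trivial.
  - intros; apply continuous_const.
  - intros; replace (cis (- x0 ^ 2) - cis (- x0 ^ 2))%C with (RtoC 0) by ring; rewrite Cmod_0; lra. }
rewrite H0, Rminus_0_r in Hle; apply Rle_antisym in Hle; [|apply Cmod_ge_0]; symmetry in Hle.
apply Cmod_eq_0 in Hle.
replace (fresnel x) with ((fresnel x - g x - (g 0 - g 0)) + g x)%C by ring.
rewrite Hle; unfold g; ring.
Qed.

Lemma Rpower_sq (x a : R) : 0 < x -> Rpower (x ^ 2) a = Rpower x (2 * a).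
Proof. intros; rewrite <- Rpower_pow, Rpower_mult by assumption; f_equal; simpl; ring. Qed.

Lemma Cmod_half_conj (z : C) : Cmod (RtoC (1 / 2) * Cconj z) = Cmod z / 2.
Proof. rewrite Cmod_mult, Cmod_conj, Cmod_R, Rabs_pos_eq by lra; field. Qed.

Lemma Cmod_fresnel_le_const (x : R) : 0 < x -> Cmod (fresnel x) <= sqrt PI / 2.
Proof.
intros Hx; rewrite fresnel_eq_osc, Cmod_half_conj, osc_ext_pos by nra.
generalize (Cmod_osc_le_Gamma (1 / 2) (x ^ 2) ltac:(nra) ltac:(lra)); rewrite Gamma_half; lra.
Qed.

Lemma Cmod_fresnel_le_inv (x : R) : 0 < x -> Cmod (fresnel x) <= / x / 2.
Proof.
intros Hx; rewrite fresnel_eq_osc, Cmod_half_conj, osc_ext_pos by nra.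
generalize (Cmod_osc_le (1 / 2 - 1) (x ^ 2) ltac:(nra) ltac:(lra)).
rewrite Rpower_sq by assumption.
replace (2 * (1 / 2 - 1)) with (Ropp 1) by field; rewrite Rpower_Ropp, Rpower_1 by assumption; lra.
Qed.

(* Interpolate between the two previous bounds; they cross at [x = / sqrt PI <= K]. *)
Lemma Cmod_fresnel_le (K gam x : R) :
  / sqrt PI <= K -> 0 < gam < 1 -> 0 < x ->
  Cmod (fresnel x) <= sqrt PI / 2 * Rpower K gam * Rpower x (- gam).
Proof.
intros HK Hg Hx.
assert (Hpi : 0 < sqrt PI) by apply sqrt_lt_R0, PI_RGT_0.
assert (HK0 : 0 < / sqrt PI) by now apply Rinv_0_lt_compat.
rewrite Rpower_Ropp, Rmult_assoc, <- Rpower_Ropp.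
assert (Hle : Rpower (/ sqrt PI) gam <= Rpower K gam) by (apply Rle_Rpower_l; lra).
assert (Hmul : Rpower (/ sqrt PI) gam * Rpower x (- gam) = Rpower (/ sqrt PI * / x) gam).
{ rewrite <- Rpower_mult_distr by (try apply Rinv_0_lt_compat; assumption).
  f_equal; unfold Rpower; rewrite ln_Rinv by assumption; f_equal; ring. }
assert (H : Cmod (fresnel x) <= sqrt PI / 2 * Rpower (/ sqrt PI * / x) gam).
(* The ratio of the bound 1/(2x) to the bound sqrt(pi)/2. If y >= 1 the constant bound applies and 1
   <= y^gamma; otherwise the other one applies and y <= y^gamma. *)
{ set (y := / sqrt PI * / x).
  assert (Hy : 0 < y) by (apply Rmult_lt_0_compat; [assumption | now apply Rinv_0_lt_compat]).
  destruct (Rle_dec 1 y) as [H1|H1].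
  - apply Rle_trans with (sqrt PI / 2 * 1); [rewrite Rmult_1_r; now apply Cmod_fresnel_le_const|].
    apply Rmult_le_compat_l; [lra|].
    apply Rle_trans with (Rpower y 0); [rewrite Rpower_O; lra | apply Rle_Rpower; lra].
  - apply Rle_trans with (sqrt PI / 2 * y).
    + replace (sqrt PI / 2 * y) with (/ x / 2) by (unfold y; field; lra).
      now apply Cmod_fresnel_le_inv.
    + apply Rmult_le_compat_l; [lra|].
      rewrite <- (Rpower_1 y Hy) at 1; unfold Rpower; apply exp_le_compat.
      assert (ln y <= 0) by (rewrite <- ln_1; apply ln_le; lra).
      nra. }
apply Rle_trans with (1 := H); apply Rmult_le_compat_l; [lra|].
rewrite <- Hmul; apply Rmult_le_compat_r; [left; apply exp_pos | exact Hle].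
Qed.

(* Geometric mean of the first-order remainder and of the trivial bound. *)
Lemma Cmod_fresnel_expansion (x : R) :
  0 < x -> Cmod (fresnel x - RtoC (/ (2 * x)) * Ci * cis (- x ^ 2)) <= / x ^ 2 / 2.
Proof.
intros Hx.
assert (Hx2 : 0 < x ^ 2) by nra.
assert (Hpow : Rpower (x ^ 2) (1 / 2 - 1) = / x).
{ rewrite Rpower_sq by assumption.
  replace (2 * (1 / 2 - 1)) with (Ropp 1) by field; now rewrite Rpower_Ropp, Rpower_1. }
rewrite fresnel_eq_osc, osc_ext_pos by lra.
set (w := osc (1 / 2 - 1) (x ^ 2)).
assert (HE : (RtoC (1 / 2) * Cconj w - RtoC (/ (2 * x)) * Ci * cis (- x ^ 2) =
  RtoC (1 / 2) * Cconj (w + Ci * cis (x ^ 2) * RtoC (Rpower (x ^ 2) (1 / 2 - 1))))%C).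
{ rewrite Hpow, <- Cconj_cis; apply injective_projections; simpl; field; lra. }
rewrite HE, Cmod_half_conj; apply Rmult_le_compat_r; [lra|].
(* The expansion gives x^(-3)/2 and the trivial bound gives 2/x; the two, and their geometric mean
   x^(-2), coincide at x = 1/2. *)
destruct (Rle_dec (1 / 2) x) as [H1|H1].
- apply Rle_trans with (1 := Cmod_osc_expansion (1 / 2 - 1) (x ^ 2) Hx2 ltac:(lra)).
  rewrite Rpower_sq by assumption.
  replace (2 * (1 / 2 - 1 - 1)) with (- INR 3) by (simpl; field).
  rewrite Rpower_Ropp, Rpower_pow by assumption.
  replace (/ x ^ 3) with (/ x ^ 2 * / x) by (field; lra).
  assert (/ x <= 2).
  { rewrite <- (Rinv_inv 2); apply Rinv_le_contravar; lra. }
  assert (0 < / x ^ 2) by now apply Rinv_0_lt_compat.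
  nra.
- apply Rle_trans with (1 := Cmod_triangle _ _).
  rewrite !Cmod_mult, Cmod_Ci, Cmod_cis, Cmod_R, Rabs_pos_eq by (left; apply exp_pos).
  assert (Hw := Cmod_osc_le (1 / 2 - 1) (x ^ 2) Hx2 ltac:(lra)); fold w in Hw.
  rewrite Hpow in *.
  replace (/ x ^ 2) with (/ x * / x) by (field; lra).
  assert (2 < / x).
  { rewrite <- (Rinv_inv 2); apply Rinv_lt_contravar; lra. }
  nra.
Qed.

(** * Integration by parts at the two critical points *)

(** An antiderivative packaged with its bound by an arbitrary majorant [G], so that the choice of
    [G] is left to each application. Clamping [h] makes the derivative two-sided at the
    endpoints. *)
Lemma primitive_on (h : R -> C) (a b : R) :
  a <= b -> (forall x, a <= x <= b -> contC h x) ->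
  exists J : R -> C, J a = RtoC 0 /\
    (forall x, a <= x <= b -> is_derC J x (h x)) /\
    (forall G dG : R -> R,
      (forall x, a < x < b -> is_derive G x (dG x)) ->
      (forall x, a <= x <= b -> continuous G x) ->
      (forall x, a < x < b -> Cmod (h x) <= dG x) ->
      Cmod (J b) <= G b - G a).
Proof.
intros Hab Ch.
assert (Chc : forall x, contC (fun t => h (clamp a b t)) x).
{ apply contC_clamp; [exact Hab|]; intros x Hx P HP.
  apply (filter_le_within (F := locally x) (fun y => a <= y <= b)); now apply (Ch x Hx). }
exists (fun x => RIntC (fun t => h (clamp a b t)) a x).
assert (HJ0 : RIntC (fun t => h (clamp a b t)) a a = RtoC 0) by apply (RInt_point (V := C_R_CompleteNormedModule)).
assert (DJ : forall x, a <= x <= b -> is_derC (fun x => RIntC (fun t => h (clamp a b t)) a x) x (h x)).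
{ intros x Hx; rewrite <- (clamp_id a b x Hx) at 2.
  now apply (is_derC_RInt (fun t => h (clamp a b t))). }
split; [exact HJ0 | split; [exact DJ|]].
intros G dG DG CG Hle.
replace (RIntC (fun t => h (clamp a b t)) a b)
  with (RIntC (fun t => h (clamp a b t)) a b - RIntC (fun t => h (clamp a b t)) a a)%C by (rewrite HJ0; ring).
apply (Cmod_increment_le (fun x => RIntC (fun t => h (clamp a b t)) a x) h G dG a b Hab); try assumption.
- intros x Hx; apply DJ; lra.
- intros x Hx; eapply is_derC_contC; now apply DJ.
Qed.

Lemma ibp (k dk B beta : R -> C) (a b : R) :
  a <= b ->
  (forall x, a <= x <= b -> is_derC k x (dk x)) ->
  (forall x, a <= x <= b -> contC dk x) ->
  (forall x, a <= x <= b -> is_derC B x (beta x)) ->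
  (forall x, a <= x <= b -> contC beta x) ->
  exists r : C,
    is_RInt (V := C_R_NormedModule) (fun x => (k x * beta x)%C) a b (k b * B b - k a * B a - r)%C /\
    (forall G dG : R -> R,
      (forall x, a < x < b -> is_derive G x (dG x)) ->
      (forall x, a <= x <= b -> continuous G x) ->
      (forall x, a < x < b -> Cmod (dk x * B x) <= dG x) ->
      Cmod r <= G b - G a).
Proof.
intros Hab Dk Cdk DB Cb.
destruct (primitive_on (fun x => dk x * B x)%C a b Hab) as (J & J0 & DJ & HJ).
{ intros x Hx; apply contC_mult; [now apply Cdk | eapply is_derC_contC; now apply DB]. }
exists (J b); split; [|exact HJ].
replace (k b * B b - k a * B a - J b)%C
  with (minus (G := C_R_NormedModule) (k b * B b - J b)%C (k a * B a - J a)%C).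
2: { change ((k b * B b - J b) - (k a * B a - J a) = k b * B b - k a * B a - J b)%C; rewrite J0; ring. }
apply (is_RInt_derive (V := C_R_CompleteNormedModule) (fun x => k x * B x - J x)%C).
- rewrite Rmin_left, Rmax_right by lra; intros x Hx.
  replace (k x * beta x)%C with (dk x * B x + k x * beta x - dk x * B x)%C by ring.
  apply is_derC_minus; [apply is_derC_mult|]; auto.
- rewrite Rmin_left, Rmax_right by lra; intros x Hx.
  apply contC_mult; [eapply is_derC_contC; now apply Dk | now apply Cb].
Qed.

(** At [a] the density [beta] may blow up, but [B] stays continuous: the antiderivative k B - J then
    has a limit at [a], and the improper integral is its increment. *)
Lemma ibp_singular (k dk B beta : R -> C) (a b : R) :
  a < b ->
  (forall x, a <= x <= b -> is_derC k x (dk x)) ->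
  (forall x, a <= x <= b -> contC dk x) ->
  (forall x, a <= x <= b -> contC B x) ->
  (forall x, a < x <= b -> is_derC B x (beta x)) ->
  (forall x, a < x <= b -> contC beta x) ->
  exists r : C,
    is_RInt_gen (V := C_R_NormedModule) (fun x => (k x * beta x)%C) (at_right a) (at_point b)
      (k b * B b - k a * B a - r)%C /\
    (forall G dG : R -> R,
      (forall x, a < x < b -> is_derive G x (dG x)) ->
      (forall x, a <= x <= b -> continuous G x) ->
      (forall x, a < x < b -> Cmod (dk x * B x) <= dG x) ->
      Cmod r <= G b - G a).
Proof.
intros Hab Dk Cdk CB DB Cb.
destruct (primitive_on (fun x => dk x * B x)%C a b (Rlt_le _ _ Hab)) as (J & J0 & DJ & HJ).
{ intros x Hx; apply contC_mult; [now apply Cdk | now apply CB]. }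
exists (J b); split; [|exact HJ].
set (H x := (k x * B x - J x)%C).
assert (CH : contC H a).
{ apply contC_minus; [apply contC_mult|].
  - eapply is_derC_contC; apply Dk; lra.
  - apply CB; lra.
  - eapply is_derC_contC; apply DJ; lra. }
assert (Hlim : filterlimC (fun ab : R * R => (H b - H (fst ab))%C) (filter_prod (at_right a) (at_point b))
  (k b * B b - k a * B a - J b)%C).
{ replace (k b * B b - k a * B a - J b)%C with (H b - H a)%C by (unfold H; rewrite J0; ring).
  apply (filterlim_comp _ _ _ fst (fun x => H b - H x)%C _ (at_right a)); [apply filterlim_fst|].
  intros P HP; apply (filter_le_within (F := locally a) (fun u => a < u) (fun x => P (H b - H x)%C)).
  revert P HP; apply (contC_minus (fun _ => H b) H); [apply continuous_const | exact CH]. }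
apply filterlimi_lim_ext_loc with (2 := Hlim).
exists (fun x => a < x < b) (fun y => y = b).
- exists (mkposreal (b - a) ltac:(lra)); intros y Hy Hay.
  change (Rabs (y - a) < b - a) in Hy; apply Rabs_lt_between' in Hy; lra.
- reflexivity.
- intros x y Hx ->; simpl fst; simpl snd.
  apply (is_RInt_derive (V := C_R_CompleteNormedModule) H).
  + rewrite Rmin_left, Rmax_right by lra; intros t Ht.
    replace (k t * beta t)%C with (dk t * B t + k t * beta t - dk t * B t)%C by ring.
    apply is_derC_minus; [apply is_derC_mult|]; [apply Dk | apply DB | apply DJ]; lra.
  + rewrite Rmin_left, Rmax_right by lra; intros t Ht.
    apply contC_mult; [eapply is_derC_contC; apply Dk | apply Cb]; lra.
Qed.

(** * The stationary point *)

Lemma contC_phase (p0 c w x : R) : contC (fun p => cis (w * psi p0 c p)) x.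
Proof.
apply contC_cis, (ex_derive_continuous (K := R_AbsRing) (V := R_NormedModule)); unfold psi; auto_derive; trivial.
Qed.

(** Primitive of the phase factor on the side of the stationary point given by the sign [sg]. *)
Definition stat_prim (sg p0 c w p : R) : C :=
  (RtoC (sg * Rpower w (- (1 / 2))) * cis (w * c) * fresnel (sg * sqrt w * (p - p0)))%C.

Lemma sqrt_mul_Rpower (w : R) : 0 < w -> sqrt w * Rpower w (- (1 / 2)) = 1.
Proof.
intros Hw; rewrite <- Rpower_sqrt, <- Rpower_plus by assumption.
replace (/ 2 + - (1 / 2)) with 0 by field; now apply Rpower_O.
Qed.

Lemma is_derC_stat_prim (sg p0 c w p : R) :
  sg * sg = 1 -> 0 < w -> is_derC (stat_prim sg p0 c w) p (cis (w * psi p0 c p)).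
Proof.
intros Hsg Hw; evar_last.
- apply is_derC_scal, (is_derC_comp fresnel (fun p => sg * sqrt w * (p - p0)) p (sg * sqrt w)).
  + auto_derive; [trivial | ring].
  + apply is_derC_fresnel.
- replace (w * psi p0 c p) with (w * c + - (sg * sqrt w * (p - p0)) ^ 2).
  2: { unfold psi; replace ((sg * sqrt w * (p - p0)) ^ 2) with ((sg * sg) * (sqrt w * sqrt w) * (p - p0) ^ 2) by ring.
       rewrite Hsg, sqrt_sqrt by lra; ring. }
  rewrite cis_plus.
  transitivity (RtoC ((sg * sg) * (sqrt w * Rpower w (- (1 / 2)))) * (cis (w * c) * cis (- (sg * sqrt w * (p - p0)) ^ 2)))%C.
  + rewrite !RtoC_mult; ring.
  + rewrite Hsg, sqrt_mul_Rpower by assumption; rewrite Rmult_1_r; ring.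
Qed.

Lemma Cmod_stat_prim (sg p0 c w p : R) :
  sg * sg = 1 ->
  Cmod (stat_prim sg p0 c w p) = Rpower w (- (1 / 2)) * Cmod (fresnel (sg * sqrt w * (p - p0))).
Proof.
intros Hsg; unfold stat_prim; rewrite !Cmod_mult, Cmod_cis, Cmod_R, Rabs_mult.
rewrite (Rabs_pos_eq (Rpower _ _)) by (left; apply exp_pos).
replace (Rabs sg) with 1; [ring|].
destruct (Rcase_abs sg); [rewrite Rabs_left by lra | rewrite Rabs_right by lra]; nra.
Qed.

(** The argument of [fresnel] carries sqrt(w), so the interpolated bound contributes w^(-gamma/2),
    and 1/2 + gamma/2 = delta. *)
Lemma Cmod_stat_prim_le (sg p0 c w p K delta : R) :
  sg * sg = 1 -> 0 < w -> / sqrt PI <= K -> 1 / 2 < delta < 1 -> 0 < sg * (p - p0) ->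
  Cmod (stat_prim sg p0 c w p)
    <= sqrt PI / 2 * Rpower K (2 * delta - 1) * Rpower w (- delta) * Rpower (sg * (p - p0)) (- (2 * delta - 1)).
Proof.
intros Hsg Hw HK Hd Hp.
assert (Hs : 0 < sqrt w) by now apply sqrt_lt_R0.
rewrite Cmod_stat_prim by assumption.
replace (sg * sqrt w * (p - p0)) with (sqrt w * (sg * (p - p0))) by ring.
apply Rle_trans with (Rpower w (- (1 / 2)) * (sqrt PI / 2 * Rpower K (2 * delta - 1) * Rpower (sqrt w * (sg * (p - p0))) (- (2 * delta - 1)))).
- apply Rmult_le_compat_l; [left; apply exp_pos|].
  apply Cmod_fresnel_le; [exact HK | lra | now apply Rmult_lt_0_compat].
- right; rewrite <- Rpower_mult_distr by assumption.
  replace (Rpower w (- delta)) with (Rpower w (- (1 / 2)) * Rpower (sqrt w) (- (2 * delta - 1))); [ring|].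
  rewrite <- Rpower_sqrt, Rpower_mult, <- Rpower_plus by assumption; f_equal; field.
Qed.

Lemma stat_prim_center (sg p0 c w : R) :
  stat_prim sg p0 c w p0 = (- (RtoC (sg * Rpower w (- (1 / 2)) * (sqrt PI / 2)) * cis (w * c) * cis (- (PI / 4))))%C.
Proof.
unfold stat_prim; rewrite Rminus_diag, Rmult_0_r, fresnel_0, !RtoC_mult; ring.
Qed.

(** [v] stands for a C^1 extension of [u] to the whole line. *)
Definition ampl (p1 mu : R) (v : R -> C) (p : R) : C := (RtoC (Rpower (p - p1) (mu - 1)) * v p)%C.

Definition dampl (p1 mu : R) (v dv : R -> C) (p : R) : C :=
  (RtoC ((mu - 1) * Rpower (p - p1) (mu - 2)) * v p + RtoC (Rpower (p - p1) (mu - 1)) * dv p)%C.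

Lemma is_derive_Rpower_shift (a x p1 : R) :
  p1 < x -> is_derive (fun p => Rpower (p - p1) a) x (a * Rpower (x - p1) (a - 1)).
Proof.
intros Hx; evar_last.
- apply (is_derive_comp (fun t => Rpower t a) (fun p => p - p1)); [apply is_derive_Rpower; lra|].
  instantiate (1 := 1); auto_derive; [trivial | ring].
- unfold scal; simpl; unfold mult; simpl; ring.
Qed.

Lemma continuous_Rpower_shift (a x p1 : R) : p1 < x -> continuous (fun p => Rpower (p - p1) a) x.
Proof.
intros Hx; apply (ex_derive_continuous (K := R_AbsRing) (V := R_NormedModule)); eexists; now apply is_derive_Rpower_shift.
Qed.

Lemma is_derC_ampl (p1 mu x : R) (v dv : R -> C) :
  p1 < x -> is_derC v x (dv x) -> is_derC (ampl p1 mu v) x (dampl p1 mu v dv x).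
Proof.
intros Hx Hv.
apply (is_derC_mult (fun p => RtoC (Rpower (p - p1) (mu - 1))) v x (RtoC ((mu - 1) * Rpower (x - p1) (mu - 2)))); [|exact Hv].
apply is_derC_RtoC; replace (mu - 2) with (mu - 1 - 1) by ring; now apply is_derive_Rpower_shift.
Qed.

Lemma contC_dampl (p1 mu x : R) (v dv : R -> C) :
  p1 < x -> contC v x -> contC dv x -> contC (dampl p1 mu v dv) x.
Proof.
intros Hx Hv Hdv; apply (continuous_plus (V := C_R_NormedModule)); apply contC_mult; try assumption; apply contC_RtoC.
- apply (continuous_scal_r (V := R_NormedModule) (mu - 1) (fun p => Rpower (p - p1) (mu - 2))).
  now apply continuous_Rpower_shift.
- now apply continuous_Rpower_shift.
Qed.

Lemma Rpower_decreasing (x y a : R) : 0 < x <= y -> a <= 0 -> Rpower y a <= Rpower x a.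
Proof.
intros Hxy Ha; unfold Rpower; apply exp_le_compat, Rmult_le_compat_neg_l; [exact Ha | apply ln_le; lra].
Qed.

(** The exponents are negative, so the powers are largest at the least distance [e] to [p1]. It is
    (p0 - p1)/2 between the midpoint and [p0], and p0 - p1 beyond [p0]. *)
Lemma Cmod_dampl_le (p1 mu x e M : R) (v dv : R -> C) :
  0 < mu < 1 -> 0 < e <= x - p1 -> Cmod (v x) <= M -> Cmod (dv x) <= M ->
  Cmod (dampl p1 mu v dv x) <= ((1 - mu) * Rpower e (mu - 2) + Rpower e (mu - 1)) * M.
Proof.
intros Hmu He Hv Hdv; apply Rle_trans with (1 := Cmod_triangle _ _).
rewrite !Cmod_mult, !Cmod_R.
rewrite Rabs_mult, (Rabs_left (mu - 1)), !(Rabs_pos_eq (Rpower _ _)) by (lra || (left; apply exp_pos)).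
assert (H1 := Rpower_decreasing e (x - p1) (mu - 2) He ltac:(lra)).
assert (H2 := Rpower_decreasing e (x - p1) (mu - 1) He ltac:(lra)).
rewrite Rmult_plus_distr_r; apply Rplus_le_compat; apply Rmult_le_compat; try apply Cmod_ge_0; try assumption.
- apply Rmult_le_pos; [lra | left; apply exp_pos].
- replace (- (mu - 1)) with (1 - mu) by ring; apply Rmult_le_compat_l; lra.
- left; apply exp_pos.
Qed.

(** The factor (p0 - q)^(1-gamma) / (1 - gamma) is the integral of the interpolated bound (p0 -
    p)^(-gamma) up to the stationary point. *)
Lemma stationary_left (g dg : R -> C) (q p0 c w K delta D : R) :
  q < p0 -> 0 < w -> / sqrt PI <= K -> 1 / 2 < delta < 1 ->
  (forall x, q <= x <= p0 -> is_derC g x (dg x)) ->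
  (forall x, q <= x <= p0 -> contC dg x) ->
  (forall x, q <= x <= p0 -> Cmod (dg x) <= D) ->
  exists r : C,
    is_RInt (V := C_R_NormedModule) (fun p => (g p * cis (w * psi p0 c p))%C) q p0
      (g p0 * stat_prim (-1) p0 c w p0 - g q * stat_prim (-1) p0 c w q - r)%C /\
    Cmod r <= sqrt PI / 2 * Rpower K (2 * delta - 1) / (1 - (2 * delta - 1)) * Rpower (p0 - q) (1 - (2 * delta - 1)) * Rpower w (- delta) * D.
Proof.
intros Hq Hw HK Hd Dg Cdg HD.
destruct (ibp g dg (stat_prim (-1) p0 c w) (fun p => cis (w * psi p0 c p)) q p0 (Rlt_le _ _ Hq) Dg Cdg) as (r & Hr & Hb).
{ intros x _; apply is_derC_stat_prim; lra. }
{ intros x _; apply contC_phase. }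
exists r; split; [exact Hr|].
set (gam := 2 * delta - 1) in *; set (L := sqrt PI / 2 * Rpower K gam).
set (k := L * Rpower w (- delta) * D).
assert (Hgam : 0 < gam < 1) by (unfold gam; lra).
(* The majorant uses [pw] rather than [Rpower]: it must be continuous at [p0], where its derivative
   is singular. *)
apply Rle_trans with ((- (k / (1 - gam)) * pw (p0 - p0) (1 - gam)) - (- (k / (1 - gam)) * pw (p0 - q) (1 - gam))).
- apply (Hb (fun p => - (k / (1 - gam)) * pw (p0 - p) (1 - gam)) (fun p => k * Rpower (p0 - p) (- gam))).
  + intros x Hx; evar_last.
    * apply (is_derive_scal (fun p => pw (p0 - p) (1 - gam))).
      apply (is_derive_comp (fun t => pw t (1 - gam)) (fun p => p0 - p)); [apply is_derive_pw; lra|].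
      instantiate (1 := - 1); auto_derive; [trivial | ring].
    * unfold scal; simpl; unfold mult; simpl.
      replace (1 - gam - 1) with (- gam) by ring; field; lra.
  + intros x Hx.
    apply (continuous_scal_r (V := R_NormedModule) (- (k / (1 - gam))) (fun p => pw (p0 - p) (1 - gam))).
    apply (continuous_comp (fun p => p0 - p) (fun t => pw t (1 - gam))); [|apply continuous_pw; lra].
    apply (ex_derive_continuous (K := R_AbsRing) (V := R_NormedModule)); auto_derive; trivial.
  + intros x Hx; rewrite Cmod_mult, Rmult_comm.
    assert (Hs := Cmod_stat_prim_le (-1) p0 c w x K delta ltac:(lra) Hw HK Hd ltac:(lra)).
    fold gam L in Hs; replace (-1 * (x - p0)) with (p0 - x) in Hs by ring.
    replace (k * Rpower (p0 - x) (- gam)) with (L * Rpower w (- delta) * Rpower (p0 - x) (- gam) * D) by (unfold k; ring).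
    apply Rmult_le_compat; try apply Cmod_ge_0; [exact Hs | apply HD; lra].
- rewrite Rminus_diag, pw_0, pw_pos by lra; right; unfold k, Rdiv; ring.
Qed.

Lemma stationary_right (g dg : R -> C) (b p0 c w K delta D : R) :
  p0 < b -> 0 < w -> / sqrt PI <= K -> 1 / 2 < delta < 1 ->
  (forall x, p0 <= x <= b -> is_derC g x (dg x)) ->
  (forall x, p0 <= x <= b -> contC dg x) ->
  (forall x, p0 <= x <= b -> Cmod (dg x) <= D) ->
  exists r : C,
    is_RInt (V := C_R_NormedModule) (fun p => (g p * cis (w * psi p0 c p))%C) p0 b
      (g b * stat_prim 1 p0 c w b - g p0 * stat_prim 1 p0 c w p0 - r)%C /\
    Cmod r <= sqrt PI / 2 * Rpower K (2 * delta - 1) / (1 - (2 * delta - 1)) * Rpower (b - p0) (1 - (2 * delta - 1)) * Rpower w (- delta) * D.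
Proof.
intros Hq Hw HK Hd Dg Cdg HD.
destruct (ibp g dg (stat_prim 1 p0 c w) (fun p => cis (w * psi p0 c p)) p0 b (Rlt_le _ _ Hq) Dg Cdg) as (r & Hr & Hb).
{ intros x _; apply is_derC_stat_prim; lra. }
{ intros x _; apply contC_phase. }
exists r; split; [exact Hr|].
set (gam := 2 * delta - 1) in *; set (L := sqrt PI / 2 * Rpower K gam).
set (k := L * Rpower w (- delta) * D).
assert (Hgam : 0 < gam < 1) by (unfold gam; lra).
apply Rle_trans with ((k / (1 - gam) * pw (b - p0) (1 - gam)) - (k / (1 - gam) * pw (p0 - p0) (1 - gam))).
- apply (Hb (fun p => k / (1 - gam) * pw (p - p0) (1 - gam)) (fun p => k * Rpower (p - p0) (- gam))).
  + intros x Hx; evar_last.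
    * apply (is_derive_scal (fun p => pw (p - p0) (1 - gam))).
      apply (is_derive_comp (fun t => pw t (1 - gam)) (fun p => p - p0)); [apply is_derive_pw; lra|].
      instantiate (1 := 1); auto_derive; [trivial | ring].
    * unfold scal; simpl; unfold mult; simpl.
      replace (1 - gam - 1) with (- gam) by ring; field; lra.
  + intros x Hx.
    apply (continuous_scal_r (V := R_NormedModule) (k / (1 - gam)) (fun p => pw (p - p0) (1 - gam))).
    apply (continuous_comp (fun p => p - p0) (fun t => pw t (1 - gam))); [|apply continuous_pw; lra].
    apply (ex_derive_continuous (K := R_AbsRing) (V := R_NormedModule)); auto_derive; trivial.
  + intros x Hx; rewrite Cmod_mult, Rmult_comm.
    assert (Hs := Cmod_stat_prim_le 1 p0 c w x K delta ltac:(lra) Hw HK Hd ltac:(lra)).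
    fold gam L in Hs; replace (1 * (x - p0)) with (x - p0) in Hs by ring.
    replace (k * Rpower (x - p0) (- gam)) with (L * Rpower w (- delta) * Rpower (x - p0) (- gam) * D) by (unfold k; ring).
    apply Rmult_le_compat; try apply Cmod_ge_0; [exact Hs | apply HD; lra].
- rewrite Rminus_diag, pw_0, pw_pos by lra; right; unfold k, Rdiv; ring.
Qed.

(** * Algebra of real powers and the singular endpoint *)

(** Splitting off integer exponents leaves the fractional powers as atoms, so that [field] can
    finish. *)
Lemma Rpower_sub_nat (x a : R) (n : nat) : 0 < x -> Rpower x (a - INR n) = Rpower x a / x ^ n.
Proof. intros Hx; unfold Rminus; now rewrite Rpower_plus, Rpower_Ropp, Rpower_pow. Qed.

Lemma Rpower_nat_sub (x a : R) (n : nat) : 0 < x -> Rpower x (INR n - a) = x ^ n / Rpower x a.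
Proof. intros Hx; unfold Rminus; now rewrite Rpower_plus, Rpower_Ropp, Rpower_pow. Qed.

Lemma Rpower_div (x y a : R) : 0 < x -> 0 < y -> Rpower (x / y) a = Rpower x a / Rpower y a.
Proof.
intros Hx Hy; unfold Rdiv.
rewrite <- Rpower_mult_distr by (try apply Rinv_0_lt_compat; assumption).
f_equal; rewrite <- Rpower_Ropp; unfold Rpower; rewrite ln_Rinv by assumption; f_equal; ring.
Qed.

Lemma Rpower_pos (x a : R) : 0 < Rpower x a.
Proof. apply exp_pos. Qed.

Ltac gen_Rpower :=
  repeat match goal with |- context [Rpower ?x ?a] =>
    generalize (Rpower_pos x a); generalize (Rpower x a); intros ? ?
  end.

(* With [s = psi p - psi p1 = (p - p1) (2 p0 - p1 - p)], the amplitude is [u p * mfac p] times [s^(mu-1) ds/dp]. *)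
Definition mfac (p1 p0 mu p : R) : R := Rpower (2 * p0 - p1 - p) (1 - mu) / (2 * (p0 - p)).

Definition dmfac (p1 p0 mu p : R) : R :=
  - (1 - mu) * Rpower (2 * p0 - p1 - p) (- mu) / (2 * (p0 - p))
  + Rpower (2 * p0 - p1 - p) (1 - mu) / (2 * (p0 - p) ^ 2).

(** With z = w s, the factor w^(-mu) compensates z^(mu-1) dz; the constant phase at [p1] restores
    e^(i w psi) from e^(iz). *)
Definition sing_prim (p1 p0 c mu w p : R) : C :=
  (cis (w * psi p0 c p1) * RtoC (Rpower w (- mu)) * osc_ext mu (w * ((p - p1) * (2 * p0 - p1 - p))))%C.

Definition sing_phase (p1 p0 c mu w p : R) : C :=
  (RtoC (2 * (p0 - p) * Rpower ((p - p1) * (2 * p0 - p1 - p)) (mu - 1)) * cis (w * psi p0 c p))%C.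

Lemma is_derive_mfac (p1 p0 mu p : R) :
  p1 < p0 -> p < p0 -> is_derive (mfac p1 p0 mu) p (dmfac p1 p0 mu p).
Proof.
intros H1 H2; unfold mfac, dmfac; evar_last.
- apply (is_derive_mult (fun p => Rpower (2 * p0 - p1 - p) (1 - mu)) (fun p => / (2 * (p0 - p)))).
  + apply (is_derive_comp (fun t => Rpower t (1 - mu)) (fun p => 2 * p0 - p1 - p)); [apply is_derive_Rpower; lra|].
    instantiate (1 := -1); auto_derive; [trivial | ring].
  + instantiate (1 := / (2 * (p0 - p) ^ 2)); auto_derive; [lra | field; lra].
  + apply Rmult_comm.
- unfold plus, scal, mult; simpl; unfold mult; simpl.
  replace (1 - mu - 1) with (- mu) by ring; field; lra.
Qed.

Lemma is_derC_sing_prim (p1 p0 c mu w p : R) :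
  0 < mu < 1 -> 0 < w -> p1 < p < p0 -> is_derC (sing_prim p1 p0 c mu w) p (sing_phase p1 p0 c mu w p).
Proof.
intros Hmu Hw Hp; set (s := (p - p1) * (2 * p0 - p1 - p)).
assert (Hs : 0 < s) by (apply Rmult_lt_0_compat; lra).
evar_last.
- apply is_derC_scal, (is_derC_comp (osc_ext mu) (fun p => w * ((p - p1) * (2 * p0 - p1 - p))) p (w * (2 * (p0 - p)))).
  + auto_derive; [trivial | ring].
  + apply is_derC_osc_ext; [exact Hmu | now apply Rmult_lt_0_compat].
- fold s; unfold sing_phase; fold s.
  replace (w * psi p0 c p) with (w * psi p0 c p1 + w * s) by (unfold psi, s; ring).
  rewrite cis_plus.
  transitivity (RtoC (Rpower w (- mu) * (w * (2 * (p0 - p))) * Rpower (w * s) (mu - 1)) * (cis (w * psi p0 c p1) * cis (w * s)))%C.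
  + rewrite !RtoC_mult; ring.
  + do 2 f_equal.
    rewrite <- Rpower_mult_distr by assumption.
    replace (mu - 1) with (mu - INR 1) at 1 by (simpl; ring).
    rewrite Rpower_sub_nat, Rpower_Ropp by assumption; field; split; [lra | apply Rgt_not_eq, Rpower_pos].
Qed.

Lemma sing_phase_ampl (p1 p0 c mu w p : R) (v : R -> C) :
  p1 < p < p0 ->
  ((v p * RtoC (mfac p1 p0 mu p)) * sing_phase p1 p0 c mu w p = ampl p1 mu v p * cis (w * psi p0 c p))%C.
Proof.
intros Hp; unfold sing_phase, ampl.
replace (Rpower (p - p1) (mu - 1))
  with (mfac p1 p0 mu p * (2 * (p0 - p) * Rpower ((p - p1) * (2 * p0 - p1 - p)) (mu - 1))).
- rewrite !RtoC_mult; ring.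
- unfold mfac; rewrite <- Rpower_mult_distr by lra.
  replace (1 - mu) with (- (mu - 1)) by ring; rewrite Rpower_Ropp; gen_Rpower; field; lra.
Qed.

(** w^(-mu) (w s)^(mu-1) = s^(mu-1) / w: this is the source of the order w^(-1). *)
Lemma Cmod_sing_prim_le (p1 p0 c mu w p : R) :
  0 < mu < 1 -> 0 < w -> p1 < p < p0 ->
  Cmod (sing_prim p1 p0 c mu w p) <= / w * (Rpower (p - p1) (mu - 1) * Rpower (2 * p0 - p1 - p) (mu - 1)).
Proof.
intros Hmu Hw Hp; unfold sing_prim.
assert (Hs : 0 < (p - p1) * (2 * p0 - p1 - p)) by (apply Rmult_lt_0_compat; lra).
rewrite !Cmod_mult, Cmod_cis, Cmod_R, Rabs_pos_eq, osc_ext_pos by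
  ((left; apply Rpower_pos) || (now apply Rmult_lt_0_compat)).
apply Rle_trans with (1 * Rpower w (- mu) * Rpower (w * ((p - p1) * (2 * p0 - p1 - p))) (mu - 1)).
- apply Rmult_le_compat_l; [generalize (Rpower_pos w (- mu)); lra|].
  apply Cmod_osc_le; [now apply Rmult_lt_0_compat | lra].
- right; rewrite <- !Rpower_mult_distr by (lra || assumption).
  replace (Rpower w (mu - 1)) with (Rpower w mu / w).
  2: { replace (mu - 1) with (mu - INR 1) by (simpl; ring); rewrite Rpower_sub_nat by assumption; simpl; field; lra. }
  rewrite Rpower_Ropp; field; split; [lra | apply Rgt_not_eq, Rpower_pos].
Qed.

(** The power of 2 p0 - p1 - p in the bound on the primitive cancels the one in [mfac] and [dmfac],
    leaving the integrable (p - p1)^(mu-1). Left of the midpoint, p0 - p is at least half of p0 -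
    p1. *)
Lemma sing_remainder_density (p1 p0 c mu w p M : R) (z dz : C) :
  0 < mu < 1 -> 0 < w -> p1 < p < (p1 + p0) / 2 -> Cmod z <= M -> Cmod dz <= M ->
  Cmod ((dz * RtoC (mfac p1 p0 mu p) + z * RtoC (dmfac p1 p0 mu p)) * sing_prim p1 p0 c mu w p)
    <= M * / w * (2 / (p0 - p1) ^ 2 + / (p0 - p1)) * Rpower (p - p1) (mu - 1).
Proof.
intros Hmu Hw Hp Hz Hdz.
set (r := 2 * p0 - p1 - p); set (t := p0 - p); set (d := p0 - p1).
assert (Ht : d / 2 <= t) by (unfold d, t; lra).
assert (Hd : 0 < d) by (unfold d; lra).
assert (Hr : t < r) by (unfold t, r; lra).
assert (HM : 0 <= M) by (generalize (Cmod_ge_0 z); lra).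
set (A := Rpower r (mu - 1)).
assert (HA : 0 < A) by apply Rpower_pos.
assert (E1 : Rpower r (1 - mu) = / A) by (unfold A; rewrite <- Rpower_Ropp; f_equal; ring).
assert (E2 : Rpower r (- mu) = / (A * r)).
{ replace (- mu) with (- (mu - 1) + - (1)) by ring.
  rewrite Rpower_plus, !Rpower_Ropp, Rpower_1 by lra; unfold A; field; split; [lra | apply Rgt_not_eq, Rpower_pos]. }
assert (Hm : Rabs (mfac p1 p0 mu p) <= / A * / d).
{ unfold mfac; fold r t; rewrite E1, Rabs_pos_eq.
  - apply Rmult_le_compat_l; [left; now apply Rinv_0_lt_compat | apply Rinv_le_contravar; lra].
  - left; apply Rdiv_lt_0_compat; [now apply Rinv_0_lt_compat | lra]. }
assert (Hdm : Rabs (dmfac p1 p0 mu p) <= / A * (2 / d ^ 2)).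
{ unfold dmfac; fold r t; rewrite E1, E2.
  replace (- (1 - mu) * / (A * r) / (2 * t) + / A / (2 * t ^ 2))
    with (/ A * (/ (2 * t ^ 2) - (1 - mu) * / (2 * r * t))) by (field; lra).
  rewrite Rabs_mult, (Rabs_pos_eq (/ A)) by (left; now apply Rinv_0_lt_compat).
  apply Rmult_le_compat_l; [left; now apply Rinv_0_lt_compat|].
  (* The two terms of [dmfac] have opposite signs and the subtracted one is the smaller, since t <
     r; the difference lies between 0 and 1/(2 t^2). *)
  assert (H1 : 0 < / (2 * r * t)) by (apply Rinv_0_lt_compat; nra).
  assert (H2 : / (2 * r * t) <= / (2 * t ^ 2)) by (apply Rinv_le_contravar; nra).
  assert (H3 : / (2 * t ^ 2) <= 2 / d ^ 2).
  { replace (2 / d ^ 2) with (/ (2 * (d / 2) ^ 2)) by (field; lra); apply Rinv_le_contravar; nra. }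
  rewrite Rabs_pos_eq; nra. }
rewrite Cmod_mult.
assert (HB := Cmod_sing_prim_le p1 p0 c mu w p Hmu Hw ltac:(lra)); fold r A in HB.
apply Rle_trans with ((M * (/ A * / d) + M * (/ A * (2 / d ^ 2))) * (/ w * (Rpower (p - p1) (mu - 1) * A))).
- apply Rmult_le_compat; try apply Cmod_ge_0; [|exact HB].
  apply Rle_trans with (1 := Cmod_triangle _ _); rewrite !Cmod_mult, !Cmod_R.
  apply Rplus_le_compat; apply Rmult_le_compat; try apply Cmod_ge_0; try apply Rabs_pos; assumption.
- right; field; lra.
Qed.

(** The last factor of the bound is the integral of (p - p1)^(mu-1) from [p1] to the midpoint. *)
Lemma singular_side (p1 p0 c mu w M : R) (v dv : R -> C) :
  p1 < p0 -> 0 < mu < 1 -> 0 < w ->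
  (forall x, is_derC v x (dv x)) -> (forall x, contC dv x) ->
  (forall x, p1 <= x <= p0 -> Cmod (v x) <= M /\ Cmod (dv x) <= M) ->
  let q := (p1 + p0) / 2 in
  let k p := (v p * RtoC (mfac p1 p0 mu p))%C in
  exists r : C,
    is_RInt_gen (V := C_R_NormedModule) (fun p => (ampl p1 mu v p * cis (w * psi p0 c p))%C) (at_right p1) (at_point q)
      (k q * sing_prim p1 p0 c mu w q - k p1 * sing_prim p1 p0 c mu w p1 - r)%C /\
    Cmod r <= M * / w * (2 / (p0 - p1) ^ 2 + / (p0 - p1)) * (Rpower ((p0 - p1) / 2) mu / mu).
Proof.
intros Hp Hmu Hw Dv Cdv HM q k.
assert (Hq : p1 < q < p0) by (unfold q; lra).
assert (Cv : forall x, contC v x) by (intros x; eapply is_derC_contC; apply Dv).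
assert (Dm : forall x, p1 <= x <= q -> is_derive (mfac p1 p0 mu) x (dmfac p1 p0 mu x)).
{ intros x Hx; apply is_derive_mfac; lra. }
destruct (ibp_singular k (fun x => dv x * RtoC (mfac p1 p0 mu x) + v x * RtoC (dmfac p1 p0 mu x))%C
  (sing_prim p1 p0 c mu w) (sing_phase p1 p0 c mu w) p1 q ltac:(lra)) as (r & Hr & Hb).
- intros x Hx; apply (is_derC_mult v (fun x => RtoC (mfac p1 p0 mu x))); [apply Dv | now apply is_derC_RtoC, Dm].
- intros x Hx; apply (continuous_plus (V := C_R_NormedModule)); apply contC_mult; auto; apply contC_RtoC.
  + apply (ex_derive_continuous (K := R_AbsRing) (V := R_NormedModule)); eexists; now apply Dm.
  + apply (ex_derive_continuous (K := R_AbsRing) (V := R_NormedModule)); unfold dmfac, Rpower; auto_derive.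
    repeat split; try lra; simpl; nra.
- intros x Hx; apply contC_mult; [apply continuous_const|].
  apply (continuous_comp (fun p => w * ((p - p1) * (2 * p0 - p1 - p))) (osc_ext mu)); [|now apply contC_osc_ext].
  apply (ex_derive_continuous (K := R_AbsRing) (V := R_NormedModule)); auto_derive; trivial.
- intros x Hx; apply is_derC_sing_prim; lra.
- intros x Hx; apply contC_mult; [|apply contC_phase].
  apply contC_RtoC, (ex_derive_continuous (K := R_AbsRing) (V := R_NormedModule)); unfold Rpower; auto_derive.
  apply Rmult_lt_0_compat; lra.
- exists r; split.
  + apply (is_RInt_gen_ext (fun x => (k x * sing_phase p1 p0 c mu w x)%C)); [|exact Hr].
    exists (fun x => p1 < x < q) (fun y => y = q).
    * exists (mkposreal (q - p1) ltac:(lra)); intros y Hy Hay.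
      change (Rabs (y - p1) < q - p1) in Hy; apply Rabs_lt_between' in Hy; lra.
    * reflexivity.
    * intros x y Hx ->; simpl fst; simpl snd; rewrite Rmin_left, Rmax_right by lra.
      intros t Ht; apply sing_phase_ampl; lra.
  + set (C0 := M * / w * (2 / (p0 - p1) ^ 2 + / (p0 - p1))).
    apply Rle_trans with (C0 / mu * pw (q - p1) mu - C0 / mu * pw (p1 - p1) mu).
    * apply (Hb (fun p => C0 / mu * pw (p - p1) mu) (fun p => C0 * Rpower (p - p1) (mu - 1))).
      -- intros x Hx; evar_last.
         ++ apply (is_derive_scal (fun p => pw (p - p1) mu)).
            apply (is_derive_comp (fun t => pw t mu) (fun p => p - p1)); [apply is_derive_pw; lra|].
            instantiate (1 := 1); auto_derive; [trivial | ring].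
         ++ unfold scal; simpl; unfold mult; simpl; field; lra.
      -- intros x Hx; apply (continuous_scal_r (V := R_NormedModule) (C0 / mu) (fun p => pw (p - p1) mu)).
         apply (continuous_comp (fun p => p - p1) (fun t => pw t mu)); [|apply continuous_pw; lra].
         apply (ex_derive_continuous (K := R_AbsRing) (V := R_NormedModule)); auto_derive; trivial.
      -- intros x Hx; apply sing_remainder_density; [exact Hmu | exact Hw | exact Hx | apply HM; lra | apply HM; lra].
    * rewrite Rminus_diag, pw_0, pw_pos by lra.
      replace (q - p1) with ((p0 - p1) / 2) by (unfold q; field); right; field; lra.
Qed.

Lemma sing_prim_left (p1 p0 c mu w : R) :
  sing_prim p1 p0 c mu w p1 =
  (- (cis (w * psi p0 c p1) * RtoC (Rpower w (- mu)) * (cis (PI * mu / 2) * RtoC (Gamma mu))))%C.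
Proof. unfold sing_prim; rewrite Rminus_diag, Rmult_0_l, Rmult_0_r, osc_ext_0; ring. Qed.

(* Both primitives have the same leading term at the midpoint, so only second-order terms remain there. *)
Lemma midpoint_boundary (p1 p0 c mu w M : R) (v : R -> C) :
  p1 < p0 -> 0 < mu < 1 -> 0 < w ->
  let q := (p1 + p0) / 2 in let d := p0 - p1 in
  Cmod (v q) <= M ->
  Cmod (v q * RtoC (mfac p1 p0 mu q) * sing_prim p1 p0 c mu w q - ampl p1 mu v q * stat_prim (-1) p0 c w q)
    <= (1 - mu) * (Rpower 2 (3 - mu) / 3) * M * Rpower d (- (4 - mu)) * Rpower w (- (2))
     + Rpower 2 (2 - mu) * M * Rpower d (- (3 - mu)) * Rpower w (- (3 / 2)).
Proof.
intros Hp Hmu Hw q d HM.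
set (a := d / 2).
assert (Ha : 0 < a) by (unfold a, d; lra).
assert (HM0 : 0 <= M) by (generalize (Cmod_ge_0 (v q)); lra).
assert (Hsw : 0 < sqrt w) by now apply sqrt_lt_R0.
assert (Hsqw : sqrt w * sqrt w = w) by (apply sqrt_sqrt; lra).
assert (Ew : Rpower w (- (1 / 2)) = / sqrt w).
{ apply Rmult_eq_reg_l with (sqrt w); [|lra]; rewrite sqrt_mul_Rpower by assumption; field; lra. }
assert (Ew2 : Rpower w (- (2)) = / w ^ 2).
{ rewrite Rpower_Ropp; replace 2 with (INR 2) at 1 by (simpl; ring); now rewrite Rpower_pow. }
(* Phase increment from [p1] to the midpoint, (2a)^2 - a^2; its 3 is the one in the constant of
   index 3. *)
set (s1 := 3 * a ^ 2).
assert (Hs1 : 0 < s1) by (unfold s1; nra).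
set (x := sqrt w * a).
assert (Hx : 0 < x) by (apply Rmult_lt_0_compat; assumption).
assert (Hx2 : x ^ 2 = w * a ^ 2) by (unfold x; rewrite <- Hsqw at 2; ring).
set (e1 := (osc (mu - 1) (w * s1) + Ci * cis (w * s1) * RtoC (Rpower (w * s1) (mu - 1)))%C).
set (e2 := (fresnel x - RtoC (/ (2 * x)) * Ci * cis (- x ^ 2))%C).
assert (He1 : Cmod e1 <= (1 - mu) * Rpower (w * s1) (mu - 2)).
{ replace (1 - mu) with (- (mu - 1)) by ring; replace (mu - 2) with (mu - 1 - 1) by ring.
  apply Cmod_osc_expansion; [now apply Rmult_lt_0_compat | lra]. }
assert (He2 : Cmod e2 <= / x ^ 2 / 2) by now apply Cmod_fresnel_expansion.
assert (Hm : mfac p1 p0 mu q = Rpower (3 * a) (1 - mu) / (2 * a)).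
{ unfold mfac; replace (2 * p0 - p1 - q) with (3 * a) by (unfold a, d, q; field).
  replace (p0 - q) with a by (unfold a, d, q; field); reflexivity. }
assert (HPa : 0 < Rpower a mu) by apply Rpower_pos.
assert (HPw : 0 < Rpower w mu) by apply Rpower_pos.
assert (HP3 : 0 < Rpower 3 mu) by apply Rpower_pos.
assert (HP2 : 0 < Rpower 2 mu) by apply Rpower_pos.
assert (Hmq : mfac p1 p0 mu q = 3 / (2 * (Rpower 3 mu * Rpower a mu))).
{ rewrite Hm, <- Rpower_mult_distr by lra.
  replace (1 - mu) with (INR 1 - mu) by (simpl; ring).
  rewrite !Rpower_nat_sub by lra; gen_Rpower; simpl; field; lra. }
assert (Hga : Rpower (q - p1) (mu - 1) = Rpower a mu / a).
{ replace (q - p1) with a by (unfold a, d, q; field); replace (mu - 1) with (mu - INR 1) by (simpl; ring).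
  rewrite Rpower_sub_nat by lra; gen_Rpower; simpl; field; lra. }
assert (Hws : forall b, Rpower (w * s1) b = Rpower w b * (Rpower 3 b * (Rpower a b * Rpower a b))).
{ intros b; unfold s1; rewrite <- !Rpower_mult_distr by nra; do 2 f_equal.
  rewrite Rpower_sq, <- Rpower_plus by assumption; f_equal; ring. }
(* The cancellation: [Hlead] and [Hlead'] give the two leading terms the same coefficient, [Hph1]
   and [Hph2] the same phase. What is left is carried by [e1] and [e2]. *)
assert (Hlead : mfac p1 p0 mu q * (Rpower w (- mu) * Rpower (w * s1) (mu - 1)) = Rpower a mu / (2 * a ^ 2 * w)).
{ rewrite Hmq, Hws, Rpower_Ropp; replace (mu - 1) with (mu - INR 1) by (simpl; ring).
  rewrite !Rpower_sub_nat by lra; gen_Rpower; simpl; field; lra. }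
assert (Hlead' : Rpower a mu / a * (/ sqrt w * / (2 * x)) = Rpower a mu / (2 * a ^ 2 * w)).
{ transitivity (Rpower a mu / (2 * a ^ 2 * (sqrt w * sqrt w))); [unfold x; field; lra | now rewrite Hsqw]. }
assert (Hph1 : w * psi p0 c q = w * psi p0 c p1 + w * s1).
{ unfold psi, s1, a, d, q; field. }
assert (Hph2 : w * psi p0 c q = w * c + - x ^ 2).
{ rewrite Hx2; unfold psi, a, d, q; field. }
replace (v q * RtoC (mfac p1 p0 mu q) * sing_prim p1 p0 c mu w q - ampl p1 mu v q * stat_prim (-1) p0 c w q)%C
  with (v q * RtoC (mfac p1 p0 mu q * Rpower w (- mu)) * cis (w * psi p0 c p1) * e1
        + v q * RtoC (Rpower a mu / a * / sqrt w) * cis (w * c) * e2)%C.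
2: { unfold sing_prim, stat_prim, ampl.
     replace (w * ((q - p1) * (2 * p0 - p1 - q))) with (w * s1) by (unfold s1, a, d, q; field).
     replace (-1 * sqrt w * (q - p0)) with x by (unfold x, a, d, q; field).
     rewrite osc_ext_pos, Hga, Ew by now apply Rmult_lt_0_compat.
     replace (osc (mu - 1) (w * s1)) with (e1 - Ci * cis (w * s1) * RtoC (Rpower (w * s1) (mu - 1)))%C by (unfold e1; ring).
     replace (fresnel x) with (e2 + RtoC (/ (2 * x)) * Ci * cis (- x ^ 2))%C by (unfold e2; ring).
     transitivity (v q * RtoC (mfac p1 p0 mu q * Rpower w (- mu)) * cis (w * psi p0 c p1) * e1
        + v q * RtoC (Rpower a mu / a * / sqrt w) * cis (w * c) * e2
        - v q * Ci * RtoC (mfac p1 p0 mu q * (Rpower w (- mu) * Rpower (w * s1) (mu - 1))) * cis (w * psi p0 c q)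
        + v q * Ci * RtoC (Rpower a mu / a * (/ sqrt w * / (2 * x))) * cis (w * psi p0 c q))%C.
     - rewrite Hlead, Hlead'; ring.
     - rewrite Hph1 at 1; rewrite Hph2, !cis_plus, !RtoC_mult; ring. }
apply Rle_trans with (1 := Cmod_triangle _ _).
rewrite !Cmod_mult, !Cmod_cis, !Cmod_R, !Rmult_1_r.
rewrite !Rabs_pos_eq.
2: { apply Rlt_le, Rmult_lt_0_compat; [apply Rdiv_lt_0_compat; assumption | now apply Rinv_0_lt_compat]. }
2: { rewrite Hmq; apply Rlt_le, Rmult_lt_0_compat; [|apply Rpower_pos].
     apply Rdiv_lt_0_compat; [lra|]; apply Rmult_lt_0_compat; [lra | now apply Rmult_lt_0_compat]. }
assert (Ed : d = 2 * a) by (unfold a; field).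
apply Rplus_le_compat.
- apply Rle_trans with (M * (mfac p1 p0 mu q * Rpower w (- mu)) * ((1 - mu) * Rpower (w * s1) (mu - 2))).
  + apply Rmult_le_compat; [|apply Cmod_ge_0| |exact He1].
    * apply Rmult_le_pos; [apply Cmod_ge_0|]; rewrite Hmq; apply Rlt_le, Rmult_lt_0_compat; [|apply Rpower_pos].
      apply Rdiv_lt_0_compat; [lra|]; apply Rmult_lt_0_compat; [lra | now apply Rmult_lt_0_compat].
    * apply Rmult_le_compat_r; [|exact HM]; rewrite Hmq; apply Rlt_le, Rmult_lt_0_compat; [|apply Rpower_pos].
      apply Rdiv_lt_0_compat; [lra|]; apply Rmult_lt_0_compat; [lra | now apply Rmult_lt_0_compat].
  + right; rewrite Hmq, Hws, Ed, <- (Rpower_mult_distr 2 a), (Rpower_Ropp w mu), (Rpower_Ropp 2), (Rpower_Ropp a) by lra.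
    replace (mu - 2) with (mu - INR 2) by (simpl; ring).
    replace (4 - mu) with (INR 4 - mu) by (simpl; ring).
    replace (3 - mu) with (INR 3 - mu) by (simpl; ring).
    rewrite Ew2, !Rpower_sub_nat, !Rpower_nat_sub by lra.
    clear - HP3 HP2 HPw HPa Ha Hw; revert HP3 HP2 HPw HPa.
    generalize (Rpower a mu) (Rpower w mu) (Rpower 3 mu) (Rpower 2 mu); intros.
    simpl; field; repeat split; lra.
- apply Rle_trans with (M * (Rpower a mu / a * / sqrt w) * (/ x ^ 2 / 2)).
  + assert (0 <= Rpower a mu / a * / sqrt w).
    { apply Rlt_le, Rmult_lt_0_compat; [apply Rdiv_lt_0_compat; assumption | now apply Rinv_0_lt_compat]. }
    apply Rmult_le_compat; [|apply Cmod_ge_0| |exact He2].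
    * apply Rmult_le_pos; [apply Cmod_ge_0 | assumption].
    * now apply Rmult_le_compat_r.
  + right; rewrite Ed, <- Rpower_mult_distr, Hx2 by lra.
    replace (Rpower w (- (3 / 2))) with (/ w * / sqrt w).
    2: { replace (- (3 / 2)) with (- (1) + - (1 / 2)) by field.
         rewrite Rpower_plus, Ew, Rpower_Ropp, Rpower_1 by assumption; reflexivity. }
    rewrite !Rpower_Ropp.
    replace (2 - mu) with (INR 2 - mu) by (simpl; ring).
    replace (3 - mu) with (INR 3 - mu) by (simpl; ring).
    rewrite !Rpower_nat_sub by lra.
    clear - HP2 HPa Ha Hw Hsw; revert HP2 HPa.
    generalize (Rpower a mu) (Rpower 2 mu); intros.
    simpl; field; repeat split; lra.
Qed.

(** * Comparison with the stated constants *)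

(** The stated constants of index 1 and 2 exceed the ones obtained by the factors 2 (2 - mu) > 2 and
    2. *)
Lemma singular_bound (d w mu M : R) :
  0 < d -> 0 < w -> 0 < mu < 1 -> 0 <= M ->
  M * / w * (2 / d ^ 2 + / d) * (Rpower (d / 2) mu / mu)
    <= Rpower 2 (2 - mu) / mu * (2 - mu) * M * Rpower d (- (2 - mu)) * Rpower w (- (1))
     + Rpower 2 (1 - mu) / mu * M * Rpower d (- (1 - mu)) * Rpower w (- (1)).
Proof.
intros Hd Hw Hmu HM.
rewrite (Rpower_Ropp w), (Rpower_1 w), !(Rpower_Ropp d), Rpower_div by lra.
replace (2 - mu) with (INR 2 - mu) at 1 3 by (simpl; ring).
replace (1 - mu) with (INR 1 - mu) by (simpl; ring).
rewrite !Rpower_nat_sub by lra.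
generalize (Rpower_pos d mu) (Rpower_pos 2 mu); generalize (Rpower d mu) (Rpower 2 mu).
intros P T HP HT; apply Rminus_le_0.
match goal with |- 0 <= ?z => replace z with (M * P * / (w * T * mu) * ((4 * (2 - mu) - 2) * / d ^ 2 + / d)) by (simpl; field; lra) end.
apply Rmult_le_pos.
- apply Rmult_le_pos; [nra | left; apply Rinv_0_lt_compat; repeat apply Rmult_lt_0_compat; lra].
- assert (0 < / d ^ 2) by (apply Rinv_0_lt_compat; nra).
  assert (0 < / d) by (apply Rinv_0_lt_compat; lra).
  nra.
Qed.

(** The powers of d/2 produce an extra 2^gamma, which the stated constants replace by 2. *)
Lemma stationary_left_bound (d w mu gam delta L M : R) :
  0 < d -> 0 < gam < 1 -> 0 < mu < 1 -> 0 <= M -> 0 <= L ->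
  L / (1 - gam) * Rpower (d / 2) (1 - gam) * Rpower w (- delta)
    * (((1 - mu) * Rpower (d / 2) (mu - 2) + Rpower (d / 2) (mu - 1)) * M)
  <= L / (1 - gam) * Rpower 2 (2 - mu) * (1 - mu) * M * Rpower d (- (1 + gam - mu)) * Rpower w (- delta)
   + L / (1 - gam) * Rpower 2 (1 - mu) * M * Rpower d (- (gam - mu)) * Rpower w (- delta).
Proof.
intros Hd Hg Hmu HM HL.
replace (- (1 + gam - mu)) with (mu + - gam - INR 1) by (simpl; ring).
replace (- (gam - mu)) with (mu + - gam) by ring.
replace (Rpower 2 (2 - mu)) with (4 / Rpower 2 mu).
2: { replace (2 - mu) with (INR 2 - mu) by (simpl; ring); rewrite Rpower_nat_sub by lra; f_equal; simpl; ring. }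
replace (Rpower 2 (1 - mu)) with (2 / Rpower 2 mu).
2: { replace (1 - mu) with (INR 1 - mu) by (simpl; ring); rewrite Rpower_nat_sub by lra; f_equal; simpl; ring. }
replace (Rpower (d / 2) (1 - gam)) with (d / 2 / (Rpower d gam / Rpower 2 gam)).
2: { replace (1 - gam) with (INR 1 - gam) by (simpl; ring); rewrite Rpower_nat_sub, Rpower_div by lra; f_equal; simpl; ring. }
replace (Rpower (d / 2) (mu - 2)) with (Rpower d mu / Rpower 2 mu / (d / 2) ^ 2).
2: { replace (mu - 2) with (mu - INR 2) by (simpl; ring); rewrite Rpower_sub_nat, Rpower_div by lra; reflexivity. }
replace (Rpower (d / 2) (mu - 1)) with (Rpower d mu / Rpower 2 mu / (d / 2)).
2: { replace (mu - 1) with (mu - INR 1) by (simpl; ring); rewrite Rpower_sub_nat, Rpower_div by lra; f_equal; simpl; ring. }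
rewrite Rpower_sub_nat, !Rpower_plus, (Rpower_Ropp d) by assumption.
assert (HG : Rpower 2 gam <= 2).
{ rewrite <- (Rpower_1 2) at 2 by lra; apply Rle_Rpower; lra. }
generalize (Rpower_pos w (- delta)) (Rpower_pos d mu) (Rpower_pos 2 mu) (Rpower_pos d gam) (Rpower_pos 2 gam).
revert HG; generalize (Rpower w (- delta)) (Rpower d mu) (Rpower 2 mu) (Rpower d gam) (Rpower 2 gam).
intros W P T Q G HG HW HP HT HQ HG0; apply Rminus_le_0.
match goal with |- 0 <= ?z => replace z with (L * M * W * P * / ((1 - gam) * T * Q) * (2 - G) * (2 * (1 - mu) * / d + 1)) end.
2: simpl; field; lra.
assert (0 < / d) by now apply Rinv_0_lt_compat.
repeat apply Rmult_le_pos; try lra; try nra.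
left; apply Rinv_0_lt_compat; repeat apply Rmult_lt_0_compat; lra.
Qed.

(** With b = p2 - p0 and d = p0 - p1, the only loss is from the power of p2 - p0 to that of p2 -
    p1. *)
Lemma stationary_right_bound (d b w mu gam delta L M : R) :
  0 < b -> 0 < d -> 0 < gam < 1 -> 0 < mu < 1 -> 0 <= M -> 0 <= L ->
  L / (1 - gam) * Rpower b (1 - gam) * Rpower w (- delta)
    * (((1 - mu) * Rpower d (mu - 2) + Rpower d (mu - 1)) * M)
  <= L / (1 - gam) * (1 - mu) * Rpower (b + d) (1 - gam) * M * Rpower d (- (2 - mu)) * Rpower w (- delta)
   + L / (1 - gam) * Rpower (b + d) (1 - gam) * M * Rpower d (- (1 - mu)) * Rpower w (- delta).
Proof.
intros Hb Hd Hg Hmu HM HL.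
replace (- (2 - mu)) with (mu - 2) by ring; replace (- (1 - mu)) with (mu - 1) by ring.
assert (H : Rpower b (1 - gam) <= Rpower (b + d) (1 - gam)) by (apply Rle_Rpower_l; lra).
assert (HL' : 0 <= L / (1 - gam)) by (apply Rmult_le_pos; [lra | left; apply Rinv_0_lt_compat; lra]).
assert (HK : 0 <= Rpower w (- delta) * (((1 - mu) * Rpower d (mu - 2) + Rpower d (mu - 1)) * M)).
{ generalize (Rpower_pos w (- delta)) (Rpower_pos d (mu - 2)) (Rpower_pos d (mu - 1)); intros.
  apply Rmult_le_pos; [lra|]; apply Rmult_le_pos; [nra | lra]. }
apply Rle_trans with (L / (1 - gam) * Rpower (b + d) (1 - gam) * (Rpower w (- delta) * (((1 - mu) * Rpower d (mu - 2) + Rpower d (mu - 1)) * M))).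
- rewrite (Rmult_assoc (L / (1 - gam) * Rpower b (1 - gam))).
  apply Rmult_le_compat_r; [exact HK | now apply Rmult_le_compat_l].
- right; ring.
Qed.

Lemma sqrt_PI_ge_1 : 1 <= sqrt PI.
Proof. rewrite <- sqrt_1; apply sqrt_le_1_alt; generalize PI2_1; lra. Qed.

(** In terms of y = sqrt(pi) K the equation reads y (y - 1) = pi/2 > 0, so the positive root has y >
    1. *)
Lemma inv_sqrt_PI_le_root (K : R) :
  0 < K -> sqrt PI / 2 * K ^ 2 - 1 / 2 * K - sqrt PI / 4 = 0 -> / sqrt PI <= K.
Proof.
intros HK E.
assert (Hs : 0 < sqrt PI) by apply sqrt_lt_R0, PI_RGT_0.
apply Rmult_le_reg_l with (sqrt PI); [exact Hs|]; rewrite Rinv_r by lra.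
assert (H : sqrt PI * K * (sqrt PI * K - 1) = sqrt PI * sqrt PI / 2).
{ replace (sqrt PI * K * (sqrt PI * K - 1))
    with (2 * sqrt PI * (sqrt PI / 2 * K ^ 2 - 1 / 2 * K - sqrt PI / 4) + sqrt PI * sqrt PI / 2) by field.
  rewrite E; ring. }
assert (0 < sqrt PI * K) by now apply Rmult_lt_0_compat.
nra.
Qed.

(** * Assembly of the two error estimates *)

(** The boundary values at [p1] and [p0] are exactly the two main terms. The error consists of the
    remainders on both sides of the midpoint and of the mismatch [kq - gq] there. *)
Lemma I1_error_le (p1 p2 p0 c mu w M0 M delta K : R) (u v dv : R -> C) :
  p1 < p0 < p2 -> 0 < mu < 1 -> 0 < w -> / sqrt PI <= K -> 1 / 2 < delta < 1 ->
  (forall x, is_derC v x (dv x)) -> (forall x, contC dv x) ->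
  (forall x, p1 <= x <= p2 -> v x = u x) ->
  (forall x, p1 <= x <= p2 -> Cmod (v x) <= M0 /\ Cmod (v x) <= M /\ Cmod (dv x) <= M) ->
  let gam := 2 * delta - 1 in
  let L := sqrt PI / 2 * Rpower K gam in
  let d := p0 - p1 in
  Cmod (I1 p1 p0 c mu w u
    - Ktilde p1 p0 c mu w u * RtoC (Rpower d (- mu)) * RtoC (Rpower w (- mu))
    - RtoC (1 / 2) * Htilde p0 c w u * RtoC (Rpower d (mu - 1)) * RtoC (Rpower w (- (1 / 2))))
  <= M * / w * (2 / d ^ 2 + / d) * (Rpower (d / 2) mu / mu)
   + L / (1 - gam) * Rpower (d / 2) (1 - gam) * Rpower w (- delta)
      * (((1 - mu) * Rpower (d / 2) (mu - 2) + Rpower (d / 2) (mu - 1)) * M)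
   + ((1 - mu) * (Rpower 2 (3 - mu) / 3) * M0 * Rpower d (- (4 - mu)) * Rpower w (- (2))
     + Rpower 2 (2 - mu) * M0 * Rpower d (- (3 - mu)) * Rpower w (- (3 / 2))).
Proof.
intros Hp Hmu Hw HK Hd Dv Cdv Hvu HM gam L d.
set (q := (p1 + p0) / 2).
assert (Hq : p1 < q < p0) by (unfold q; lra).
assert (Hd0 : 0 < d) by (unfold d; lra).
assert (Cv : forall x, contC v x) by (intros x; eapply is_derC_contC; apply Dv).
destruct (singular_side p1 p0 c mu w M v dv ltac:(lra) Hmu Hw Dv Cdv) as (r1 & Hr1 & Hb1).
{ intros x Hx; apply HM; lra. }
destruct (stationary_left (ampl p1 mu v) (dampl p1 mu v dv) q p0 c w K delta
  (((1 - mu) * Rpower (d / 2) (mu - 2) + Rpower (d / 2) (mu - 1)) * M) ltac:(lra) Hw HK Hd) as (r2 & Hr2 & Hb2).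
{ intros x Hx; apply is_derC_ampl; [lra | apply Dv]. }
{ intros x Hx; apply contC_dampl; [lra | apply Cv | apply Cdv]. }
{ intros x Hx; apply Cmod_dampl_le; [exact Hmu | unfold d, q in *; lra | apply HM; lra | apply HM; lra]. }
(* Applied with [M0], since the mismatch depends on the value of [v] at the midpoint but not on its
   derivative. *)
assert (HB := midpoint_boundary p1 p0 c mu w M0 v ltac:(lra) Hmu Hw).
cbv zeta in HB, Hr1; fold q d in HB, Hr1.
specialize (HB (proj1 (HM q ltac:(lra)))).
fold gam L in Hb2; fold d in Hb1.
replace (p0 - q) with (d / 2) in Hb2 by (unfold d, q; field).
set (kq := (v q * RtoC (mfac p1 p0 mu q) * sing_prim p1 p0 c mu w q)%C) in *.
set (kp := (v p1 * RtoC (mfac p1 p0 mu p1) * sing_prim p1 p0 c mu w p1)%C) in *.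
set (gq := (ampl p1 mu v q * stat_prim (-1) p0 c w q)%C) in *.
set (g0 := (ampl p1 mu v p0 * stat_prim (-1) p0 c w p0)%C) in *.
assert (HI : I1 p1 p0 c mu w u = ((kq - kp - r1) + (g0 - gq - r2))%C).
{ unfold I1; apply (is_RInt_gen_unique (V := C_R_CompleteNormedModule)).
  apply (is_RInt_gen_ext (V := C_R_NormedModule) (fun p => (ampl p1 mu v p * cis (w * psi p0 c p))%C)).
  - exists (fun x => p1 < x < p0) (fun y => y = p0).
    + exists (mkposreal (p0 - p1) ltac:(lra)); intros y Hy Hay.
      change (Rabs (y - p1) < p0 - p1) in Hy; apply Rabs_lt_between' in Hy; lra.
    + reflexivity.
    + intros x y Hx ->; simpl fst; simpl snd; rewrite Rmin_left, Rmax_right by lra.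
      intros t Ht; unfold ampl, integrand, U; rewrite Hvu by lra; reflexivity.
  - apply (is_RInt_gen_Chasles (V := C_R_NormedModule)) with q; [exact Hr1|].
    apply is_RInt_gen_at_point; exact Hr2. }
assert (Hkp : kp = (- (Ktilde p1 p0 c mu w u * RtoC (Rpower d (- mu)) * RtoC (Rpower w (- mu))))%C).
{ unfold kp; rewrite sing_prim_left, Hvu by lra; unfold Ktilde.
  replace (mfac p1 p0 mu p1) with (/ Rpower 2 mu * Rpower d (- mu)).
  - unfold Rdiv; rewrite !RtoC_mult; ring.
  - unfold mfac; replace (2 * p0 - p1 - p1) with (2 * d) by (unfold d; ring); fold d.
    rewrite <- Rpower_mult_distr, Rpower_Ropp by lra.
    replace (1 - mu) with (INR 1 - mu) by (simpl; ring); rewrite !Rpower_nat_sub by lra.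
    gen_Rpower; simpl; field; lra. }
assert (Hg0 : g0 = (RtoC (1 / 2) * Htilde p0 c w u * RtoC (Rpower d (mu - 1)) * RtoC (Rpower w (- (1 / 2))))%C).
{ unfold g0, ampl, Htilde; rewrite stat_prim_center, Hvu by lra; fold d.
  replace (-1 * Rpower w (- (1 / 2)) * (sqrt PI / 2)) with (- (1 / 2 * sqrt PI * Rpower w (- (1 / 2)))) by field.
  rewrite RtoC_opp, !RtoC_mult; ring. }
rewrite HI, Hkp, Hg0.
match goal with |- Cmod ?z <= _ => replace z with ((kq - gq) + (- r1 + - r2))%C by ring end.
apply Rle_trans with (1 := Cmod_triangle _ _).
apply Rle_trans with (1 := Rplus_le_compat_l _ _ _ (Cmod_triangle _ _)).
rewrite !Cmod_opp; lra.
Qed.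

(** The vanishing of [U] at [p2] removes the boundary term there; the one at [p0] is the main term,
    so the error is the remainder alone. *)
Lemma I2_error_le (p1 p2 p0 c mu w M delta K : R) (u v dv : R -> C) :
  p1 < p0 < p2 -> 0 < mu < 1 -> 0 < w -> / sqrt PI <= K -> 1 / 2 < delta < 1 ->
  (forall x, is_derC v x (dv x)) -> (forall x, contC dv x) ->
  (forall x, p1 <= x <= p2 -> v x = u x) -> U p1 mu u p2 = RtoC 0 ->
  (forall x, p1 <= x <= p2 -> Cmod (v x) <= M /\ Cmod (dv x) <= M) ->
  let gam := 2 * delta - 1 in
  let L := sqrt PI / 2 * Rpower K gam in
  let d := p0 - p1 in
  Cmod (I2 p1 p2 p0 c mu w u
    - RtoC (1 / 2) * Htilde p0 c w u * RtoC (Rpower d (mu - 1)) * RtoC (Rpower w (- (1 / 2))))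
  <= L / (1 - gam) * Rpower (p2 - p0) (1 - gam) * Rpower w (- delta)
      * (((1 - mu) * Rpower d (mu - 2) + Rpower d (mu - 1)) * M).
Proof.
intros Hp Hmu Hw HK Hd Dv Cdv Hvu HU HM gam L d.
assert (Cv : forall x, contC v x) by (intros x; eapply is_derC_contC; apply Dv).
destruct (stationary_right (ampl p1 mu v) (dampl p1 mu v dv) p2 p0 c w K delta
  (((1 - mu) * Rpower d (mu - 2) + Rpower d (mu - 1)) * M) ltac:(lra) Hw HK Hd) as (r & Hr & Hb).
{ intros x Hx; apply is_derC_ampl; [lra | apply Dv]. }
{ intros x Hx; apply contC_dampl; [lra | apply Cv | apply Cdv]. }
{ intros x Hx; apply Cmod_dampl_le; [exact Hmu | unfold d in *; lra | apply HM; lra | apply HM; lra]. }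
fold gam L in Hb.
assert (HI : I2 p1 p2 p0 c mu w u =
  (ampl p1 mu v p2 * stat_prim 1 p0 c w p2 - ampl p1 mu v p0 * stat_prim 1 p0 c w p0 - r)%C).
{ unfold I2; apply (is_RInt_unique (V := C_R_CompleteNormedModule)).
  apply (is_RInt_ext (V := C_R_NormedModule) (fun p => (ampl p1 mu v p * cis (w * psi p0 c p))%C)); [|exact Hr].
  rewrite Rmin_left, Rmax_right by lra; intros t Ht.
  unfold ampl, integrand, U; rewrite Hvu by lra; reflexivity. }
assert (Hp2 : ampl p1 mu v p2 = RtoC 0).
{ unfold ampl; rewrite Hvu by lra; exact HU. }
assert (Hg0 : (- (ampl p1 mu v p0 * stat_prim 1 p0 c w p0) =
  RtoC (1 / 2) * Htilde p0 c w u * RtoC (Rpower d (mu - 1)) * RtoC (Rpower w (- (1 / 2))))%C).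
{ unfold ampl, Htilde; rewrite stat_prim_center, Hvu by lra; fold d.
  replace (1 * Rpower w (- (1 / 2)) * (sqrt PI / 2)) with (1 / 2 * sqrt PI * Rpower w (- (1 / 2))) by field.
  rewrite !RtoC_mult; ring. }
rewrite HI, Hp2, <- Hg0.
match goal with |- Cmod ?z <= _ => replace z with (- r)%C by ring end.
rewrite Cmod_opp; exact Hb.
Qed.

Theorem theorem3p1
  (p1 p2 p0 c mu : R) (u du : R -> C) (delta K : R)
  (Hp : p1 < p2) (Hp0 : p1 < p0 < p2) (Hmu : 0 < mu < 1)
  (Hu : C1_on p1 p2 u du) (Hu1 : u p1 <> RtoC 0) (HU2 : U p1 mu u p2 = RtoC 0)
  (Hdelta : 1 / 2 < delta < 1)
  (HK0 : 0 < K)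
  (HK : sqrt PI / 2 * K ^ 2 - 1 / 2 * K - sqrt PI / 4 = 0) :
  let gam := 2 * delta - 1 in
  let L := sqrt PI / 2 * Rpower K gam in
  let M0 := Linf_norm p1 p2 u in
  let M := W1inf_norm p1 p2 u du in
  (forall k : nat, (1 <= k <= 6)%nat ->
     0 <= Rcst1 mu gam L M0 M k /\ 0 < beta1 delta k) /\
  (forall k : nat, (1 <= k <= 2)%nat ->
     0 <= Rcst2 p1 p2 mu gam L M k /\ 0 < beta2 delta k) /\
  (forall w : R, 0 < w ->
     Cmod (I1 p1 p0 c mu w u
           - Ktilde p1 p0 c mu w u
               * RtoC (Rpower (p0 - p1) (- mu)) * RtoC (Rpower w (- mu))
           - RtoC (1 / 2) * Htilde p0 c w u
               * RtoC (Rpower (p0 - p1) (mu - 1))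
               * RtoC (Rpower w (- (1 / 2))))%C
     <= sum_n_m (fun k => Rcst1 mu gam L M0 M k
                   * Rpower (p0 - p1) (- alpha1 mu gam k)
                   * Rpower w (- beta1 delta k)) 1 6
     /\
     Cmod (I2 p1 p2 p0 c mu w u
           - RtoC (1 / 2) * Htilde p0 c w u
               * RtoC (Rpower (p0 - p1) (mu - 1))
               * RtoC (Rpower w (- (1 / 2))))%C
     <= sum_n_m (fun k => Rcst2 p1 p2 mu gam L M k
                   * Rpower (p0 - p1) (- alpha2 mu k)
                   * Rpower w (- beta2 delta k)) 1 2).

Proof.
intros gam L M0 M.
destruct (C1_on_extension p1 p2 u du Hp Hu) as (v & dv & Dv & Cdv & Hvu & Hdv).
assert (Cv : forall x, contC v x) by (intros x; eapply is_derC_contC; apply Dv).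
assert (B0 : forall x, p1 <= x <= p2 -> Cmod (u x) <= M0) by now apply (Cmod_le_Linf_norm p1 p2 u v).
assert (B1 : forall x, p1 <= x <= p2 -> Cmod (du x) <= Linf_norm p1 p2 du) by now apply (Cmod_le_Linf_norm p1 p2 du dv).
assert (HM0 : 0 <= M0) by (generalize (B0 p1 ltac:(lra)) (Cmod_ge_0 (u p1)); lra).
assert (HM1 : 0 <= Linf_norm p1 p2 du) by (generalize (B1 p1 ltac:(lra)) (Cmod_ge_0 (du p1)); lra).
assert (EM : M = M0 + Linf_norm p1 p2 du) by reflexivity.
assert (HM : 0 <= M) by lra.
assert (HB : forall x, p1 <= x <= p2 -> Cmod (v x) <= M0 /\ Cmod (v x) <= M /\ Cmod (dv x) <= M).
{ intros x Hx; rewrite Hvu, Hdv by exact Hx; generalize (B0 x Hx) (B1 x Hx); lra. }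
assert (Hg : 0 < gam < 1) by (unfold gam; lra).
assert (Hpow : forall x a, 0 <= Rpower x a) by (intros; left; apply Rpower_pos).
assert (Hipow : forall x a, 0 <= / Rpower x a) by (intros; left; apply Rinv_0_lt_compat, Rpower_pos).
assert (Himu : 0 <= / mu) by (left; apply Rinv_0_lt_compat; lra).
assert (Higam : 0 <= / (1 - gam)) by (left; apply Rinv_0_lt_compat; lra).
assert (Hspi : 0 <= sqrt PI) by (generalize sqrt_PI_ge_1; lra).
assert (HL : 0 <= L) by (apply Rmult_le_pos; [lra | apply Hpow]).
assert (HKpi := inv_sqrt_PI_le_root K HK0 HK).
split; [|split].
- intros k Hk.
  destruct k as [|[|[|[|[|[|[|k]]]]]]]; try lia; simpl; (split; [|lra]); repeat apply Rmult_le_pos; auto; lra.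
- intros k Hk.
  destruct k as [|[|[|k]]]; try lia; simpl; (split; [|lra]); repeat apply Rmult_le_pos; auto; lra.
- intros w Hw; split.
  + do 5 rewrite sum_n_Sm by lia; rewrite sum_n_n; unfold plus; simpl.
    eapply Rle_trans.
    { apply (I1_error_le p1 p2 p0 c mu w M0 M delta K u v dv); assumption. }
    fold gam L; set (d := p0 - p1).
    assert (Hd : 0 < d) by (unfold d; lra).
    assert (N1 := singular_bound d w mu M Hd Hw Hmu HM).
    assert (N2 := stationary_left_bound d w mu gam delta L M Hd Hg Hmu HM HL).
    (* The midpoint estimate has 1 where the stated constant of index 6 has sqrt(pi). *)
    assert (N3 : Rpower 2 (2 - mu) * M0 * Rpower d (- (3 - mu)) * Rpower w (- (3 / 2))
      <= sqrt PI / Rpower 2 (mu - 2) * M0 * Rpower d (- (3 - mu)) * Rpower w (- (3 / 2))).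
    { do 2 (apply Rmult_le_compat_r; [left; apply Rpower_pos|]); apply Rmult_le_compat_r; [exact HM0|].
      replace (2 - mu) with (- (mu - 2)) by ring; rewrite Rpower_Ropp.
      rewrite <- (Rmult_1_l (/ Rpower 2 (mu - 2))).
      apply Rmult_le_compat_r; [left; apply Rinv_0_lt_compat, Rpower_pos | exact sqrt_PI_ge_1]. }
    lra.
  + rewrite sum_n_Sm by lia; rewrite sum_n_n; unfold plus; simpl.
    eapply Rle_trans.
    { apply (I2_error_le p1 p2 p0 c mu w M delta K u v dv); try assumption.
      intros x Hx; apply HB, Hx. }
    fold gam L; set (d := p0 - p1).
    assert (N := stationary_right_bound d (p2 - p0) w mu gam delta L M ltac:(lra) ltac:(unfold d; lra) Hg Hmu HM HL).
    replace (p2 - p0 + d) with (p2 - p1) in N by (unfold d; ring).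
    exact N.
Qed.
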